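(* Let $W(x) = \frac12 |x|$ on $\mathbb{R}$. Let $\rho_0 \in \mathcal{P}_2(\mathbb{R})$, let $c > 1/2$ and set $\sigma_0 = a[\rho_0]\rho_0$. There exists a constant $C>0$ such that, for every $\varepsilon > 0$, denoting by $(\rho^\varepsilon, \sigma^\varepsilon)$ the solution of the relaxation system $$\partial_t \rho + \partial_x \sigma = 0, \qquad \partial_t \sigma + c^2 \partial_x \rho = \frac{1}{\varepsilon}\big(a[\rho]\rho - \sigma\big), \qquad a[\rho] = -W' * \rho,$$ with initial data $(\rho_0, \sigma_0)$, one has $$\forall T>0, \qquad W_1\big(\rho(T), \rho^\varepsilon(T)\big) \leq C\big(\sqrt{\varepsilon T} + \varepsilon\big),$$ where $\rho \in C([0,+\infty), \mathcal{P}_2(\mathbb{R}))$ is the unique solution of the aggregation equation $\partial_t \rho + \partial_x(a[\rho]\rho) = 0$ with initial datum $\rho_0$.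
   Context: $\mathcal{P}_2(\mathbb{R})$ is the set of Borel probability measures on $\mathbb{R}$ with finite second moment. $W_1$ is the Wasserstein distance of order 1; in one dimension $W_1(\mu,\nu) = \int_0^1 |F_\mu^{-1}(z) - F_\nu^{-1}(z)|\,dz$ where $F_\mu(x) = \mu((-\infty,x))$ and $F_\mu^{-1}(z) = \inf\{x : F_\mu(x) > z\}$. For $W(x)=\frac12|x|$ one takes $W'(x) = \frac12\mathrm{sgn}(x)$. The relaxation system is understood through the cumulative variables $u^\varepsilon(t,x) = \frac12 - \int_{-\infty}^x \rho^\varepsilon(t,dy)$, $v^\varepsilon(t,x) = \frac12 - \int_{-\infty}^x \sigma^\varepsilon(t,dy)$, which solve $\partial_t u + \partial_x v = 0$, $\partial_t v + c^2 \partial_x u = \frac1\varepsilon(\frac12 u^2 - v)$ (one has $a[\rho^\varepsilon] = u^\varepsilon$, $\rho^\varepsilon = -\partial_x u^\varepsilon$). The solution $\rho$ of the aggregation equation is characterized by $\rho(t) = -\partial_x u(t)$, where $u$ is the entropy solution of the Burgers equation $\partial_t u + \frac12\partial_x(u^2)=0$ with initial datum $u_0(x) = \frac12 - \rho_0((-\infty,x))$. *)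

(* Defs.v *)
From HB Require Import structures.
From mathcomp Require Import all_boot all_order all_algebra.
From mathcomp Require Import all_classical all_reals all_analysis.
Set Implicit Arguments. Unset Strict Implicit. Unset Printing Implicit Defensive.
Import Order.TTheory GRing.Theory Num.Theory.
Import numFieldNormedType.Exports.
Local Open Scope classical_set_scope.
Local Open Scope ring_scope.

Section Defs.
Variable R : realType.

Notation leb := (@lebesgue_measure R).

Definition probR := probability (measurableTypeR R) R.

Definition second_moment (mu : probR) : Prop :=
  (\int[mu]_x ((x ^+ 2)%:E) < +oo)%E.

Definition cdfL (mu : probR) (x : R) : R := fine (mu `]-oo, x[%classic).

Definition quantile (mu : probR) (z : R) : R := inf [set x | z < cdfL mu x].

Definition W1 (mu nu : probR) : \bar R :=
  (\int[leb]_(z in `[0%R, 1%R]%classic) (`|quantile mu z - quantile nu z|)%:E)%E.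

(* a[mu](y) = - (W' * mu)(y) = - int (1/2) sgn(y - z) dmu(z) *)
Definition avel (mu : probR) (y : R) : R :=
  - fine (\int[mu]_z ((2^-1 * Num.sg (y - z))%:E))%E.

(* cumulative variables of rho_0 and sigma_0 = a[rho0] rho0 *)
Definition u_of (mu : probR) (x : R) : R := 2^-1 - cdfL mu x.
Definition v0_of (mu : probR) (x : R) : R :=
  2^-1 - fine (\int[mu]_(y in `]-oo, x[%classic) ((avel mu y)%:E))%E.

Definition dt (phi : R -> R -> R) (t x : R) : R := derive1 (fun s => phi s x) t.
Definition dx (phi : R -> R -> R) (t x : R) : R := derive1 (phi t) x.

Definition testfun (phi : R -> R -> R) : Prop :=
  [/\ (exists M : R, forall t x, phi t x != 0 -> `|t| <= M /\ `|x| <= M),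
      continuous (fun p : R * R => phi p.1 p.2),
      forall t x, derivable (fun s => phi s x) t 1 /\ derivable (phi t) x 1,
      continuous (fun p : R * R => dt phi p.1 p.2)
    & continuous (fun p : R * R => dx phi p.1 p.2)].

Definition int_QT (g : R -> R -> R) : \bar R :=
  (\int[leb]_(t in `[0%R, +oo[%classic) \int[leb]_x (g t x)%:E)%E.

Definition int_R (g : R -> R) : \bar R := (\int[leb]_x (g x)%:E)%E.

Definition narrow_cont (rho : R -> probR) : Prop :=
  forall f : R -> R, continuous f -> (exists M, forall x, `|f x| <= M) ->
    {within `[0, +oo[, continuous (fun t => fine (\int[rho t]_x (f x)%:E))%E}.

(* Solution of the relaxation system, in the cumulative variables
   u(t,x) = 1/2 - rho(t)((-oo,x)), v : weak (distributional) solution of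
     d_t u + d_x v = 0,  d_t v + c^2 d_x u = (1/eps)(u^2/2 - v)
   with initial data u_0 = u_of rho0, v_0 = v0_of rho0. *)
Definition relax_solution (c eps : R) (rho0 : probR) (rho : R -> probR)
    (v : R -> R -> R) : Prop :=
  [/\ rho 0 = rho0, narrow_cont rho,
      measurable_fun setT (fun p : R * R => v p.1 p.2) /\
      (exists M : R, forall t x, `| v t x | <= M),
      forall phi, testfun phi ->
        (int_QT (fun t x => (u_of (rho t) x * dt phi t x + v t x * dx phi t x)%R)
         + int_R (fun x => (u_of rho0 x * phi 0 x)%R))%E = 0%E
    & forall phi, testfun phi ->
        (int_QT (fun t x => (v t x * dt phi t x
                   + c ^+ 2 * u_of (rho t) x * dx phi t x
                   + eps^-1 * (2^-1 * u_of (rho t) x ^+ 2 - v t x) * phi t x)%R)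
         + int_R (fun x => (v0_of rho0 x * phi 0 x)%R))%E = 0%E].

(* Solution of the aggregation equation: rho(t) = - d_x u(t), where u is the
   (Kruzhkov) entropy solution of Burgers d_t u + d_x (u^2/2) = 0 with
   u(0) = u_0 = u_of rho0 (entropy inequalities with initial term, for all
   constants k and all nonnegative C^1 compactly supported test functions). *)
Definition aggregation_solution (rho0 : probR) (rho : R -> probR) : Prop :=
  [/\ rho 0 = rho0, narrow_cont rho,
      forall t, 0 <= t -> second_moment (rho t)
    & forall (k : R) phi, testfun phi -> (forall t x, 0 <= phi t x) ->
        (0%E <= int_QT (fun t x =>
                  (`|u_of (rho t) x - k| * dt phi t x
                  + Num.sg (u_of (rho t) x - k)
                    * (2^-1 * u_of (rho t) x ^+ 2 - 2^-1 * k ^+ 2) * dx phi t x)%R)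
                + int_R (fun x => (`|u_of rho0 x - k| * phi 0 x)%R))%E].

End Defs.

(* Main.v *)
(**
  In the relaxation system, [l u + v] relaxes for [l = c, -c] towards [N_l(u) = l u + u^2/2]
  along the characteristics of speed [l]; Duhamel's formula expresses it, up to a function of
  [t], as an exponential average [K_l] of [N_l(u)] over the past of these characteristics.
  Hence [u^eps] solves [d_t u + d_x w = 0] with the explicit flux [w = (K_c + K_(-c)) / 2].
  For [c > 1/2], [N_c] increases and [N_(-c)] decreases on [[-1/2, 1/2]], so the conservation
  laws in the frames moving at speeds [c] and [-c] show that [u^eps(t, .)] is monotone in [t]
  along each family of characteristics.  Consequently the defect [w - (u^eps)^2 / 2] is
  nonnegative and of integral at most [2 c^2 eps] at all times.

  Since the limit [u] and [u^eps] are nonincreasing in [x], no entropy method is needed: for [u]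
  only the weak form of the Burgers equation is used, and
  [D(t, x) = int_0^t (w - u^2/2)(s, x) ds], whose derivative in [x] is [u - u^eps], is transported
  with the nonincreasing velocity [(u + u^eps) / 2] and fed by the defect.  So the integral of
  [|D(T, .)|] is at most [2 c^2 eps T], and interpolating with the monotonicity of [u] and
  [u^eps] bounds the integral of [|u - u^eps|], which dominates [W1], by [4 sqrt (2 c^2 eps T)].
*)
Require Import Defs.
From HB Require Import structures.
From mathcomp Require Import all_boot all_order all_algebra.
From mathcomp Require Import all_classical all_reals all_analysis.
From mathcomp Require Import measurable_realfun ring lra.
Set Implicit Arguments. Unset Strict Implicit. Unset Printing Implicit Defensive.
Import Order.TTheory GRing.Theory Num.Theory.
Import numFieldNormedType.Exports.
Local Open Scope classical_set_scope.
Local Open Scope ring_scope.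

(** * Locally bounded measurable functions and their integrals *)

(** The obstacle is regularity: [V] is only bounded and measurable, and [U] only narrowly continuous
    in time, so the equations cannot be read pointwise. The explicit flux removes this: [kinetic] is
    built from [U] alone and inherits its left continuity and monotonicity in space, so that the
    balance laws hold on every interval and at every time. The monotonicity along characteristics
    then comes from a short loop: in the frame of speed [- l] the flux of [U] is [l U + V], that is
    [K_l] up to a function of time; as an average of monotone functions [N_l(U)] it is monotone in
    space, and a monotone flux makes the integral of [U] over every moving interval monotone in
    time. The bound [2 c^2 eps] is the oscillation [c] of [N_l] on [[-1/2, 1/2]], times the distance
    [2 c (t - s)] of the two characteristics at time [s], averaged over the past. Since [u] and [U]
    may jump, the differential inequalities are proved by adding increments over fine partitions,
    with errors quadratic in the step or equal to the step times an increment of a monotone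
    function. *)

Section LocallyBounded.
Variable R : realType.
Implicit Types (f g h : R -> R) (F G H : R -> R -> R).

(** This class is closed under composition as well as arithmetic and is integrable on every compact
    interval, so the side conditions of all integrals below are discharged by the syntax-directed
    tactic [lbt]. *)
Definition lb f : Prop := measurable_fun setT f /\
  forall M : R, exists B : R, forall x, `|x| <= M -> `|f x| <= B.

Definition lb2 F : Prop := measurable_fun setT (fun p : R * R => F p.1 p.2) /\
  forall M : R, exists B : R, forall t x, `|t| <= M -> `|x| <= M -> `|F t x| <= B.

Lemma lb_cst k : lb (fun=> k).
Proof. by split=> [|M]; [exact: measurable_cst|exists `|k|]. Qed.

Lemma lb_id : lb id.
Proof. by split=> [|M]; [exact: measurable_id|exists M]. Qed.

Lemma lb_comp f g : lb f -> lb g -> lb (fun x => f (g x)).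
Proof.
move=> [mf bf] [mg bg]; split=> [|M]; first exact: measurableT_comp.
have [B gB] := bg M; have [C fC] := bf B; exists C => x xM.
by apply: fC; apply: gB.
Qed.

Lemma lb_continuous f : continuous f -> lb f.
Proof.
move=> cf; split=> [|M]; first exact: continuous_measurable_fun.
have : compact (f @` `[- M, M]).
  apply: continuous_compact; last exact: segment_compact.
  exact: continuous_subspaceT.
move=> /compact_bounded [B [_ Bf]].
exists (B + 1) => x; rewrite ler_norml => xM.
apply: (Bf (B + 1)); first by rewrite ltrDl.
by exists x => //=; rewrite in_itv.
Qed.

Lemma lb_bounded f B : measurable_fun setT f -> (forall x, `|f x| <= B) -> lb f.
Proof. by move=> mf fB; split=> // M; exists B. Qed.

Lemma lb2_lb2 F G H : lb2 F -> lb2 G -> lb2 H ->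
  lb2 (fun t x => F (G t x) (H t x)).
Proof.
move=> [mF bF] [mG bG] [mH bH]; split=> [|M].
  apply: (@measurableT_comp _ _ _ _ _ _ (fun p : R * R => F p.1 p.2) _
    (fun p : R * R => (G p.1 p.2, H p.1 p.2))) => //.
  exact: measurable_fun_pair.
have [B gB] := bG M; have [C hC] := bH M; have [D fD] := bF (Num.max B C).
by exists D => t x tM xM; apply: fD; rewrite le_max ?gB ?hC ?orbT.
Qed.

Lemma lb2_fst : lb2 (fun t _ => t).
Proof. by split=> [|M]; [exact: measurable_fst|exists M]. Qed.

Lemma lb2_snd : lb2 (fun _ x => x).
Proof. by split=> [|M]; [exact: measurable_snd|exists M]. Qed.

Lemma lb_lb2 f G : lb f -> lb2 G -> lb2 (fun t x => f (G t x)).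
Proof.
move=> [mf bf] [mG bG]; split=> [|M].
  exact: (@measurableT_comp _ _ _ _ _ _ f _ (fun p : R * R => G p.1 p.2)).
have [B gB] := bG M; have [C fC] := bf B; exists C => t x tM xM.
by apply: fC; apply: gB.
Qed.

Lemma lb2_lb F g h : lb2 F -> lb g -> lb h -> lb (fun x => F (g x) (h x)).
Proof.
move=> [mF bF] [mg bg] [mh bh]; split=> [|M].
  apply: (@measurableT_comp _ _ _ _ _ _ (fun p : R * R => F p.1 p.2) _
    (fun x => (g x, h x))) => //.
  exact: measurable_fun_pair.
have [B gB] := bg M; have [C hC] := bh M; have [D fD] := bF (Num.max B C).
by exists D => x xM; apply: fD; rewrite le_max ?gB ?hC ?orbT.
Qed.

Lemma lb2_l F t : lb2 F -> lb (F t).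
Proof. by move=> bF; exact: (lb2_lb bF (lb_cst t) lb_id). Qed.

Lemma lb2_cst k : lb2 (fun _ _ => k).
Proof. exact: (lb_lb2 (lb_cst k) lb2_fst). Qed.

Lemma lb2_add : lb2 (fun t x => t + x).
Proof.
split=> [|M]; first by apply: measurable_funD.
by exists (M + M) => t x tM xM; rewrite (le_trans (ler_normD _ _))// lerD.
Qed.

Lemma lb2_mul : lb2 (fun t x => t * x).
Proof.
split=> [|M]; first by apply: measurable_funM.
by exists (M * M) => t x tM xM; rewrite normrM ler_pM.
Qed.

Lemma lb2_max : lb2 (fun t x => Num.max t x).
Proof.
split=> [|M]; first exact: measurable_maxr.
by exists M => t x tM xM; rewrite /Num.max; case: ifP.
Qed.

Lemma lb2_min : lb2 (fun t x => Num.min t x).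
Proof.
split=> [|M]; first exact: measurable_minr.
by exists M => t x tM xM; rewrite /Num.min; case: ifP.
Qed.

Lemma lb2_le : lb2 (fun t x => (t <= x)%R%:R).
Proof.
split=> [|M]; last by exists 1 => t x _ _; case: (t <= x); rewrite ?normr1 ?normr0.
rewrite (_ : (fun p => _) = \1_[set p : R * R | p.1 <= p.2]); last first.
  apply/funext => p; rewrite indicE; congr (nat_of_bool _)%:R.
  by apply/idP/idP; rewrite inE.
apply/measurable_indicP.
have := measurable_fun_ler (@measurable_fst _ _ (measurableTypeR R) (measurableTypeR R))
  (@measurable_snd _ _ (measurableTypeR R) (measurableTypeR R)).
move=> /(_ measurableT [set true]).
rewrite setTI; apply => //.
Qed.

Lemma lb_addl k : lb (+%R k).
Proof. exact: lb2_l k lb2_add. Qed.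

Lemma lb_mull k : lb ( *%R k).
Proof. exact: lb2_l k lb2_mul. Qed.

Lemma lb_opp : lb (fun x => - x).
Proof. by apply: lb_continuous => x; exact: oppr_continuous. Qed.

Lemma lb_norm : lb (fun x => `|x|).
Proof. by apply: lb_continuous => x; exact: norm_continuous. Qed.

Lemma lb_exp : lb (@expR R).
Proof. exact: (lb_continuous (@continuous_expR _)). Qed.

Lemma lb_pow n : lb (fun x => x ^+ n).
Proof. by apply: lb_continuous => x; exact: exprn_continuous. Qed.

Lemma lb_nincr f B : {homo f : x y / x <= y >-> y <= x} ->
  (forall x, `|f x| <= B) -> lb f.
Proof.
by move=> fi; apply: lb_bounded; apply: nonincreasing_measurable => // x y _ _; exact: fi.
Qed.

End LocallyBounded.

(** One step strips the head operation of the function by second-order matching. The pattern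
    [_ *+ nat_of_bool _] is the form of an indicator [(t <= x)%:R]. *)
Ltac lb_step := first
  [ assumption
  | exact: lb_cst | exact: lb_id | exact: lb_addl | exact: lb_mull
  | exact: lb_opp | exact: lb_norm | exact: lb_exp
  | exact: lb2_cst | exact: lb2_fst | exact: lb2_snd
  | match goal with
    | |- lb (fun x => ?h) => exact: (lb_cst h)
    | H : lb2 ?f |- lb (?f _) => exact: (lb2_l _ H)
    | H : lb ?f |- lb (fun x => ?f (@?g x)) => apply: (lb_comp H)
    | H : lb2 ?f |- lb (fun x => ?f (@?g x) (@?h x)) => apply: (lb2_lb H)
    | H : forall k, lb (?f k) |- lb (?f _) => exact: H
    | H : forall k, lb (?f k) |- lb (fun x => ?f ?k (@?g x)) => apply: (lb_comp (H k))
    | |- lb (fun x => @?f x + @?g x) => apply: (lb2_lb (@lb2_add _))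
    | |- lb (fun x => - (@?f x)) => apply: (lb_comp (@lb_opp _))
    | |- lb (fun x => @?f x * @?g x) => apply: (lb2_lb (@lb2_mul _))
    | |- lb (fun x => Num.max (@?f x) (@?g x)) => apply: (lb2_lb (@lb2_max _))
    | |- lb (fun x => Num.min (@?f x) (@?g x)) => apply: (lb2_lb (@lb2_min _))
    | |- lb (fun x => `|@?f x|) => apply: (lb_comp (@lb_norm _))
    | |- lb (fun x => (@?f x) ^+ ?n) => apply: (lb_comp (@lb_pow _ n))
    | |- lb (fun x => expR (@?f x)) => apply: (lb_comp (@lb_exp _))
    | |- lb (fun x => _ *+ nat_of_bool _) => apply: (lb2_lb (@lb2_le _))
    | H : lb ?f |- lb2 (fun t x => ?f (@?g t x)) => apply: (lb_lb2 H)
    | H : lb2 ?f |- lb2 (fun t x => ?f (@?g t x) (@?h t x)) => apply: (lb2_lb2 H)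
    | |- lb2 (fun t x => @?f t x + @?g t x) => apply: (lb2_lb2 (@lb2_add _))
    | |- lb2 (fun t x => - (@?f t x)) => apply: (lb_lb2 (@lb_opp _))
    | |- lb2 (fun t x => @?f t x * @?g t x) => apply: (lb2_lb2 (@lb2_mul _))
    | |- lb2 (fun t x => Num.max (@?f t x) (@?g t x)) => apply: (lb2_lb2 (@lb2_max _))
    | |- lb2 (fun t x => Num.min (@?f t x) (@?g t x)) => apply: (lb2_lb2 (@lb2_min _))
    | |- lb2 (fun t x => `|@?f t x|) => apply: (lb_lb2 (@lb_norm _))
    | |- lb2 (fun t x => (@?f t x) ^+ ?n) => apply: (lb_lb2 (@lb_pow _ n))
    | |- lb2 (fun t x => expR (@?f t x)) => apply: (lb_lb2 (@lb_exp _))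
    | |- lb2 (fun t x => _ *+ nat_of_bool _) => apply: (lb2_lb2 (@lb2_le _))
    end ].
Ltac lbt := repeat lb_step.

(** * Integrals over compact intervals: additivity, translation, Fubini, dominated convergence *)

Section IntervalIntegral.
Variable R : realType.
Notation leb := (@lebesgue_measure R).
Implicit Types (a b c k : R) (f g h : R -> R) (F G : R -> R -> R).

(* [J a b f] is 0 when [b < a]: there is no orientation. *)
Definition J a b f : R := \int[leb]_(x in `[a, b]) f x.

Lemma lb_integrable a b f : lb f -> leb.-integrable `[a, b] (EFin \o f).
Proof.
move=> [mf bf]; apply: measurable_bounded_integrable => //.
- have := @lebesgue_measure_itv R `[a, b]; rewrite /= => ->.
  by case: ifPn => _; rewrite ?ltry// -EFinD ltry.
- exact: measurable_funTS.
- have [B fB] := bf (`|a| + `|b|); exists B; split; first exact: num_real.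
  move=> M BM x /=; rewrite in_itv/= => /andP[ax xb].
  apply: (le_trans (fB x _) (ltW BM)); rewrite ler_norml.
  have := ler_norm b; have := ler_norm (- a); rewrite normrN.
  have := normr_ge0 a; have := normr_ge0 b.
  by move=> *; apply/andP; split; lra.
Qed.
Hint Resolve lb_integrable : core.

Lemma J_EFin a b f : lb f -> (\int[leb]_(x in `[a, b]) (f x)%:E)%E = (J a b f)%:E.
Proof. by move=> bf; rewrite fineK//; apply: integrable_fin_num => //; exact: lb_integrable. Qed.

Lemma eq_J a b f g : (forall x, a <= x <= b -> f x = g x) -> J a b f = J a b g.
Proof. by move=> fg; apply: eq_Rintegral => x; rewrite inE/= in_itv/=; exact: fg. Qed.

Lemma J_add a b f g : lb f -> lb g ->
  J a b (fun x => f x + g x) = J a b f + J a b g.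
Proof. by move=> bf bg; rewrite /J RintegralD//; exact: lb_integrable. Qed.

Lemma J_sub a b f g : lb f -> lb g ->
  J a b (fun x => f x - g x) = J a b f - J a b g.
Proof. by move=> bf bg; rewrite /J RintegralB//; exact: lb_integrable. Qed.

Lemma J_mull a b k f : lb f -> J a b (fun x => k * f x) = k * J a b f.
Proof. by move=> bf; rewrite /J RintegralZl//; exact: lb_integrable. Qed.

Lemma J_mulr a b k f : lb f -> J a b (fun x => f x * k) = J a b f * k.
Proof. by move=> bf; rewrite /J RintegralZr//; exact: lb_integrable. Qed.

Lemma J_opp a b f : lb f -> J a b (fun x => - f x) = - J a b f.
Proof.
by move=> bf; rewrite -mulN1r -J_mull//; apply: eq_J => x _; rewrite mulN1r.
Qed.

Lemma J_cst a b k : a <= b -> J a b (fun=> k) = k * (b - a).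
Proof.
move=> ab; rewrite /J Rintegral_cst//.
have := @lebesgue_measure_itv R `[a, b]; rewrite /= => ->.
rewrite lte_fin; by case: ltgtP ab => // -> _; rewrite subrr.
Qed.

Lemma J_xx a f : J a a f = 0.
Proof. by rewrite /J set_itv1 Rintegral_set1. Qed.

Lemma J_cat a b c f : lb f -> a <= b <= c -> J a c f = J a b f + J b c f.
Proof.
move=> bf /andP[ab bc].
have := @Rintegral_itvB R f (BLeft a) (BRight c) b.
rewrite !bnd_simp => /(_ (lb_integrable _ _ bf) ab bc) /eqP.
rewrite subr_eq => /eqP; rewrite Rintegral_itv_obnd_cbnd; first by rewrite /J addrC.
apply: integrableS (lb_integrable b c bf) => //.
by apply: subset_itvr; rewrite bnd_simp.
Qed.

Lemma le_J a b f g : lb f -> lb g -> (forall x, a <= x <= b -> f x <= g x) ->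
  J a b f <= J a b g.
Proof.
by move=> bf bg fg; apply: le_Rintegral => //; exact: lb_integrable.
Qed.

Lemma J_ge0 a b f : (forall x, a <= x <= b -> 0 <= f x) -> 0 <= J a b f.
Proof. by move=> f0; apply: Rintegral_ge0 => x /=; rewrite in_itv; exact: f0. Qed.

Lemma J_norm a b f : lb f -> `|J a b f| <= J a b (fun x => `|f x|).
Proof. by move=> bf; apply: le_normr_Rintegral => //; exact: lb_integrable. Qed.

Lemma J_le_cst a b f k : lb f -> a <= b -> (forall x, a <= x <= b -> f x <= k) ->
  J a b f <= k * (b - a).
Proof. by move=> bf ab fk; rewrite -J_cst//; apply: le_J => //; exact: lb_cst. Qed.

Lemma J_ge_cst a b f k : lb f -> a <= b -> (forall x, a <= x <= b -> k <= f x) ->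
  k * (b - a) <= J a b f.
Proof. by move=> bf ab fk; rewrite -J_cst//; apply: le_J => //; exact: lb_cst. Qed.

Lemma J_le_norm a b f k : lb f -> a <= b -> (forall x, a <= x <= b -> `|f x| <= k) ->
  `|J a b f| <= k * (b - a).
Proof.
move=> bf ab fk; rewrite (le_trans (J_norm _ _ bf))//.
by apply: J_le_cst => //; lbt.
Qed.

Lemma le_J_itv a b c d f : lb f -> (forall x, 0 <= f x) -> c <= a -> a <= b -> b <= d ->
  J a b f <= J c d f.
Proof.
move=> bf f0 ca ab bd; rewrite (@J_cat c a d)//; last by rewrite ca (le_trans ab).
rewrite (@J_cat a b d)//; last by rewrite ab bd.
by rewrite addrCA lerDl addr_ge0// J_ge0.
Qed.

Lemma lebesgue_measure_shift k (A : set R) : measurable A ->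
  leb ((fun x => x + k) @^-1` A) = leb A.
Proof.
have mk : measurable_fun setT (fun x : R => x + k) by exact: measurable_funD.
move=> mA.
pose mu := pushforward leb (fun x : R => x + k : measurableTypeR R).
suff -> : leb A = mu A by [].
apply: (@lebesgue_measure_unique R) => // _ [[x y] _ <-].
have E : (fun x : R => x + k) @^-1` `]x, y] = `]x - k, y - k]%classic.
  by apply/seteqP; split=> z /=; rewrite !in_itv/= ltrBlDr lerBrDr.
transitivity (leb `]x - k, y - k]%classic); last by rewrite -E.
rewrite !lebesgue_measure_itv/= !lte_fin ltrD2r.
by case: ifPn => // _; rewrite -!EFinB; congr (_%:E); lra.
Qed.

Lemma ge0_integral_shift k (f : R -> \bar R) : measurable_fun setT f ->
  (forall x, 0 <= f x)%E -> (\int[leb]_x f (x + k)%R = \int[leb]_x f x)%E.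
Proof.
have mk : measurable_fun setT (fun x : R => x + k) by exact: measurable_funD.
move=> mf f0.
have := @ge0_integral_pushforward _ _ (measurableTypeR R) (measurableTypeR R) R _ mk leb setT f measurableT mf (fun x _ => f0 x).
rewrite preimage_setT => <-.
apply: eq_measure_integral => A mA _.
by rewrite /= /pushforward; exact: lebesgue_measure_shift.
Qed.

Lemma integral_shift k (f : R -> \bar R) : measurable_fun setT f ->
  (\int[leb]_x f (x + k)%R = \int[leb]_x f x)%E.
Proof.
move=> mf; rewrite [RHS]integralE [LHS]integralE.
rewrite -(ge0_integral_shift k (measurable_funepos mf))//.
rewrite -[in RHS](ge0_integral_shift k (measurable_funeneg mf))//.
by congr (_ - _)%E; apply: eq_integral => x _; rewrite ?funeposE ?funenegE.
Qed.

Lemma J_shift a b k f : lb f -> J a b (fun x => f (x + k)) = J (a + k) (b + k) f.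
Proof.
move=> bf; rewrite /J /Rintegral; congr fine.
rewrite integral_mkcond [RHS]integral_mkcond.
rewrite -[RHS](@integral_shift k ((EFin \o f) \_ `[a + k, b + k])); last first.
  apply: (measurable_restrictT (EFin \o f) (measurable_itv `[a + k, b + k])).1.
  apply: measurable_funTS.
  by apply/measurable_EFinP; exact: bf.1.
apply: eq_integral => x _; rewrite /patch.
have -> : (x + k \in `[a + k, b + k]%classic) = (x \in `[a, b]%classic) => //.
by apply/idP/idP; rewrite !inE/= !in_itv/= !lerD2r.
Qed.

Lemma J_gt a b f : b < a -> J a b f = 0.
Proof. by move=> ba; rewrite /J set_itv_ge ?Rintegral_set0// bnd_simp -ltNge. Qed.

Lemma measurable_integral_section (g : R * R -> \bar R) :
  measurable_fun setT g -> measurable_fun setT (fun t => \int[leb]_x g (t, x))%E.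
Proof.
move=> mg; have -> : (fun t => \int[leb]_x g (t, x))%E =
    (fun t => \int[leb]_x g^\+ (t, x) - \int[leb]_x g^\- (t, x))%E.
  apply/funext => t; rewrite integralE; congr (_ - _)%E;
  by apply: eq_integral => x _; rewrite ?funeposE ?funenegE.
apply: emeasurable_funB.
- apply: (@measurable_fun_fubini_tonelli_F _ _ _ _ R leb g^\+%E).
  + exact: measurable_funepos.
  + by move=> x; exact: funepos_ge0.
- apply: (@measurable_fun_fubini_tonelli_F _ _ _ _ R leb g^\-%E).
  + exact: measurable_funeneg.
  + by move=> x; exact: funeneg_ge0.
Qed.

Lemma lb_J c d F : lb2 F -> lb (fun t => J c d (F t)).
Proof.
move=> bF; split.
  pose g := fun p : R * R => (F p.1 p.2 * (\1_`[c, d]%classic p.2))%:E.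
  have mg : measurable_fun setT g.
    apply/measurable_EFinP; apply: measurable_funM; first exact: bF.1.
    by apply: measurableT_comp => //; exact: measurable_indic.
  rewrite (_ : (fun t => _) = (fun t => fine (\int[leb]_x g (t, x))%E)).
    by apply: measurableT_comp => //; exact: measurable_integral_section.
  apply/funext => t; rewrite /J /Rintegral integral_mkcond; congr fine.
  apply: eq_integral => x _; rewrite /g /patch/= indicE.
  by case: (x \in _); rewrite ?mulr1 ?mulr0.
move=> M; have [B FB] := bF.2 (`|M| + (`|c| + `|d|)).
have [dc|cd] := ltP d c.
  by exists 0 => x _; rewrite J_gt// normr0.
exists (B * (d - c)) => t tM; apply: J_le_norm => //; first by lbt.
move=> x /andP[cx xd]; apply: FB.
  apply: (le_trans tM); have := ler_norm M; have := normr_ge0 c; have := normr_ge0 d.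
  by move=> *; lra.
rewrite ler_norml.
have := ler_norm d; have := ler_norm (- c); rewrite normrN.
have := normr_ge0 c; have := normr_ge0 d; have := normr_ge0 M.
by move=> *; apply/andP; split; lra.
Qed.

Lemma lb_J2 c d F : lb2 F -> lb (fun x => J c d (F ^~ x)).
Proof.
move=> bF; apply: (@lb_J c d (fun x t => F t x)).
by apply: (lb2_lb2 bF); lbt.
Qed.

Lemma J_swap a b c d F : lb2 F ->
  J a b (fun t => J c d (F t)) = J c d (fun x => J a b (F ^~ x)).
Proof.
move=> bF.
pose D : set (R * R) := `[a, b]%classic `*` `[c, d]%classic.
have mD : measurable D by exact: measurableX.
pose g := (fun p : R * R => (F p.1 p.2)%:E) \_ D.
have ig : (leb \x leb)%E.-integrable setT g.
  rewrite /g -integrable_mkcond//; apply: measurable_bounded_integrable => //.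
  - apply: (@le_lt_trans _ _ (leb `[a, b]%classic * leb `[c, d]%classic)%E).
      by rewrite -product_measure1E.
    have fin x y : leb `[x, y] \is a fin_num.
      have := @lebesgue_measure_itv R `[x, y]; rewrite /= => ->.
      by case: ifPn => _; rewrite // -EFinD.
    by rewrite ltey_eq fin_numM.
  - by apply: measurable_funTS; exact: bF.1.
  - have [B FB] := bF.2 ((`|a| + `|b|) + (`|c| + `|d|)).
    exists B; split; first exact: num_real.
    move=> M BM [x y] [] /=; rewrite !in_itv/= => /andP[ax xb] /andP[cy yd].
    apply: (le_trans (FB x y _ _) (ltW BM)); rewrite ler_norml;
    have := ler_norm d; have := ler_norm (- c); have := ler_norm b;
    have := ler_norm (- a); rewrite !normrN;
    have := normr_ge0 c; have := normr_ge0 d; have := normr_ge0 a;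
    have := normr_ge0 b; by move=> *; apply/andP; split; lra.
have := Fubini ig.
have H1 t : (\int[leb]_x g (t, x) = ((fun t => (J c d (F t))%:E) \_ `[a, b]) t)%E.
  rewrite /patch; case: ifPn => tab.
    rewrite -J_EFin; last by lbt.
    rewrite [RHS]integral_mkcond; apply: eq_integral => x _.
    rewrite /g /patch /D.
    suff -> : ((t, x) \in `[a, b]%classic `*` `[c, d]%classic) = (x \in `[c, d]%classic) by [].
    apply/idP/idP; rewrite !inE/= ; [by case|split => //].
    by move: tab; rewrite inE.
  rewrite integral0_eq// => x _; rewrite /g /patch ifF//.
  apply/negbTE; apply: contra tab; rewrite !inE; by case.
have H2 x : (\int[leb]_t g (t, x) = ((fun x => (J a b (F ^~ x))%:E) \_ `[c, d]) x)%E.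
  rewrite /patch; case: ifPn => xcd.
    rewrite -J_EFin; last by apply: (lb2_lb bF); lbt.
    rewrite [RHS]integral_mkcond; apply: eq_integral => t _.
    rewrite /g /patch /D.
    suff -> : ((t, x) \in `[a, b]%classic `*` `[c, d]%classic) = (t \in `[a, b]%classic) by [].
    apply/idP/idP; rewrite !inE/= ; [by case|split => //].
    by move: xcd; rewrite inE.
  rewrite integral0_eq// => t _; rewrite /g /patch ifF//.
  apply/negbTE; apply: contra xcd; rewrite !inE; by case.
have H1' : (\int[leb]_x \int[leb]_y g (x, y) = \int[leb]_x ((fun t => (J c d (F t))%:E) \_ `[a, b]) x)%E.
  by apply: eq_integral => x _; exact: H1.
have H2' : (\int[leb]_x \int[leb]_y g (y, x) = \int[leb]_x ((fun x => (J a b (F ^~ x))%:E) \_ `[c, d]) x)%E.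
  by apply: eq_integral => x _; exact: H2.
rewrite H1' H2' -!integral_mkcond J_EFin; last exact: lb_J.
by rewrite J_EFin => [[]|]; last exact: lb_J2.
Qed.

Lemma J_cvg a b (f : (R -> R)^nat) g B : (forall n, lb (f n)) -> lb g -> a <= b ->
  (forall n x, a <= x <= b -> `|f n x| <= B) ->
  (forall x, a <= x <= b -> f n x @[n --> \oo] --> g x) ->
  J a b (f n) @[n --> \oo] --> J a b g.
Proof.
move=> bf bg ab fB fg.
have := @dominated_convergence _ _ R leb `[a, b]%classic (measurable_itv _)
  (fun n x => (f n x)%:E) (EFin \o g) (fun=> B%:E).
case.
- by move=> n; apply/measurable_EFinP; apply: measurable_funTS; exact: (bf n).1.
- by apply/measurable_EFinP; apply: measurable_funTS; exact: bg.1.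
- apply: aeW => x /=; rewrite in_itv/= => xab.
  by apply/fine_cvgP; split; [exact: nearW|exact: fg].
- exact: (lb_integrable _ _ (lb_cst B)).
- by apply: aeW => x n /=; rewrite in_itv/= => xab; rewrite lee_fin; exact: fB.
move=> _ _; rewrite J_EFin// => /fine_cvgP[_]; exact.
Qed.

End IntervalIntegral.

(** * Increments over partitions, and primitives *)

Section Calculus.
Variable R : realType.
Implicit Types (a b c k : R) (f g h Q mu : R -> R) (F : R -> R -> R).

(* Sum the increments over a uniform partition of mesh tending to 0: neither Q nor mu
   has to be differentiable or continuous. *)
Lemma partition_le Q mu C a b : a <= b -> 0 <= C ->
  (forall x y, a <= x -> x <= y -> y <= b -> mu x <= mu y) ->
  (forall x y, a <= x -> x <= y -> y <= b ->
    Q y - Q x <= C * (y - x) * (mu y - mu x)) ->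
  Q b <= Q a.
Proof.
move=> ab C0 muI HQ.
have step (N : nat) : (0 < N)%N ->
    Q b - Q a <= C * ((b - a) / N%:R) * (mu b - mu a).
  move=> N0; have N0' : 0 < N%:R :> R by rewrite ltr0n.
  set hh := (b - a) / N%:R.
  have hh0 : 0 <= hh by rewrite divr_ge0 ?subr_ge0// ltW.
  have hN : hh * N%:R = b - a by rewrite /hh divfK// gt_eqF.
  have ile (i : nat) : (i <= N)%N -> a + hh * i%:R <= b.
    move=> iN; rewrite -lerBrDl -hN ler_wpM2l// ler_nat//.
  have ind (i : nat) : (i <= N)%N ->
      Q (a + hh * i%:R) - Q a <= C * hh * (mu (a + hh * i%:R) - mu a).
    elim: i => [_|i IH iN]; first by rewrite mulr0 addr0 !subrr mulr0.
    have := IH (ltnW iN).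
    have h1 : a <= a + hh * i%:R by rewrite lerDl mulr_ge0.
    have h2 : a + hh * i%:R <= a + hh * i.+1%:R.
      by rewrite lerD2l ler_wpM2l// ler_nat.
    have := HQ _ _ h1 h2 (ile _ iN).
    have -> : a + hh * i.+1%:R - (a + hh * i%:R) = hh by rewrite -natr1; ring.
    move=> *; lra.
  have := ind N (leqnn N).
  by rewrite hN (_ : a + (b - a) = b)//; ring.
rewrite leNgt; apply/negP => Qab.
set d := Q b - Q a; have d0 : 0 < d by rewrite subr_gt0.
set K := C * (b - a) * (mu b - mu a).
have := Num.Theory.archi_boundP (normr_ge0 (K / d)).
set N := Num.bound _ => HN.
have N0 : (0 < N)%N.
  by rewrite -(ltr0n R); apply: le_lt_trans HN.
have := step N N0.
have N0' : 0 < N%:R :> R by rewrite ltr0n.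
have -> : C * ((b - a) / N%:R) * (mu b - mu a) = K / N%:R by rewrite /K; field; rewrite gt_eqF.
rewrite ler_pdivlMr// -/d leNgt mulrC -ltr_pdivrMr// (le_lt_trans (ler_norm _) HN)//.
Qed.

(** Quadratic errors over N equal steps add up to a multiple of [(b - a)^2 / N]: this is
    [partition_le] with the identity as monotone function, for [Q] and for [- Q]. *)
Lemma partition_eq Q C a b : a <= b ->
  (forall x y, a <= x -> x <= y -> y <= b -> `|Q y - Q x| <= C * (y - x) ^+ 2) ->
  Q b = Q a.
Proof.
move=> ab HQ.
have HQ' x y : a <= x -> x <= y -> y <= b -> `|Q y - Q x| <= `|C| * (y - x) * (y - x).
  move=> ax xy yb; apply: (le_trans (HQ _ _ ax xy yb)).
  by rewrite -mulrA -expr2 ler_wpM2r ?sqr_ge0// ler_norm.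
apply/eqP; rewrite eq_le; apply/andP; split.
  apply: (@partition_le Q id `|C| a b) => // x y ax xy yb.
  exact: (le_trans (ler_norm _) (HQ' _ _ ax xy yb)).
rewrite -lerN2.
apply: (@partition_le (fun x => - Q x) id `|C| a b) => // x y ax xy yb.
apply: (le_trans (ler_norm _)); rewrite -opprD normrN.
exact: (HQ' _ _ ax xy yb).
Qed.

Lemma is_derive_continuous f f' : (forall x : R, is_derive x 1 f (f' x)) -> continuous f.
Proof.
move=> df x; apply: differentiable_continuous; apply/derivable1_diffP.
exact: (@ex_derive _ _ _ _ _ _ _ (df x)).
Qed.

Lemma mvt f f' a b : a <= b -> (forall x : R, is_derive x 1 f (f' x)) ->
  exists2 c, a <= c <= b & f b - f a = f' c * (b - a).
Proof.
move=> ab df.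
have cf := is_derive_continuous df.
have [c] := MVT_segment ab (fun x _ => df x) (continuous_subspaceT cf).
by rewrite in_itv => cab E; exists c.
Qed.

Lemma lipschitz_continuous f :
  (forall M : R, exists L : R, forall x y, `|x| <= M -> `|y| <= M -> `|f x - f y| <= L * `|x - y|) ->
  continuous f.
Proof.
move=> lf x; apply/cvgrPdist_le => e e0.
have [L HL] := lf (`|x| + 1).
have L0 : 0 < `|L| + 1 by rewrite ltr_wpDl.
near=> y.
have xy : `|x - y| <= Num.min 1 (e / (`|L| + 1)).
  near: y; apply/nbhs_ballP; exists (Num.min 1 (e / (`|L| + 1))).
    by rewrite /= lt_min ltr01 divr_gt0.
  by move=> y /ltW.
have xy1 : `|x - y| <= 1 by rewrite (le_trans xy)// ge_min lexx.
have := HL x y; rewrite lerDl ler01 => /(_ isT) /(_ _) /le_trans; apply.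
  have := ler_normB (x - y) x.
  rewrite (_ : x - y - x = - y); last by ring.
  rewrite normrN; move=> *; lra.
have xy2 : `|x - y| <= e / (`|L| + 1) by rewrite (le_trans xy)// ge_min lexx orbT.
rewrite ler_pdivlMr// in xy2; apply: le_trans xy2.
rewrite mulrC ler_wpM2l// (le_trans (ler_norm _))// lerDl//.
Unshelve. all: by end_near.
Qed.

Lemma lb_lipschitz f :
  (forall M : R, exists L : R, forall x y, `|x| <= M -> `|y| <= M -> `|f x - f y| <= L * `|x - y|) ->
  lb f.
Proof. by move=> /lipschitz_continuous; exact: lb_continuous. Qed.

Lemma primitive_lipschitz f M B : lb f -> (forall x, `|x| <= M -> `|f x| <= B) ->
  forall x y, `|x| <= M -> `|y| <= M -> `|J 0 x f - J 0 y f| <= B * `|x - y|.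
Proof.
move=> bf fB.
have H x y : `|x| <= M -> `|y| <= M -> x <= y -> `|J 0 x f - J 0 y f| <= B * `|x - y|.
  move=> xM yM xy.
  have B0 : 0 <= B by apply: le_trans (fB x xM).
  have [x0|x0] := leP 0 x.
    rewrite (@J_cat _ 0 x y)// ?x0// opprD addrA subrr sub0r normrN.
    have yx0 : 0 <= y - x by rewrite subr_ge0.
    rewrite distrC (ger0_norm yx0); apply: J_le_norm => // z /andP[xz zy].
    apply: fB; move: xM yM; rewrite !ler_norml => /andP[? ?] /andP[? ?].
    by apply/andP; split; lra.
  rewrite (J_gt _ x0) sub0r normrN.
  have [y0|y0] := ltP y 0; first by rewrite J_gt// normr0 mulr_ge0.
  (* For [x < 0 <= y] the primitive is 0 at [x], as [J 0 x f] is an integral over an empty interval,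
     and only [[0, y]] contributes. *)
  apply: (@le_trans _ _ (B * (y - 0))).
    apply: J_le_norm => // z /andP[z0 zy].
    apply: fB; move: xM yM; rewrite !ler_norml => /andP[? ?] /andP[? ?].
    by apply/andP; split; lra.
  by rewrite ler_wpM2l// distrC ger0_norm; lra.
move=> x y xM yM; have [xy|/ltW yx] := leP x y; first exact: H.
by rewrite distrC (distrC x); exact: H.
Qed.

Lemma lb_primitive f : lb f -> lb (fun t => J 0 t f).
Proof.
move=> bf; apply: lb_lipschitz => M; have [B fB] := bf.2 M; exists B.
exact: primitive_lipschitz.
Qed.

Definition itv_floor (n : nat) (t : R) : R := (Num.floor (t * n.+1%:R))%:~R / n.+1%:R.

Lemma itv_floor_le n t : t - n.+1%:R^-1 <= itv_floor n t <= t.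
Proof.
have n0 : 0 < n.+1%:R :> R by rewrite ltr0n.
have /andP[h1 h2] := floor_itv (t * n.+1%:R).
rewrite intrD in h2.
rewrite /itv_floor ler_pdivlMr// ler_pdivrMr// h1 andbT.
by rewrite mulrBl mulVf ?gt_eqF// lerBlDr ltW.
Qed.

Lemma itv_floor_cvg t : itv_floor n t @[n --> \oo] --> t.
Proof.
apply: (@squeeze_cvgr _ _ _ _ (fun n => t - n.+1%:R^-1) (fun=> t)).
- by apply: nearW => n; exact: itv_floor_le.
- rewrite -[X in _ --> X]subr0; apply: cvgB; first exact: cvg_cst.
  exact: cvg_harmonic.
- exact: cvg_cst.
Qed.

(** Rounding [t] down to the grid of mesh [1 / (n + 1)] makes [F] constant in [t] on countably many
    strips, hence jointly measurable; continuity in [t] recovers [F] as the limit. *)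
Lemma lb2_caratheodory F :
  (forall x, continuous (F ^~ x)) -> (forall t, measurable_fun setT (F t)) ->
  (forall M : R, exists B : R, forall t x, `|t| <= M -> `|x| <= M -> `|F t x| <= B) -> lb2 F.
Proof.
move=> cF mF bF; split=> //.
apply: (@measurable_fun_cvg _ _ _ _ (fun n (p : R * R) => F (itv_floor n p.1) p.2)).
  move=> n _ Y mY; rewrite setTI.
  rewrite (_ : _ @^-1` _ = \bigcup_(z : int)
    ([set t | Num.floor (t * n.+1%:R) = z] `*` (F (z%:~R / n.+1%:R) @^-1` Y))); last first.
    apply/seteqP; split => [[t x]/= FY|[t x]/= [z _ [/= <-]]//].
    by exists (Num.floor (t * n.+1%:R)).
  apply: countable_bigcupT_measurable => // z; apply: measurableX.
    apply: is_interval_measurable => s t /= sz tz u /andP[su ut].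
    apply/eqP; rewrite eq_le; apply/andP; split; [rewrite -tz|rewrite -sz];
    by apply: le_floor; rewrite ler_wpM2r.
  by rewrite -[X in measurable X]setTI; exact: mF.
move=> [t x] _ /=; exact: (cvg_comp _ _ (@itv_floor_cvg t) (cF x t)).
Qed.

(** The primitive is Lipschitz in [t] and measurable in [x], so it is a Caratheodory function. *)
Lemma lb2_primitive F : lb2 F -> lb2 (fun t x => J 0 t (F ^~ x)).
Proof.
move=> bF; have bFx x : lb (F ^~ x) by apply: (lb2_lb bF); lbt.
apply: lb2_caratheodory.
- move=> x; apply: lipschitz_continuous => M.
  by have [B fB] := (bFx x).2 M; exists B; exact: primitive_lipschitz.
- by move=> t; exact: (lb_J2 _ _ bF).1.
- move=> M; have [B FB] := bF.2 M; exists (B * M) => t x tM xM.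
  have M0 : 0 <= M by apply: le_trans tM.
  have B0 : 0 <= B by apply: le_trans (FB _ _ tM xM).
  have := @primitive_lipschitz (F ^~ x) M B (bFx x) (fun y yM => FB y x yM xM) t 0 tM.
  rewrite normr0 J_xx !subr0 => /(_ M0) /le_trans; apply.
  by rewrite ler_wpM2l.
Qed.

End Calculus.

(** * Test functions *)

Section Splines.
Variable R : realType.
Implicit Types (a b c k x y m M : R) (f g : R -> R).

(** A Lipschitz derivative gives increments an error quadratic in the step, which is what
    [partition_eq] consumes. This yields integration by parts against coefficients that are merely
    measurable. *)
Definition C11 f f' : Prop := (forall x : R, is_derive x 1 f (f' x)) /\
  exists L : R, forall x y, `|f' x - f' y| <= L * `|x - y|.

Definition C11c M f f' : Prop :=
  C11 f f' /\ forall x, M <= `|x| -> f x = 0 /\ f' x = 0.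

Lemma C11_add f f' g g' : C11 f f' -> C11 g g' ->
  C11 (fun x => f x + g x) (fun x => f' x + g' x).
Proof.
move=> [df [L Lf]] [dg [K Kg]]; split=> [x|]; first exact: is_deriveD.
exists (L + K) => x y; rewrite mulrDl.
rewrite (_ : _ - _ = (f' x - f' y) + (g' x - g' y)); last by ring.
by rewrite (le_trans (ler_normD _ _))// lerD.
Qed.

Lemma C11_scale k f f' : C11 f f' -> C11 (fun x => k * f x) (fun x => k * f' x).
Proof.
move=> [df [L Lf]]; split=> [x|]; first exact: is_deriveZ.
exists (`|k| * L) => x y.
by rewrite -mulrBr normrM -mulrA ler_wpM2l.
Qed.

Lemma C11_affine k m f f' : C11 f f' ->
  C11 (fun x => f (k * x + m)) (fun x => k * f' (k * x + m)).
Proof.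
move=> [df [L Lf]]; split=> [x|].
  have dg : is_derive x 1 (fun x => k * x + m) k.
    rewrite -[X in is_derive _ _ _ X]addr0; apply: is_deriveD.
    by rewrite -[X in is_derive _ _ _ X]mulr1; apply: is_deriveZ.
  by have := @is_derive1_comp _ f (fun x => k * x + m) x _ _ (df _) dg; rewrite mulrC.
exists (`|k| * (L * `|k|)) => x y.
rewrite -mulrBr normrM -!mulrA ler_wpM2l// mulrA (le_trans (Lf _ _))//.
by rewrite (_ : _ - _ = k * (x - y)) ?normrM ?mulrA//; ring.
Qed.

Lemma C11_continuous f f' : C11 f f' -> continuous f.
Proof. by move=> [df _]; exact: is_derive_continuous df. Qed.

Lemma C11_continuous' f f' : C11 f f' -> continuous f'.
Proof.
by move=> [_ [L Lf]]; apply: lipschitz_continuous => M; exists L => x y _ _; exact: Lf.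
Qed.

Lemma C11_lb f f' : C11 f f' -> lb f.
Proof. by move=> /C11_continuous; exact: lb_continuous. Qed.

Lemma C11_lb' f f' : C11 f f' -> lb f'.
Proof. by move=> /C11_continuous'; exact: lb_continuous. Qed.

Lemma C11_taylor f f' : C11 f f' -> exists2 L, 0 <= L & forall x y z, x <= z <= y ->
  `|f y - f x - f' z * (y - x)| <= L * (y - x) ^+ 2.
Proof.
move=> [df [L Lf]]; exists `|L| => // x y z /andP[xz zy].
have xy : x <= y by apply: le_trans zy.
have [c /andP[xc cy] ->] := mvt xy df.
rewrite -mulrBl normrM (ger0_norm (_ : 0 <= y - x)) ?subr_ge0// expr2 mulrA.
rewrite ler_wpM2r ?subr_ge0// (le_trans (Lf _ _))//.
apply: (@le_trans _ _ (`|L| * `|c - z|)); first by rewrite ler_wpM2r// ler_norm.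
by rewrite ler_wpM2l// ler_norml; apply/andP; split; lra.
Qed.

Lemma C11_ftc f f' a b : C11 f f' -> a <= b -> J a b f' = f b - f a.
Proof.
move=> Cf ab; have bf' := C11_lb' Cf.
have [L L0 HL] := C11_taylor Cf.
have [df [K Kf]] := Cf.
suff : f b - J a b f' = f a - J a a f' by rewrite J_xx; lra.
apply: (@partition_eq _ (fun x => f x - J a x f') `|K| a b ab) => x y ax xy yb.
rewrite (@J_cat _ a x y)// ?ax//.
rewrite (_ : _ - (f x - _) = f y - f x - J x y f'); last by ring.
have [c /andP[xc cy] ->] := mvt xy df.
rewrite -(J_cst _ xy) -J_sub//; last exact: lb_cst.
rewrite expr2 mulrA; apply: J_le_norm => //; first by lbt.
move=> z /andP[xz zy]; apply: (le_trans (Kf _ _)).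
apply: (@le_trans _ _ (`|K| * `|c - z|)); first by rewrite ler_wpM2r// ler_norm.
by rewrite ler_wpM2l// ler_norml; apply/andP; split; lra.
Qed.

Lemma is_derive_quadratic f x d C :
  (forall y, `|f y - f x - d * (y - x)| <= C * (y - x) ^+ 2) -> is_derive x 1 f d.
Proof.
move=> H.
have cv : (fun h => h^-1 *: ((f \o shift x) (h *: 1) - f x)) @ 0^' --> d.
  apply/cvgrPdist_le => e e0; near=> h.
  have h0 : h != 0 by near: h; exact: nbhs_dnbhs_neq.
  have hC : `|h| <= e / (`|C| + 1).
    near: h; apply: dnbhs0_le; by rewrite divr_gt0// ltr_wpDl.
  have := H (h + x); rewrite addrK => Hh.
  rewrite /= [h *: 1]mulr1 /shift/=.
  rewrite -(ler_pM2r (_ : 0 < `|h|)) ?normr_gt0// -normrM.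
  rewrite (_ : _ * h = - (f (h + x) - f x - d * h)); last first.
    rewrite /GRing.scale/=; field. exact: h0.
  rewrite normrN (le_trans Hh)//.
  rewrite -real_normK ?num_real// expr2 mulrA ler_wpM2r//.
  rewrite ler_pdivlMr ?ltr_wpDl// in hC; apply: le_trans hC.
  by rewrite mulrC ler_wpM2l// (le_trans (ler_norm _))// lerDl.
apply: DeriveDef; first by apply/cvg_ex; exists d.
exact: cvg_lim cv.
Unshelve. all: by end_near.
Qed.

Definition pos (x : R) : R := Num.max x 0.
Definition q2 x := pos x ^+ 2.
(** The cube of the positive part, written so that the product rule gives its derivative. *)
Definition q3 x := x * q2 x.

Lemma pos_lip x y : `|pos x - pos y| <= `|x - y|.
Proof.
rewrite /pos /Num.max; case: ltP => hx; case: ltP => hy; rewrite ler_norml;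
  have := ler_norm (x - y); have := ler_norm (y - x); rewrite (distrC y) => h1 h2;
  by apply/andP; split; lra.
Qed.

Lemma C11_q2 : C11 q2 (fun x => 2 * pos x).
Proof.
split=> [x|]; last first.
  by exists 2 => x y; rewrite -mulrBr normrM ger0_norm// ler_wpM2l// pos_lip.
apply: (@is_derive_quadratic _ _ _ 1) => y.
have sq := sqr_ge0 (y - x); have sqy := sqr_ge0 y; have sqx := sqr_ge0 x.
rewrite /q2 /pos /Num.max; case: ltP => hy; case: ltP => hx; rewrite ler_norml mul1r.
- by apply/andP; split; lra.
- have xy : 0 <= x * - y by rewrite mulr_ge0// oppr_ge0 ltW.
  by rewrite expr0n/=; apply/andP; split; lra.
- have xy : 0 <= - x * y by rewrite mulr_ge0// oppr_ge0 ltW.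
  by rewrite expr0n/=; apply/andP; split; lra.
- by apply/andP; split; lra.
Qed.

Lemma is_derive_q3 (x : R) : is_derive x 1 q3 (3 * q2 x).
Proof.
have -> : 3 * q2 x = x *: (2 * pos x) + q2 x *: 1.
  rewrite /GRing.scale/= /q2 /pos /Num.max; case: ltP => hx; ring.
exact: (@is_deriveM _ _ id q2 x 1 1 (2 * pos x) (is_derive_id _ _) (C11_q2.1 x)).
Qed.

(* [Bsp] is the quadratic B-spline with knots 0, 1, 2, 3, and its primitive [Ssp] increases
   from 0 to 1 on [0, 3]. *)
Definition Bsp x : R := (q2 x - 3 * q2 (x - 1) + 3 * q2 (x - 2) - q2 (x - 3)) / 2.
Definition Bsp' x : R := pos x - 3 * pos (x - 1) + 3 * pos (x - 2) - pos (x - 3).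
Definition Ssp x : R := (q3 x - 3 * q3 (x - 1) + 3 * q3 (x - 2) - q3 (x - 3)) / 6.

Lemma C11_ext f f' g g' : (forall x, f x = g x) -> (forall x, f' x = g' x) ->
  C11 f f' -> C11 g g'.
Proof. by move=> /funext -> /funext ->. Qed.

Lemma C11_Bsp : C11 Bsp Bsp'.
Proof.
have H m := C11_affine 1 m C11_q2.
have := C11_scale 2^-1 (C11_add (C11_add (C11_add (H 0) (C11_scale (-3) (H (-1))))
  (C11_scale 3 (H (-2)))) (C11_scale (-1) (H (-3)))).
apply: C11_ext => x; rewrite !mul1r !addr0 ?/Bsp ?/Bsp'; by field.
Qed.

Lemma is_derive_Ssp (x : R) : is_derive x 1 Ssp (Bsp x).
Proof.
have H m : is_derive x 1 (fun x => q3 (x + m)) (3 * q2 (x + m)).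
  have dg : is_derive x 1 (fun x => x + m) 1.
    by rewrite -[X in is_derive _ _ _ X]addr0; apply: is_deriveD.
  by have := @is_derive1_comp _ q3 (fun x => x + m) x _ _ (is_derive_q3 _) dg; rewrite mulr1.
have := is_deriveZ (6^-1) (is_deriveD (is_deriveD (is_deriveD (H 0) (is_deriveZ (-3) (H (-1))))
  (is_deriveZ 3 (H (-2)))) (is_deriveZ (-1) (H (-3)))).
set F := (X in is_derive _ _ X _); set d := (X in is_derive _ _ _ X -> _).
have -> : Ssp = F.
  apply/funext => y.
  have -> : F y = 6^-1 * (q3 (y + 0) + -3 * q3 (y - 1) + 3 * q3 (y - 2) + -1 * q3 (y - 3)) by [].
  by rewrite /Ssp addr0; field.
have Ed : d = 6^-1 * (3 * q2 (x + 0) + -3 * (3 * q2 (x - 1)) + 3 * (3 * q2 (x - 2)) +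
     -1 * (3 * q2 (x - 3))) by [].
by have -> : Bsp x = d by rewrite Ed /Bsp addr0; field.
Qed.

Lemma Bsp'_le x : `|Bsp' x| <= 1.
Proof.
rewrite /Bsp' /pos /Num.max ler_norml.
by case: ltP => ?; case: ltP => ?; case: ltP => ?; case: ltP => ?; apply/andP; split; lra.
Qed.

Lemma C11_Ssp : C11 Ssp Bsp.
Proof.
split=> [x|]; first exact: is_derive_Ssp.
exists 1; have H x y : x <= y -> `|Bsp x - Bsp y| <= 1 * `|x - y|.
  move=> xy; have [c _ E] := mvt xy C11_Bsp.1.
  rewrite distrC E normrM (distrC x y); apply: ler_wpM2r => //.
  exact: Bsp'_le.
move=> x y; have [xy|/ltW yx] := leP x y; first exact: H.
by rewrite distrC (distrC x); exact: H.
Qed.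

Lemma Bsp_ge0 x : 0 <= Bsp x.
Proof.
rewrite /Bsp /q2 /pos /Num.max divr_ge0//.
case: ltP => h1; case: ltP => h2; case: ltP => h3; case: ltP => h4; try lra; try nra.
Qed.

Lemma Bsp_out x : (x <= 0) || (3 <= x) -> Bsp x = 0 /\ Bsp' x = 0.
Proof.
rewrite /Bsp /Bsp' /q2 /pos /Num.max => /orP[] hx.
  by case: ltP => h1; case: ltP => h2; case: ltP => h3; case: ltP => h4;
    split; try lra; rewrite (_ : x = 0); lra.
have E (y : R) : 0 <= y -> (if y < 0 then 0 else y) = y by rewrite leNgt => /negbTE ->.
by rewrite !E; [split; field|lra..].
Qed.

Lemma Ssp_le0 x : x <= 0 -> Ssp x = 0.
Proof.
move=> x0; rewrite /Ssp /q3 /q2 /pos /Num.max.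
by case: ltP => h1; case: ltP => h2; case: ltP => h3; case: ltP => h4; try lra;
   rewrite (_ : x = 0); lra.
Qed.

Lemma Ssp_ge3 x : 3 <= x -> Ssp x = 1.
Proof.
move=> x0; rewrite /Ssp /q3 /q2 /pos /Num.max.
by case: ltP => h1; case: ltP => h2; case: ltP => h3; case: ltP => h4; try lra; field.
Qed.

Lemma Ssp_nd x y : x <= y -> Ssp x <= Ssp y.
Proof.
move=> xy; rewrite -subr_ge0.
have [c _ ->] := mvt xy is_derive_Ssp.
by rewrite mulr_ge0 ?Bsp_ge0 ?subr_ge0.
Qed.

Lemma Ssp_itv x : 0 <= Ssp x <= 1.
Proof.
have h0 : Ssp (Num.min x 0) = 0 by apply: Ssp_le0; rewrite ge_min lexx orbT.
have h1 : Ssp (Num.max x 3) = 1 by apply: Ssp_ge3; rewrite le_max lexx orbT.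
apply/andP; split; [rewrite -h0|rewrite -h1]; apply: Ssp_nd.
  by rewrite ge_min lexx.
by rewrite le_max lexx.
Qed.

End Splines.

(** * From weak ordinary differential equations to their integrated form *)

Section WeakODE.
Variable R : realType.
Implicit Types (a b f g th : R -> R) (x y z s t u T M : R).

Lemma eq_J_oo (x y : R) f g : lb f -> lb g -> (forall z, x < z < y -> f z = g z) ->
  J x y f = J x y g.
Proof.
move=> bf bg fg.
have H h : lb h -> J x y h = \int[@lebesgue_measure R]_(z in `]x, y[) h z.
  move=> bh; have ih := lb_integrable x y bh.
  rewrite Rintegral_itv_bndo_bndc; last first.
    by apply: integrableS ih => //; apply: subset_itvScc; rewrite bnd_simp.
  rewrite Rintegral_itv_obnd_cbnd//.
  by apply: integrableS ih => //; apply: subset_itvScc; rewrite bnd_simp.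
rewrite !H//; apply: eq_Rintegral => z; rewrite inE/= in_itv/=; exact: fg.
Qed.

Lemma pos_le0 (x : R) : x <= 0 -> pos x = 0.
Proof. by move=> x0; rewrite /pos max_r. Qed.

Lemma pos_ge0 (x : R) : 0 <= x -> pos x = x.
Proof. by move=> x0; rewrite /pos max_l. Qed.

(* [pramp n] is a primitive of [ramp n], which tends to the indicator of ]0, +oo[. *)
Definition ramp (n : nat) (t : R) : R := pos (n.+1%:R * t) - pos (n.+1%:R * t - 1).
Definition pramp (n : nat) (t : R) : R :=
  (2 * n.+1%:R)^-1 * (q2 (n.+1%:R * t) - q2 (n.+1%:R * t - 1)).

Lemma C11_pramp n T : C11 (fun t => pramp n (t - T)) (fun t => ramp n (t - T)).
Proof.
have N0 : n.+1%:R != 0 :> R by rewrite pnatr_eq0.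
have H m := C11_affine n.+1%:R m (@C11_q2 R).
have := C11_scale (2 * n.+1%:R)^-1
  (C11_add (H (- n.+1%:R * T)) (C11_scale (-1) (H (- n.+1%:R * T - 1)))).
have E1 t : n.+1%:R * (t - T) = n.+1%:R * t + - n.+1%:R * T by ring.
have E2 t : n.+1%:R * (t - T) - 1 = n.+1%:R * t + (- n.+1%:R * T - 1) by ring.
apply: C11_ext => t; first by rewrite /pramp E2 E1 mulN1r.
by rewrite /ramp E2 E1; field; rewrite ?pnatr_eq0.
Qed.

Lemma ramp_le0 n t : t <= 0 -> ramp n t = 0.
Proof.
move=> t0; have nt : n.+1%:R * t <= 0 by rewrite mulr_ge0_le0.
by rewrite /ramp /pos /Num.max; case: ltP => ?; case: ltP => ?; lra.
Qed.

Lemma ramp_ge1 n t : 1 <= n.+1%:R * t -> ramp n t = 1.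
Proof.
by move=> nt; rewrite /ramp /pos /Num.max; case: ltP => ?; case: ltP => ?; lra.
Qed.

Lemma ramp_itv n t : 0 <= ramp n t <= 1.
Proof.
by rewrite /ramp /pos /Num.max; apply/andP; split; case: ltP => ?; case: ltP => ?; lra.
Qed.

Lemma ramp_nd n s t : s <= t -> ramp n s <= ramp n t.
Proof.
move=> st; have : n.+1%:R * s <= n.+1%:R * t by rewrite ler_wpM2l.
rewrite /ramp /pos /Num.max.
by case: ltP => ?; case: ltP => ?; case: ltP => ?; case: ltP => ?; lra.
Qed.

Lemma pramp_le0 n t : t <= 0 -> pramp n t = 0.
Proof.
move=> t0; have nt : n.+1%:R * t <= 0 by rewrite mulr_ge0_le0.
by rewrite /pramp /q2 !pos_le0 ?subrr ?mulr0//; lra.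
Qed.

Lemma pramp_ge1 n t : 1 <= n.+1%:R * t -> pramp n t = t - (2 * n.+1%:R)^-1.
Proof.
have N0 : n.+1%:R != 0 :> R by rewrite pnatr_eq0.
move=> nt; rewrite /pramp /q2 !pos_ge0; [|lra|lra].
by field; rewrite ?pnatr_eq0.
Qed.

Lemma ramp_cvg1 t : 0 < t -> ramp n t @[n --> \oo] --> (1 : R).
Proof.
move=> t0; apply: cvg_near_cst; near=> n; apply/eqP; rewrite eq_sym; apply/eqP.
rewrite ramp_ge1// -ler_pdivrMr// div1r.
apply: ltW; apply: (@lt_trans _ _ n%:R); last by rewrite ltr_nat.
near: n; exact: nbhs_infty_gtr.
Unshelve. all: by end_near. Qed.

(* On the positive half-line the derivatives of the test functions approximate minus the
   indicator of [T1, T2]. *)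
Lemma weak_ode a b (a0 : R) : lb a -> lb b ->
  (forall (M : R) th th', C11c M th th' -> (forall t, 0 <= th t) ->
    J 0 M (fun t => a t * th' t + b t * th t) + a0 * th 0 = 0) ->
  forall T1 T2, 0 <= T1 -> T1 <= T2 -> J T1 T2 (fun t => a t - a0 - J 0 t b) = 0.
Proof.
move=> ba bb H T1 T2 T10 T12.
have bp := lb_primitive bb.
pose p t := a0 + J 0 t b.
have bp' : lb p by rewrite /p; lbt.
(* The test function will be [G n (t + S) - G n t]. The shift [S] sends the rise of the first term
   to negative times, so that for [0 <= t] it is [T2 - T1 - G n t], with derivative [- G' n t]. It
   is nonnegative because [G n] is nondecreasing, and [M] bounds its support. *)
pose S := T2 + 2; pose M := 2 * T2 + 4.
have M0 : 0 <= M by rewrite /M; lra.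
pose G n t := pramp n (t - T1) - pramp n (t - T2).
pose G' n t := ramp n (t - T1) - ramp n (t - T2).
have CG n : C11 (G n) (G' n).
  have := C11_add (C11_pramp n T1) (C11_scale (-1) (C11_pramp n T2)).
  by apply: C11_ext => t; rewrite mulN1r.
have N1 n : 1 <= n.+1%:R :> R by rewrite ler1n.
have GT1 n t : t <= T1 -> G n t = 0 /\ G' n t = 0.
  by move=> tT; rewrite /G /G' !pramp_le0 ?ramp_le0 ?subr0//; lra.
have GT2 n t : T2 + 1 <= t -> G n t = T2 - T1 /\ G' n t = 0.
  have big (u : R) : 1 <= u -> 1 <= n.+1%:R * u.
    move=> u1; rewrite (le_trans u1)// ler_peMl ?N1//; lra.
  move=> tT; have b1 : 1 <= n.+1%:R * (t - T1) by apply: big; lra.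
  have b2 : 1 <= n.+1%:R * (t - T2) by apply: big; lra.
  rewrite /G /G' (pramp_ge1 b1) (pramp_ge1 b2) (ramp_ge1 b1) (ramp_ge1 b2).
  by split; ring.
have G'0 n t : 0 <= G' n t by rewrite /G' subr_ge0 ramp_nd// lerD2l lerN2.
have G'1 n t : G' n t <= 1.
  rewrite /G'; have := ramp_itv n (t - T1); have := ramp_itv n (t - T2).
  by move=> /andP[? ?] /andP[? ?]; lra.
have Gnd n s t : s <= t -> G n s <= G n t.
  move=> st; rewrite -subr_ge0; have [c _ ->] := mvt st (CG n).1.
  by rewrite mulr_ge0// subr_ge0.
have S0 : 0 <= S by rewrite /S; lra.
have CT n : C11c M (fun t => G n (t + S) - G n t) (fun t => G' n (t + S) - G' n t).
  split.
    have := C11_add (C11_affine 1 S (CG n)) (C11_scale (-1) (CG n)).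
    by apply: C11_ext => t; rewrite !mul1r mulN1r.
  move=> t; rewrite ler_normr => /orP[] Mt.
    have [|-> ->] := GT2 n (t + S); first by move: Mt; rewrite /S /M; lra.
    by have [|-> ->] := GT2 n t; [move: Mt; rewrite /M; lra|rewrite !subrr].
  have [|-> ->] := GT1 n (t + S); first by move: Mt; rewrite /S /M; lra.
  by have [|-> ->] := GT1 n t; [move: Mt; rewrite /M; lra|rewrite !subrr].
(* The exact solution [p] satisfies the same weak equation, by integration by parts through
   [partition_eq]. Subtracting the two equations leaves the integral of [(a - p) * th'], whatever
   [b] is. *)
have ibp th th' : C11c M th th' ->
    J 0 M (fun t => p t * th' t + b t * th t) + a0 * th 0 = 0.
  move=> [Cth th0]; have bth := C11_lb Cth; have bth' := C11_lb' Cth.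
  have [B bB] := bb.2 M; have [K thK] := bth'.2 M.
  have Mn x : 0 <= x -> x <= M -> `|x| <= M by move=> x0 xM; rewrite ger0_norm.
  have B0 : 0 <= B by apply: le_trans (bB 0 _) => //; exact: Mn.
  have K0 : 0 <= K by apply: le_trans (thK 0 _) => //; exact: Mn.
  have bq : lb (fun t => p t * th' t + b t * th t) by lbt.
  have E : p M * th M - J 0 M (fun t => p t * th' t + b t * th t) =
      p 0 * th 0 - J 0 0 (fun t => p t * th' t + b t * th t).
    apply: (@partition_eq _ (fun x => p x * th x - J 0 x (fun t => p t * th' t + b t * th t))
      (2 * B * K) 0 M M0) => x y x0 xy yM.
    have pz z : x <= z -> z <= y -> p z = p x + J x z b.
      by move=> xz zy; rewrite /p (@J_cat _ 0 x z)// ?x0// addrA.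
    have xM : x <= M by apply: le_trans yM.
    rewrite (@J_cat _ 0 x y)// ?x0//.
    set j0 := J 0 x _.
    rewrite (_ : _ - _ = (p y - p x) * th y + p x * (th y - th x) -
      J x y (fun t => p t * th' t + b t * th t)); last by ring.
    have pyx : p y - p x = J x y b by rewrite (pz y xy (lexx _)); ring.
    rewrite pyx -(C11_ftc Cth xy) -J_mulr// -J_mull//.
    rewrite -J_add; [|by lbt..].
    rewrite -J_sub; [|by lbt..].
    rewrite expr2 mulrA; apply: J_le_norm => //; first by lbt.
    move=> z /andP[xz zy].
    have zM : z <= M by apply: le_trans yM.
    have z0 : 0 <= z by apply: le_trans xz.
    rewrite (_ : _ - _ = b z * (th y - th z) - (p z - p x) * th' z); last by ring.
    have h1 : `|b z * (th y - th z)| <= B * (K * (y - x)).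
      rewrite normrM ler_pM//; first by apply: bB; exact: Mn.
      have [c /andP[zc cy] ->] := mvt zy Cth.1.
      rewrite normrM ler_pM//; first by apply: thK; apply: Mn; lra.
      by rewrite ger0_norm; lra.
    have h2 : `|(p z - p x) * th' z| <= B * (y - x) * K.
      rewrite normrM ler_pM//; last by apply: thK; exact: Mn.
      have -> : p z - p x = J x z b by rewrite (pz z xz zy); ring.
      apply: (@le_trans _ _ (B * (z - x))).
        by apply: J_le_norm => // w /andP[? ?]; apply: bB; apply: Mn; lra.
      by rewrite ler_wpM2l// lerD2r.
    rewrite (le_trans (ler_normB _ _))// (le_trans (lerD h1 h2))// le_eqVlt.
    by apply/orP; left; apply/eqP; ring.
  move: E; rewrite J_xx (th0 M _).1 ?ger0_norm// mulr0 /p J_xx addr0 subr0 sub0r.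
  by move=> /eqP; rewrite eq_sym -addr_eq0 addrC => /eqP.
pose f t := a t - a0 - J 0 t b.
have bf : lb f by rewrite /f; lbt.
have bG' n : lb (G' n) := C11_lb' (CG n).
have fG n : J 0 M (fun t => f t * G' n t) = 0.
  have [Cth th0] := CT n.
  have h1 := ibp _ _ (CT n).
  have th_ge0 t : 0 <= G n (t + S) - G n t by rewrite subr_ge0 Gnd// lerDl.
  have h2 := H _ _ _ (CT n) th_ge0.
  have bth := C11_lb Cth; have bth' := C11_lb' Cth.
  have /addIr/eqP := etrans h2 (esym h1).
  rewrite -subr_eq0 -J_sub; [|by lbt..] => /eqP => E3.
  apply/eqP; rewrite -oppr_eq0 -J_opp; last by lbt.
  apply/eqP; rewrite -[RHS]E3.
  apply: eq_J => t /andP[t0 tM].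
  have [|_ ->] := GT2 n (t + S); first by rewrite /S; lra.
  by rewrite /f /p; ring.
have T2M : T2 <= M by rewrite /M; lra.
have [B fB] := bf.2 M.
pose ind t : R := (t <= T2)%R%:R - (t <= T1)%R%:R.
have bind : lb ind by rewrite /ind; lbt.
have cG t : G' n t @[n --> \oo] --> ind t.
  have H1 T : ramp n (t - T) @[n --> \oo] --> ((1 - (t <= T)%R%:R) : R).
    case: ltP => [Tt|tT]; first by rewrite subr0; apply: ramp_cvg1; rewrite subr_gt0.
    rewrite subrr; apply: cvg_near_cst; apply: nearW => n.
    by rewrite ramp_le0// subr_le0.
  rewrite (_ : ind t = (1 - (t <= T1)%R%:R) - (1 - (t <= T2)%R%:R)); last by rewrite /ind; ring.
  exact: cvgB.
have C : J 0 M (fun t => f t * G' n t) @[n --> \oo] --> J 0 M (fun t => f t * ind t).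
  apply: (@J_cvg _ 0 M _ _ B) => //; try by move=> *; lbt.
    by lbt.
  - move=> n x /andP[x0 xM]; rewrite normrM (ger0_norm (G'0 _ _)).
    rewrite -[leRHS]mulr1 ler_pM//; apply: fB; by rewrite ger0_norm.
  - by move=> x _; apply: cvgM; [exact: cvg_cst|exact: cG].
have E0 : J 0 M (fun t => f t * ind t) = 0.
  have C0 : J 0 M (fun t => f t * G' n t) @[n --> \oo] --> (0 : R).
    by apply: cvg_near_cst; apply: nearW => n; exact: fG.
  exact: (cvg_unique _ C C0).
rewrite -[RHS]E0 (@J_cat _ 0 T1 M); [|by lbt|by rewrite T10 (le_trans T12)].
rewrite (@J_cat _ T1 T2 M); [|by lbt|by rewrite T12].
have -> : J 0 T1 (fun t => f t * ind t) = J 0 T1 (fun=> 0).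
  apply: eq_J => t /andP[_ tT]; rewrite /ind tT (le_trans tT T12).
  by rewrite subrr mulr0.
have -> : J T2 M (fun t => f t * ind t) = J T2 M (fun=> 0).
  apply: eq_J_oo; [by lbt|by lbt|] => t /andP[tT _]; rewrite /ind.
  by rewrite leNgt tT leNgt (le_lt_trans T12 tT) subrr mulr0.
rewrite !J_cst// !mul0r add0r addr0.
apply: eq_J_oo; [by lbt|by lbt|] => t /andP[T1t tT2].
by rewrite /ind ltW// leNgt T1t subr0 mulr1.
Qed.

(** Continuity from the right lets a value be read off from integrals over [[T, T + d]], also at
    [T = 0], where the time axis of the equations begins. *)
Definition rcont f T := forall e, 0 < e -> exists2 d : R, 0 < d &
  forall t, T <= t <= T + d -> `|f t - f T| <= e.

Lemma integral_zero_rcont f T : lb f -> 0 <= T -> rcont f T ->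
  (forall T1 T2, 0 <= T1 -> T1 <= T2 -> J T1 T2 f = 0) -> f T = 0.
Proof.
move=> bf T0 cf H; apply/eqP; rewrite -normr_le0 leNgt; apply/negP => f0.
have e0 : 0 < `|f T| / 2 by rewrite divr_gt0.
have [d d0 Hd] := cf _ e0.
have Td : T <= T + d by rewrite lerDl ltW.
have bk : lb (fun t => f t - f T) by lbt.
have := J_le_norm bk Td Hd.
rewrite J_sub//; last exact: lb_cst.
rewrite H// J_cst// sub0r normrN normrM (_ : T + d - T = d); last by ring.
rewrite (gtr0_norm d0) ler_pM2r// => ?; lra.
Qed.

Lemma weak_ode_rcont a b (a0 : R) : lb a -> lb b ->
  (forall M th th', C11c M th th' -> (forall t, 0 <= th t) ->
    J 0 M (fun t => a t * th' t + b t * th t) + a0 * th 0 = 0) ->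
  forall T, 0 <= T -> rcont a T -> a T = a0 + J 0 T b.
Proof.
move=> ba bb H T T0 cT; have bp := lb_primitive bb.
suff : a T - a0 - J 0 T b = 0 by move=> ?; lra.
apply: (@integral_zero_rcont (fun t => a t - a0 - J 0 t b)) => //; first by lbt.
  move=> e e0; have e20 : 0 < e / 2 by rewrite divr_gt0.
  have [d d0 Hd] := cT _ e20.
  have [B fB] := bb.2 (`|T| + 1).
  have B0 : 0 <= B by apply: le_trans (fB T _) => //; rewrite lerDl.
  pose d' := Num.min (Num.min d 1) (e / 2 / (B + 1)).
  exists d'; first by rewrite !lt_min d0 ltr01 divr_gt0// ltr_wpDl.
  move=> t /andP[Tt tT].
  have d'd : d' <= d by rewrite /d' !ge_min lexx.
  have d'1 : d' <= 1 by rewrite /d' !ge_min lexx orbT.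
  have d'e : d' * (B + 1) <= e / 2.
    by rewrite -ler_pdivlMr ?ltr_wpDl// /d' ge_min lexx orbT.
  have h1 : `|a t - a T| <= e / 2 by apply: Hd; rewrite Tt (le_trans tT)// lerD2l.
  have TN : T <= `|T| := ler_norm T.
  have h2 : `|J 0 t b - J 0 T b| <= B * `|t - T|.
    apply: (@primitive_lipschitz _ b (`|T| + 1) B bb fB); last by rewrite lerDl.
    by rewrite ger0_norm; lra.
  have h3 : B * `|t - T| <= e / 2.
    apply: le_trans d'e; rewrite mulrC; apply: ler_pM => //; last by lra.
    by rewrite ger0_norm; lra.
  rewrite (_ : _ - _ = (a t - a T) - (J 0 t b - J 0 T b)); last by ring.
  by rewrite (le_trans (ler_normB _ _))// (le_trans (lerD h1 (le_trans h2 h3)))//; lra.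
exact: weak_ode.
Qed.

End WeakODE.

(** * From weak conservation laws to balances over intervals *)

Section SpaceTests.
Variable R : realType.
Implicit Types (f g : R -> R) (a b x y M k T t : R) (U fl : R -> R -> R).

(** Left continuity is the regularity of [x |-> mu (]-oo, x[)], and it passes to every flux built
    from such functions. *)
Definition lcont f x := forall e : R, 0 < e -> exists2 d : R, 0 < d &
  forall y, x - d <= y <= x -> `|f y - f x| <= e.

(** The offset puts the whole rise into [[a - 3 / (n + 1), a]]: the derivative [bump a n] sees only
    values on the left of [a], where left continuity gives control. *)
Definition step a (n : nat) x : R := Ssp (n.+1%:R * x + (3 - n.+1%:R * a)).
Definition bump a (n : nat) x : R := n.+1%:R * Bsp (n.+1%:R * x + (3 - n.+1%:R * a)).
Definition bump' a (n : nat) x : R :=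
  n.+1%:R * (n.+1%:R * Bsp' (n.+1%:R * x + (3 - n.+1%:R * a))).

Lemma C11_step a n : C11 (step a n) (bump a n).
Proof. exact: C11_affine (@C11_Ssp R). Qed.

Lemma C11_bump a n : C11 (bump a n) (bump' a n).
Proof. by apply: C11_scale; exact: C11_affine (@C11_Bsp R). Qed.

Lemma step_arg a n x : n.+1%:R * x + (3 - n.+1%:R * a) = n.+1%:R * (x - a) + 3.
Proof. by ring. Qed.

Lemma step_ge a n x : a <= x -> step a n x = 1.
Proof.
by move=> ax; rewrite /step step_arg Ssp_ge3// lerDr mulr_ge0// subr_ge0.
Qed.

Lemma bump_ge a n x : a <= x -> bump a n x = 0 /\ bump' a n x = 0.
Proof.
move=> ax; rewrite /bump /bump' step_arg.
have [|-> ->] := @Bsp_out R (n.+1%:R * (x - a) + 3).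
  by rewrite lerDr mulr_ge0 ?orbT// subr_ge0.
by rewrite !mulr0.
Qed.

Lemma step_arg_le a n x : n.+1%:R * (a - x) >= 3 -> n.+1%:R * (x - a) + 3 <= 0.
Proof. by rewrite -(opprB x a) mulrN; lra. Qed.

Lemma step_le a n x : n.+1%:R * (a - x) >= 3 -> step a n x = 0.
Proof. by move=> ax; rewrite /step step_arg Ssp_le0// step_arg_le. Qed.

Lemma bump_le a n x : n.+1%:R * (a - x) >= 3 -> bump a n x = 0 /\ bump' a n x = 0.
Proof.
move=> ax; rewrite /bump /bump' step_arg.
have [|-> ->] := @Bsp_out R (n.+1%:R * (x - a) + 3); last by rewrite !mulr0.
by rewrite step_arg_le.
Qed.

Lemma nat_mul_ge (n : nat) x y : 0 <= x -> y <= x -> y <= n.+1%:R * x.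
Proof. by move=> x0 yx; rewrite (le_trans yx)// ler_peMl// ler1n. Qed.

Lemma bump_ge0 a n x : 0 <= bump a n x.
Proof. by rewrite mulr_ge0// Bsp_ge0. Qed.

Lemma bump_out a n x : x <= a - 3 \/ a <= x -> bump a n x = 0 /\ bump' a n x = 0.
Proof.
move=> [xa|ax]; last exact: bump_ge.
by apply: bump_le; apply: nat_mul_ge; lra.
Qed.

Lemma abs_bounds x : - `|x| <= x /\ x <= `|x|.
Proof. by split; [rewrite lerNl -normrN|]; exact: ler_norm. Qed.

(* [chi] and [chi'] are the first two derivatives of [psi]. *)
Definition tst M (psi chi chi' : R -> R) : Prop :=
  [/\ C11c M psi chi, C11c M chi chi' & forall x, 0 <= psi x].

Lemma tst_step a b n : a <= b -> tst (`|a| + `|b| + 3)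
  (fun x => step a n x - step b n x) (fun x => bump a n x - bump b n x)
  (fun x => bump' a n x - bump' b n x).
Proof.
move=> ab.
have sub f f' g g' : C11 f f' -> C11 g g' ->
    C11 (fun x => f x - g x) (fun x => f' x - g' x).
  move=> Cf Cg; have := C11_add Cf (C11_scale (-1) Cg).
  by apply: C11_ext => x; rewrite mulN1r.
have out x : `|a| + `|b| + 3 <= `|x| ->
    (x <= a - 3 /\ x <= b - 3) \/ (a <= x /\ b <= x).
  have [a1 a2] := abs_bounds a; have [b1 b2] := abs_bounds b.
  have a0 := normr_ge0 a; have b0 := normr_ge0 b.
  have [x0|x0] := leP 0 x; [rewrite (ger0_norm x0) => xM; right; lra|].
  by rewrite (ltr0_norm x0) => xM; left; lra.
split.
- split; first by apply: sub; exact: C11_step.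
  move=> x /out[[xa xb]|[ax bx]]; last first.
    by rewrite !step_ge ?(bump_ge _ ax).1 ?(bump_ge _ bx).1// !subrr.
  rewrite !step_le; [|by apply: nat_mul_ge; lra..].
  by rewrite !(bump_out _ (or_introl _)).1// !subrr.
- split; first by apply: sub; exact: C11_bump.
  move=> x /out[[xa xb]|[ax bx]].
    by rewrite !(bump_out _ (or_introl _)).1// !(bump_out _ (or_introl _)).2// !subrr.
  by rewrite !(bump_ge _ _).1// !(bump_ge _ _).2// !subrr.
- move=> x; rewrite subr_ge0 /step !step_arg; apply: Ssp_nd.
  by rewrite lerD2r ler_wpM2l// lerD2l lerN2.
Qed.

Lemma J_bump a n M : a <= M -> - M <= a - 3 -> J (- M) M (bump a n) = 1.
Proof.
move=> aM Ma; rewrite (C11_ftc (C11_step a n)); last by lra.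
by rewrite step_ge// step_le ?subr0//; apply: nat_mul_ge; lra.
Qed.

Lemma J_bump_le f a n M B : lb f -> a <= M -> - M <= a - 3 ->
  (forall x, - M <= x <= M -> `|f x| <= B) ->
  `|J (- M) M (fun x => f x * bump a n x)| <= B.
Proof.
move=> bf aM Ma fB; have bb := C11_lb' (C11_step a n).
apply: (le_trans (J_norm _ _ _)); first by lbt.
rewrite -[leRHS]mulr1 -(J_bump n aM Ma) -J_mull//.
apply: le_J; [by lbt|by lbt|] => x xM.
rewrite normrM (ger0_norm (bump_ge0 _ _ _)) ler_wpM2r ?bump_ge0//.
exact: fB.
Qed.

Lemma bump_cvg f a M : lb f -> lcont f a -> a <= M -> - M <= a - 3 ->
  J (- M) M (fun x => f x * bump a n x) @[n --> \oo] --> f a.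
Proof.
move=> bf cf aM Ma; apply/cvgrPdist_le => e e0.
have [d d0 Hd] := cf _ e0.
near=> n.
have nd : 3 <= n.+1%:R * d.
  rewrite -ler_pdivrMr//; apply: ltW; apply: (@lt_trans _ _ n%:R); last by rewrite ltr_nat.
  near: n; exact: nbhs_infty_gtr.
have bb := C11_lb' (C11_step a n).
rewrite distrC -[X in _ - X]mulr1 -(J_bump n aM Ma) -J_mull// -J_sub; [|by lbt..].
apply: (le_trans (J_norm _ _ _)); first by lbt.
rewrite -[leRHS]mulr1 -(J_bump n aM Ma) -J_mull//.
apply: le_J; [by lbt|by lbt|] => x xM.
rewrite -mulrBl normrM (ger0_norm (bump_ge0 _ _ _)).
have [ax|xa] := leP a x; first by rewrite (bump_ge n ax).1 !mulr0.
have [xad|adx] := leP x (a - d).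
  have ax : 3 <= n.+1%:R * (a - x) by rewrite (le_trans nd)// ler_wpM2l//; lra.
  by rewrite (bump_le ax).1 !mulr0.
by rewrite ler_wpM2r ?bump_ge0// Hd// !ltW.
Unshelve. all: by end_near. Qed.

Lemma step_cvg f a b M : lb f -> a <= b -> b <= M -> - M <= a ->
  J (- M) M (fun x => f x * (step a n x - step b n x)) @[n --> \oo] --> J a b f.
Proof.
move=> bf ab bM Ma; have [B fB] := bf.2 M.
pose ind x : R := (a <= x)%R%:R - (b <= x)%R%:R.
have bind : lb ind by rewrite /ind; lbt.
have cS c x : step c n x @[n --> \oo] --> ((c <= x)%R%:R : R).
  case: leP => [cx|xc]; first by apply: cvg_near_cst; apply: nearW => n; rewrite step_ge.
  apply: cvg_near_cst; near=> n; rewrite step_le//.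
  rewrite -ler_pdivrMr ?subr_gt0//; apply: ltW; apply: (@lt_trans _ _ n%:R); last by rewrite ltr_nat.
  near: n; exact: nbhs_infty_gtr.
have -> : J a b f = J (- M) M (fun x => f x * ind x).
  rewrite (@J_cat _ (- M) a M); [|by lbt|by rewrite Ma (le_trans ab)].
  rewrite (@J_cat _ a b M); [|by lbt|by rewrite ab].
  have -> : J (- M) a (fun t => f t * ind t) = J (- M) a (fun=> 0).
    apply: eq_J_oo; [by lbt|by lbt|] => t /andP[_ ta]; rewrite /ind.
    by rewrite !leNgt ta (lt_le_trans ta ab) subrr mulr0.
  have -> : J b M (fun t => f t * ind t) = J b M (fun=> 0).
    apply: eq_J => t /andP[bt _]; rewrite /ind.
    by rewrite bt (le_trans ab bt) subrr mulr0.
  rewrite !J_cst// !mul0r add0r addr0.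
  apply: eq_J_oo; [by lbt|by lbt|] => t /andP[at_ tb].
  by rewrite /ind (ltW at_) leNgt tb subr0 mulr1.
have bs c n : lb (step c n) := C11_lb (C11_step c n).
apply: (@J_cvg _ _ _ _ _ B) => //; [by move=> n; lbt|by lbt|lra| |].
- move=> n x /andP[Mx xM]; rewrite normrM -[leRHS]mulr1 ler_pM//.
    by apply: fB; rewrite ler_norml Mx.
  have /andP[? ?] : 0 <= step a n x <= 1 := Ssp_itv _.
  have /andP[? ?] : 0 <= step b n x <= 1 := Ssp_itv _.
  by rewrite ler_norml; apply/andP; split; lra.
- move=> x _; apply: cvgM; first exact: cvg_cst.
  by apply: cvgB; exact: cS.
Unshelve. all: by end_near. Qed.

(* The functions [step a n - step b n] tend to the indicator of [a, b[, and their derivatives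
   concentrate on the left of a and b: hence the left continuity of the flux. *)
Lemma conservation U fl k T : lb2 U -> lb2 fl -> (forall t x, lcont (fl t) x) -> 0 <= T ->
  (forall M psi chi chi', tst M psi chi chi' -> 0 <= M ->
    J (- M) M (fun x => U T (x + k * T) * psi x) - J (- M) M (fun x => U 0 x * psi x) =
    J 0 T (fun t => J (- M) M (fun x => fl t (x + k * t) * chi x))) ->
  forall a b, a <= b ->
  J a b (fun x => U T (x + k * T)) - J a b (U 0) =
  J 0 T (fun t => fl t (a + k * t) - fl t (b + k * t)).
Proof.
move=> bU bfl cfl T0 H a b ab.
pose M := `|a| + `|b| + 3.
have [aM bM aM' bM'] : [/\ a <= M, b <= M, - M <= a - 3 & - M <= b - 3].
  have [a1 a2] := abs_bounds a; have [b1 b2] := abs_bounds b.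
  have a0 := normr_ge0 a; have b0 := normr_ge0 b.
  by split; rewrite /M; lra.
have M0 : 0 <= M by rewrite /M !addr_ge0.
have {}H n := H _ _ _ _ (tst_step n ab) M0.
have bUT : lb (fun x => U T (x + k * T)) by lbt.
have bs c n : lb (step c n) := C11_lb (C11_step c n).
have bb c n : lb (bump c n) := C11_lb' (C11_step c n).
have Ma : - M <= a by lra.
have C1 : J (- M) M (fun x => U T (x + k * T) * (step a n x - step b n x)) -
     J (- M) M (fun x => U 0 x * (step a n x - step b n x)) @[n --> \oo] -->
     J a b (fun x => U T (x + k * T)) - J a b (U 0).
  by apply: cvgB; apply: step_cvg => //; lbt.
have [B flB] := bfl.2 (M + `|k| * T + T).
have bfk t : lb (fun x => fl t (x + k * t)) by lbt.
have C2 : J 0 T (fun t => J (- M) M (fun x => fl t (x + k * t) * (bump a n x - bump b n x)))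
    @[n --> \oo] --> J 0 T (fun t => fl t (a + k * t) - fl t (b + k * t)).
  apply: (@J_cvg _ 0 T _ _ (B + B)) => //.
  - move=> n; apply: (@lb_J _ _ _ (fun t x => fl t (x + k * t) * (bump a n x - bump b n x))).
    have := bb a n; have := bb b n => ? ?.
    by lbt.
  - by lbt.
  - move=> n t /andP[t0 tT].
    under [X in `|X|]eq_J do rewrite mulrBr.
    have := bb a n; have := bb b n => ? ?; have := bfk t => ?.
    rewrite J_sub; [|by lbt..].
    have flB' x : - M <= x <= M -> `|fl t (x + k * t)| <= B.
      have kT : `|k * t| <= `|k| * T by rewrite normrM ler_wpM2l// ger0_norm.
      have kT0 : 0 <= `|k| * T by rewrite mulr_ge0.
      move=> xM; apply: flB; first by rewrite ger0_norm; lra.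
      rewrite (le_trans (ler_normD _ _))//.
      have : `|x| <= M by rewrite ler_norml.
      by move=> ?; lra.
    by rewrite (le_trans (ler_normB _ _))// lerD//; apply: J_bump_le.
  - move=> t /andP[t0 tT].
    have := bfk t => bft.
    rewrite (_ : (fun n => _) = (fun n => J (- M) M (fun x => fl t (x + k * t) * bump a n x) -
       J (- M) M (fun x => fl t (x + k * t) * bump b n x))); last first.
      apply/funext => n; have := bb a n; have := bb b n => ? ?.
      rewrite -J_sub; [|by lbt..].
      by apply: eq_J => x _; rewrite mulrBr.
    have cft c : lcont (fun x => fl t (x + k * t)) c.
      move=> e e0; have [d d0 Hd] := cfl t (c + k * t) _ e0.
      by exists d => // y /andP[? ?]; apply: Hd; apply/andP; split; lra.
    by apply: cvgB; exact: bump_cvg.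
have C3 : J (- M) M (fun x => U T (x + k * T) * (step a n x - step b n x)) -
     J (- M) M (fun x => U 0 x * (step a n x - step b n x)) @[n --> \oo] -->
     J 0 T (fun t => fl t (a + k * t) - fl t (b + k * t)).
  by apply: cvg_trans C2; apply: near_eq_cvg; apply: nearW => n; exact: esym (H n).
exact: (cvg_unique _ C1 C3).
Qed.

(** If left continuity fails, each radius [1 / (n + 1)] has a counterexample, and choice collects
    them into a sequence. In this sequential form left continuity of an integral follows by
    dominated convergence. *)
Lemma lcont_seq f x :
  (forall y : R^nat, (forall n, x - n.+1%:R^-1 <= y n <= x) -> f (y n) @[n --> \oo] --> f x) ->
  lcont f x.
Proof.
move=> H e e0; apply: contrapT => /forall2NP Hd.
have {}Hd n : exists y, x - n.+1%:R^-1 <= y <= x /\ ~ (`|f y - f x| <= e).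
  have [] := Hd (n.+1%:R^-1); first by rewrite invr_gt0// ltr0n.
  by move=> /existsNP[y /not_implyP[? ?]]; exists y.
have [y Hy] := choice Hd.
have /cvgrPdist_le /(_ _ e0) [N _ HN] := H y (fun n => (Hy n).1).
by case: (Hy N) => _; apply; rewrite distrC; exact: HN (leqnn N).
Qed.

Lemma lcont_cvg f x (y : R^nat) : lcont f x -> (forall n, x - n.+1%:R^-1 <= y n <= x) ->
  f (y n) @[n --> \oo] --> f x.
Proof.
move=> cf Hy; apply/cvgrPdist_le => e e0.
have [d d0 Hd] := cf _ e0; near=> n.
rewrite distrC; apply: Hd; have /andP[h ->] := Hy n; rewrite andbT.
apply: le_trans h; rewrite lerD2l lerN2 invf_ple ?posrE ?ltr0n//.
apply: ltW; apply: (@lt_trans _ _ n%:R); last by rewrite ltr_nat.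
near: n; exact: nbhs_infty_gtr.
Unshelve. all: by end_near. Qed.

Lemma lcont_le f g x : lb f -> lb g -> lcont f x -> lcont g x ->
  (forall a b, a <= b -> J a b f <= J a b g) -> f x <= g x.
Proof.
move=> bf bg cf cg H; rewrite leNgt; apply/negP => gf.
have e0 : 0 < (f x - g x) / 4 by rewrite divr_gt0// subr_gt0.
have [d d0 Hd] := cf _ e0; have [d' d'0 Hd'] := cg _ e0.
pose m := Num.min d d'; have m0 : 0 < m by rewrite lt_min d0.
have xm : x - m <= x by rewrite lerBlDr lerDl ltW.
have := H _ _ xm; rewrite -subr_le0 -J_sub// leNgt => /negP; apply.
apply: (@lt_le_trans _ _ ((f x - g x) / 2 * (x - (x - m)))).
  by rewrite mulr_gt0 ?divr_gt0 ?subr_gt0// ltrBlDr ltrDl.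
apply: J_ge_cst; [by lbt|by []|] => y /andP[my yx].
have md : m <= d by rewrite /m ge_min lexx.
have md' : m <= d' by rewrite /m ge_min lexx orbT.
have := Hd y; have := Hd' y; rewrite yx !andbT !ler_norml.
have -> : x - d <= y by lra.
have -> : x - d' <= y by lra.
by move=> /(_ isT)/andP[? ?] /(_ isT)/andP[? ?]; lra.
Qed.

(** The two translated integrals cancel except on windows of length [2 |p|] around [a] and [b], so
    the bound does not grow with [b - a]; this is what makes the estimates uniform in the length of
    the interval. *)
Lemma J_shift_le f a b p B1 B2 : lb f -> a <= b -> (forall x, B1 <= f x <= B2) ->
  J a b (fun x => f (x - p) - f (x + p)) <= 2 * `|p| * (B2 - B1).
Proof.
move=> bf ab fB.
have H (q : R) : 0 <= q -> `|J a b (fun x => f (x - q) - f (x + q))| <= 2 * q * (B2 - B1).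
  move=> q0.
  have balance (p1 p2 p3 p4 : R) : p1 + p2 = p3 + p4 -> p1 - p4 = p3 - p2 by lra.
  rewrite J_sub; [|by lbt..]; rewrite !J_shift//.
  have E1 := @J_cat _ (a - q) (a + q) (b + q) f bf.
  have E2 := @J_cat _ (a - q) (b - q) (b + q) f bf.
  have -> : J (a - q) (b - q) f - J (a + q) (b + q) f =
      J (a - q) (a + q) f - J (b - q) (b + q) f.
    have e1 : a - q <= a + q <= b + q by apply/andP; split; lra.
    have e2 : a - q <= b - q <= b + q by apply/andP; split; lra.
    exact: (balance _ _ _ _ (etrans (esym (E2 e2)) (E1 e1))).
  clear E1 E2 balance.
  have f1 x := proj1 (andP (fB x)); have f2 x := proj2 (andP (fB x)).
  have i1 z : z - q <= z + q by lra.
  have l1 z := J_le_cst bf (i1 z) (fun x _ => f2 x).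
  have l2 z := J_ge_cst bf (i1 z) (fun x _ => f1 x).
  have := l1 a; have := l1 b; have := l2 a; have := l2 b.
  rewrite (_ : a + q - (a - q) = 2 * q); last by ring.
  rewrite (_ : b + q - (b - q) = 2 * q); last by ring.
  by move=> *; rewrite ler_norml; apply/andP; split; lra.
have [p0|p0] := leP 0 p.
  by rewrite (ger0_norm p0); exact: le_trans (ler_norm _) (H _ p0).
rewrite (ltr0_norm p0).
have p0' : 0 <= - p by rewrite oppr_ge0 ltW.
have := H _ p0'; rewrite opprK -normrN -J_opp; last by lbt.
move=> /(le_trans (ler_norm _)); apply: le_trans.
by rewrite le_eqVlt; apply/orP; left; apply/eqP; apply: eq_J => x _; ring.
Qed.

Lemma J_ftc f f' a b : a < b -> (forall x : R, is_derive x 1 f (f' x)) -> continuous f' ->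
  J a b f' = f b - f a.
Proof.
move=> ab df cf'; rewrite /J /Rintegral (@continuous_FTC2 _ f' f a b ab) //.
- exact: continuous_subspaceT.
- have cf := is_derive_continuous df; split.
  + by move=> x _; exact: (@ex_derive _ _ _ _ _ _ _ (df x)).
  + exact: cvg_at_right_filter (cf a).
  + exact: cvg_at_left_filter (cf b).
- by move=> x _; rewrite derive1E; exact: (@derive_val _ _ _ _ _ _ _ (df x)).
Qed.

End SpaceTests.

Section Supports.
Variable R : realType.
Implicit Types (f g : R -> R) (a b x y M k d : R).

(** The class in which the weak formulations are tested. It is larger than [C11c], so that the
    product of a [C11c] function with [exp (t / eps)] can be used in [duhamel] without a Lipschitz
    bound on its derivative. *)
Definition C1c M f f' : Prop :=
  [/\ forall x : R, is_derive x 1 f (f' x), continuous f' &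
      forall x, M <= `|x| -> f x = 0 /\ f' x = 0].

Lemma C11c_C1c M f f' : C11c M f f' -> C1c M f f'.
Proof. by move=> [Cf f0]; split; [exact: Cf.1|exact: C11_continuous' Cf|]. Qed.

Lemma C1c_lb M f f' : C1c M f f' -> lb f.
Proof. by move=> [df _ _]; apply: lb_continuous; exact: is_derive_continuous df. Qed.

Lemma C1c_lb' M f f' : C1c M f f' -> lb f'.
Proof. by move=> [_ cf' _]; exact: lb_continuous. Qed.

Lemma J_zero a b f : (forall x, a <= x <= b -> f x = 0) -> J a b f = 0.
Proof.
move=> f0; rewrite (eq_J f0); have [ab|ba] := leP a b; last by rewrite J_gt.
by rewrite J_cst// mul0r.
Qed.

Lemma J_zero_oo a b f : lb f -> (forall x, a < x < b -> f x = 0) -> J a b f = 0.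
Proof.
move=> bf f0; rewrite (eq_J_oo bf (lb_cst 0) f0).
by apply: J_zero.
Qed.

Lemma J_supp a b c d f : lb f -> a <= c -> c <= d -> d <= b ->
  (forall x, x < c \/ d < x -> f x = 0) -> J a b f = J c d f.
Proof.
move=> bf ac cd db f0.
rewrite (@J_cat _ a c b)//; last by rewrite ac (le_trans cd).
rewrite (@J_cat _ c d b)//; last by rewrite cd.
rewrite (@J_zero_oo a c)//; last by move=> x /andP[_ xc]; apply: f0; left.
by rewrite (@J_zero_oo d b) ?add0r ?addr0// => x /andP[dx _]; apply: f0; right.
Qed.

Lemma J_supp_shift f M M' d : lb f -> 0 <= M -> M + `|d| <= M' ->
  (forall x, M <= `|x| -> f x = 0) ->
  J (- M') M' (fun x => f (x + d)) = J (- M) M f.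
Proof.
move=> bf M0 MM' f0; have [d1 d2] := abs_bounds d.
rewrite J_shift//; apply: J_supp => //; [lra|lra|lra|].
move=> x xM; apply: f0; rewrite ler_normr; apply/orP.
by case: xM => ?; [right|left]; lra.
Qed.

Lemma lb_C11c_lip M f f' : C11c M f f' -> exists2 K, 0 <= K &
  (forall x, `|f x| <= K) /\ (forall x y, `|f x - f y| <= K * `|x - y|).
Proof.
move=> [Cf f0]; have bf := C11_lb Cf; have bf' := C11_lb' Cf.
have [B fB] := bf.2 M; have [B' fB'] := bf'.2 M.
exists (`|B| + `|B'|); first by rewrite addr_ge0.
split.
  move=> x; have [Mx|xM] := leP M `|x|; first by rewrite (f0 x Mx).1 normr0 addr_ge0.
  rewrite (le_trans (fB x (ltW xM)))//; have := ler_norm B; have := normr_ge0 B'.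
  by move=> *; lra.
have f'K x : `|f' x| <= `|B| + `|B'|.
  have [Mx|xM] := leP M `|x|; first by rewrite (f0 x Mx).2 normr0 addr_ge0.
  rewrite (le_trans (fB' x (ltW xM)))//; have := ler_norm B'; have := normr_ge0 B.
  by move=> *; lra.
have H x y : x <= y -> `|f x - f y| <= (`|B| + `|B'|) * `|x - y|.
  move=> xy; have [z _ E] := mvt xy Cf.1.
  by rewrite distrC E normrM (distrC x y) ler_wpM2r.
move=> x y; have [xy|/ltW yx] := leP x y; first exact: H.
by rewrite distrC (distrC x); exact: H.
Qed.

End Supports.

(** * Passing from one moving frame to another *)

Section Frames.
Variable R : realType.
Variables (eps l : R) (e : R -> R -> R).
Hypotheses (eps0 : 0 < eps) (be : lb2 e).
Hypothesis He : forall M psi psi', C11c M psi psi' -> 0 <= M ->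
  forall T1 T2, 0 <= T1 -> T1 <= T2 ->
  J T1 T2 (fun t => expR (t / eps) * J (- M) M (fun x => e t (x + l * t) * psi x)) = 0.

Lemma expR_sub1_le (y Y : R) : 0 <= y -> y <= Y -> `|expR y - 1| <= expR Y * y.
Proof.
move=> y0 yY.
have [z /andP[z0 zy]] := mvt y0 (@is_derive_expR R).
rewrite expR0 subr0 => ->.
rewrite ger0_norm ?mulr_ge0 ?expR_ge0// ler_wpM2r// ler_expR.
exact: le_trans zy yY.
Qed.

(* On a time slice of length h the frames moving at speeds k and l differ by O(h), whence an
   error O(h^2), to which [partition_eq] applies. *)
Lemma change_frame k M chi chi' T : C11c M chi chi' -> 0 <= M -> 0 <= T ->
  J 0 T (fun t => J (- M) M (fun x => e t (x + k * t) * chi x)) = 0.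
Proof.
move=> Cchi M0 T0.
have [K K0 [chiK chiL]] := lb_C11c_lip Cchi.
have bchi := C11_lb Cchi.1.
pose M' := M + (`|l| + `|k|) * T.
have M'0 : 0 <= M' by rewrite addr_ge0// mulr_ge0// addr_ge0.
have [B eB] := be.2 (M' + `|l| * T + T).
have bF : lb (fun t => J (- M) M (fun x => e t (x + k * t) * chi x)).
  by apply: (@lb_J _ _ _ (fun t x => e t (x + k * t) * chi x)); lbt.
have eB' t x : 0 <= t <= T -> - M' <= x <= M' -> `|e t (x + l * t)| <= B.
  move=> /andP[t0 tT] xM'.
  have h : `|l * t| <= `|l| * T by rewrite normrM ler_wpM2l// ger0_norm.
  have h0 : 0 <= `|l| * T by rewrite mulr_ge0.
  apply: eB; first by rewrite ger0_norm; lra.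
  rewrite (le_trans (ler_normD _ _))//.
  have : `|x| <= M' by rewrite ler_norml.
  by move=> ?; lra.
have B0 : 0 <= B.
  by apply: le_trans (eB' 0 0 _ _) => //; rewrite ?lexx// oppr_le0 M'0.
pose C1 := K * `|l - k| + K * (expR (T / eps) / eps).
rewrite -[RHS](J_xx 0 (fun t => J (- M) M (fun x => e t (x + k * t) * chi x))).
apply: (@partition_eq _ (fun T => J 0 T (fun t => J (- M) M (fun x => e t (x + k * t) * chi x)))
  (B * C1 * (M' - - M')) 0 T T0) => s t s0 st tT.
rewrite (@J_cat _ 0 s t)// ?s0// addrAC subrr add0r.
have dT (u : R) : 0 <= u <= T -> M + `|(l - k) * u| <= M'.
  move=> /andP[u0 uT]; rewrite lerD2l normrM (ger0_norm u0) ler_pM//.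
  exact: ler_normB.
have C2 : C11c M' (fun x => chi (x + (l - k) * s)) (fun x => chi' (x + (l - k) * s)).
  split.
    have := C11_affine 1 ((l - k) * s) Cchi.1.
    by apply: C11_ext => x; rewrite !mul1r.
  move=> x Mx; apply: Cchi.2.
  have := dT s; have := ler_normB (x + (l - k) * s) ((l - k) * s).
  rewrite addrK => h1 h2.
  have : M + `|(l - k) * s| <= M' by apply: h2; apply/andP; split; lra.
  by move=> ?; lra.
(* Read in the frame of speed [l], the test function drifts at speed [l - k]; the interval
   [[- M', M']] contains its support up to time [T]. *)
have E1 : J s t (fun t => J (- M) M (fun x => e t (x + k * t) * chi x)) =
  J s t (fun u => J (- M') M' (fun x => e u (x + l * u) * chi (x + (l - k) * u))).
  apply: eq_J => u /andP[su ut].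
  rewrite -(@J_supp_shift _ (fun x => e u (x + k * u) * chi x) M M' ((l - k) * u)) //.
  - by apply: eq_J => x _; congr (e _ _ * _); ring.
  - by lbt.
  - by apply: dT; apply/andP; split; lra.
  - by move=> x Mx; rewrite (Cchi.2 x Mx).1 mulr0.
(* With the test function frozen at time [s], [He] applies. The weight is normalized to 1 at
   [u = s], so that it stays within O(t - s) of the weight 1 in [E1]. *)
have E2 : J s t (fun u => J (- M') M' (fun x => expR ((u - s) / eps) *
     (e u (x + l * u) * chi (x + (l - k) * s)))) = 0.
  have := He C2 M'0 s0 st.
  move=> /(congr1 (fun z => expR (- s / eps) * z)); rewrite mulr0 => <-.
  rewrite -J_mull; last first.
    have ? := @lb_J _ (- M') M' (fun u x => e u (x + l * u) * chi (x + (l - k) * s)) _.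
    lbt.
    by apply: (@lb_J _ (- M') M' (fun u x => e u (x + l * u) * chi (x + (l - k) * s))); lbt.
  apply: eq_J => u _; rewrite J_mull; last by lbt.
  by rewrite mulrA -expRD; congr (expR _ * _); field; rewrite gt_eqF.
have bG1 : lb (fun u => J (- M') M' (fun x => e u (x + l * u) * chi (x + (l - k) * u))).
  by apply: (@lb_J _ _ _ (fun u x => e u (x + l * u) * chi (x + (l - k) * u))); lbt.
have bG2 : lb (fun u => J (- M') M' (fun x => expR ((u - s) / eps) *
     (e u (x + l * u) * chi (x + (l - k) * s)))).
  by apply: (@lb_J _ _ _ (fun u x => expR ((u - s) / eps) *
     (e u (x + l * u) * chi (x + (l - k) * s)))); lbt.
rewrite E1 -[X in `|X|]subr0 -[X in `|_ - X|]E2 -J_sub//.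
rewrite expr2 mulrA; apply: J_le_norm; [by lbt|by []|].
move=> u /andP[su ut]; rewrite -J_sub; [|by lbt..].
have u0T : 0 <= u <= T by rewrite (le_trans s0 su) (le_trans ut tT).
have MM' : - M' <= M' by rewrite (le_trans _ M'0)// oppr_le0.
rewrite mulrAC; apply: J_le_norm; [by lbt|by []|] => x xM'.
clear E1 E2 bG1 bG2 C2 bF dT bchi.
rewrite (_ : _ - _ = e u (x + l * u) * (chi (x + (l - k) * u) - chi (x + (l - k) * s) -
  chi (x + (l - k) * s) * (expR ((u - s) / eps) - 1))); last by ring.
rewrite normrM -mulrA ler_pM//; first exact: eB'.
rewrite (le_trans (ler_normB _ _))// /C1 [leRHS]mulrDl lerD//.
  rewrite (le_trans (chiL _ _))// -mulrA ler_wpM2l//.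
  rewrite (_ : _ - _ = (l - k) * (u - s)); last by ring.
  by rewrite normrM ler_wpM2l// ger0_norm; lra.
rewrite normrM -!mulrA ler_pM//.
have us0 : 0 <= u - s by rewrite subr_ge0.
have h1 : 0 <= (u - s) / eps by rewrite divr_ge0// ltW.
have h2 : (u - s) / eps <= T / eps by rewrite ler_pM2r ?invr_gt0//; lra.
rewrite (le_trans (expR_sub1_le h1 h2))// ler_wpM2l ?expR_ge0//.
rewrite mulrC ler_pM2l ?invr_gt0//; lra.
Qed.

End Frames.

(** * The relaxation system *)

Section WeakBalance.
Variable R : realType.

(** For fixed [psi] the tested equation is the weak form of an ordinary differential equation for
    the moment of [U] against [psi] in the frame of speed [k], in which the flux is [V - k U]. *)
Lemma weak_balance (U V : R -> R -> R) (k M : R) (psi psi' : R -> R) :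
  lb2 U -> lb2 V -> C1c M psi psi' ->
  (forall M1 al al', C11c M1 al al' -> (forall t, 0 <= al t) ->
    J 0 M1 (fun t => J (- M) M (fun x =>
      U t (x + k * t) * (al' t * psi x - k * al t * psi' x) +
      V t (x + k * t) * (al t * psi' x))) +
    al 0 * J (- M) M (fun x => U 0 x * psi x) = 0) ->
  forall T : R, 0 <= T -> rcont (fun t => J (- M) M (fun x => U t (x + k * t) * psi x)) T ->
  J (- M) M (fun x => U T (x + k * T) * psi x) - J (- M) M (fun x => U 0 x * psi x) =
  J 0 T (fun t => J (- M) M (fun x =>
    (V t (x + k * t) - k * U t (x + k * t)) * psi' x)).
Proof.
move=> bU bV Cpsi H T T0 cT.
have bpsi := C1c_lb Cpsi; have bpsi' := C1c_lb' Cpsi.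
pose a t := J (- M) M (fun x => U t (x + k * t) * psi x).
pose b t := J (- M) M (fun x => (V t (x + k * t) - k * U t (x + k * t)) * psi' x).
have ba : lb a by apply: (@lb_J _ _ _ (fun t x => U t (x + k * t) * psi x)); lbt.
have bb : lb b.
  by apply: (@lb_J _ _ _ (fun t x => (V t (x + k * t) - k * U t (x + k * t)) * psi' x)); lbt.
pose a0 := J (- M) M (fun x => U 0 x * psi x).
suff E : a T = a0 + J 0 T b by apply/eqP; rewrite subr_eq addrC; apply/eqP; exact: E.
apply: (weak_ode_rcont ba bb _ T0 cT) => M1 al al' Cal al0.
have := H _ _ _ Cal al0; rewrite mulrC => E1; rewrite -[RHS]E1; congr (_ + _).
apply: eq_J => t _.
rewrite /a /b [in RHS](eq_J (g := fun x => al' t * (U t (x + k * t) * psi x) +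
  al t * ((V t (x + k * t) - k * U t (x + k * t)) * psi' x))); last first.
  by move=> x _; ring.
rewrite J_add; [|by lbt..].
by rewrite !J_mull; [|by lbt..]; ring.
Qed.

Lemma J_mean (F G : R -> R -> R) (k M T : R) (chi : R -> R) : lb2 F -> lb2 G -> lb chi ->
  J 0 T (fun t => J (- M) M (fun x => 2^-1 * (F t (x + k * t) + G t (x + k * t)) * chi x)) =
  2^-1 * (J 0 T (fun t => J (- M) M (fun x => F t (x + k * t) * chi x)) +
          J 0 T (fun t => J (- M) M (fun x => G t (x + k * t) * chi x))).
Proof.
move=> bF bG bchi.
have jF : lb (fun t => J (- M) M (fun x => F t (x + k * t) * chi x)).
  by apply: (@lb_J _ _ _ (fun t x => F t (x + k * t) * chi x)); lbt.
have jG : lb (fun t => J (- M) M (fun x => G t (x + k * t) * chi x)).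
  by apply: (@lb_J _ _ _ (fun t x => G t (x + k * t) * chi x)); lbt.
rewrite -J_add; [|by []..]; rewrite -J_mull; last by lbt.
apply: eq_J => t _; rewrite -J_add; [|by lbt..].
rewrite -J_mull; last by lbt.
by apply: eq_J => x _; ring.
Qed.

End WeakBalance.

Section Relaxation.
Variable R : realType.
Variables (c eps : R) (U V : R -> R -> R).
Hypotheses (eps0 : 0 < eps) (bU : lb2 U) (bV : lb2 V).
Hypothesis lU : forall t x, lcont (U t) x.
Hypothesis cU : forall k M psi psi', C11c M psi psi' -> 0 <= M -> forall T : R, 0 <= T ->
  rcont (fun t => J (- M) M (fun x => U t (x + k * t) * psi x)) T.
(** [W1] and [W2] are the two equations of the system tested with [al t * psi (x - k t)], after the
    substitution of [x + k t] for [x]. The term [3 / 8 + U^2 / 2] in [W2] is the initial value of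
    [v], computed in [v0_ofE]. *)
Hypothesis W1 : forall k M1 M al al' psi psi', C1c M1 al al' -> C1c M psi psi' ->
  0 <= M ->
  J 0 M1 (fun t => J (- M) M (fun x =>
    U t (x + k * t) * (al' t * psi x - k * al t * psi' x) +
    V t (x + k * t) * (al t * psi' x))) +
  al 0 * J (- M) M (fun x => U 0 x * psi x) = 0.
Hypothesis W2 : forall k M1 M al al' psi psi', C1c M1 al al' -> C1c M psi psi' ->
  0 <= M ->
  J 0 M1 (fun t => J (- M) M (fun x =>
    V t (x + k * t) * (al' t * psi x - k * al t * psi' x) +
    c ^+ 2 * U t (x + k * t) * (al t * psi' x) +
    eps^-1 * (2^-1 * U t (x + k * t) ^+ 2 - V t (x + k * t)) * (al t * psi x))) +
  al 0 * J (- M) M (fun x => (3 / 8 + 2^-1 * U 0 x ^+ 2) * psi x) = 0.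

Definition Nl (l y : R) : R := l * y + 2^-1 * y ^+ 2.

(* Duhamel's formula for [l * U + V] along the characteristics of speed l = c, - c, on which
   it relaxes towards [Nl l U]; the constant 3/8 of the initial datum of V is split off, see [defect]. *)
Definition kinetic (l t x : R) : R := expR (- t / eps) * (Nl l (U 0 (x - l * t)) +
  eps^-1 * J 0 t (fun s => expR (s / eps) * Nl l (U s (x - l * t + l * s)))).

Lemma lb2_prim l : lb2 (fun t y => J 0 t (fun s => expR (s / eps) * Nl l (U s (y + l * s)))).
Proof.
apply: (@lb2_primitive _ (fun s y => expR (s / eps) * Nl l (U s (y + l * s)))).
by rewrite /Nl; lbt.
Qed.

Lemma lb2_kinetic l : lb2 (kinetic l).
Proof.
have bP := lb2_prim l.
have bP' : lb2 (fun t x => J 0 t (fun s => expR (s / eps) * Nl l (U s (x - l * t + l * s)))).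
  by apply: (lb2_lb2 bP (G := fun t _ => t) (H := fun t x => x - l * t)); lbt.
by rewrite /kinetic /Nl; lbt.
Qed.

(** The error in Duhamel's formula, to be distinguished from the flux defect [w - U^2 / 2]. It is
    shown to vanish in the weak sense of [duhamel], the sense available for a measurable [V]. *)
Definition defect (l t x : R) : R :=
  l * U t x + V t x - kinetic l t x - expR (- t / eps) * (3 / 8).

Lemma lb2_defect l : lb2 (defect l).
Proof. by have := lb2_kinetic l; rewrite /defect => ?; lbt. Qed.

Lemma expR_mulVN (t : R) : expR (t / eps) * expR (- t / eps) = 1.
Proof. by rewrite -expRD mulNr subrr expR0. Qed.

(** In the frame of speed [l] all terms with [psi'] cancel in [l] times [W1] plus [W2], because
    [l^2 = c^2]. What remains is a weak ordinary differential equation in [t]; the integrating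
    factor [exp (t / eps)], put into the test function, absorbs the damping and leaves the source
    [Nl l U / eps]. *)
Lemma duhamel l M psi psi' : l ^+ 2 = c ^+ 2 -> C11c M psi psi' -> 0 <= M ->
  forall T1 T2, 0 <= T1 -> T1 <= T2 ->
  J T1 T2 (fun t => expR (t / eps) *
    J (- M) M (fun x => defect l t (x + l * t) * psi x)) = 0.
Proof.
move=> lc Cpsi M0 T1 T2 T10 T12.
have C1psi := C11c_C1c Cpsi; have bpsi := C1c_lb C1psi; have bpsi' := C1c_lb' C1psi.
have bK := lb2_kinetic l; have bP := lb2_prim l.
pose a t := expR (t / eps) *
  J (- M) M (fun x => (l * U t (x + l * t) + V t (x + l * t)) * psi x).
pose b t := eps^-1 * expR (t / eps) * J (- M) M (fun x => Nl l (U t (x + l * t)) * psi x).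
pose a0 := J (- M) M (fun x => (Nl l (U 0 x) + 3 / 8) * psi x).
have ba : lb a.
  have ? := @lb_J _ (- M) M (fun t x => (l * U t (x + l * t) + V t (x + l * t)) * psi x).
  have ? : lb (fun t => J (- M) M (fun x => (l * U t (x + l * t) + V t (x + l * t)) * psi x)).
    by apply: (@lb_J _ (- M) M (fun t x => (l * U t (x + l * t) + V t (x + l * t)) * psi x)); lbt.
  by rewrite /a; lbt.
have bb : lb b.
  have ? : lb (fun t => J (- M) M (fun x => Nl l (U t (x + l * t)) * psi x)).
    by apply: (@lb_J _ (- M) M (fun t x => Nl l (U t (x + l * t)) * psi x)); rewrite /Nl; lbt.
  by rewrite /b; lbt.
rewrite -[RHS](@weak_ode R a b a0 ba bb _ T1 T2 T10 T12); last first.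
  move=> M1 th th' Cth _.
  have [Cth1 th0] := Cth.
  pose al t := expR (t / eps) * th t.
  pose al' t := expR (t / eps) * (th' t + th t / eps).
  have Cal : C1c M1 al al'.
    split.
    - move=> t; rewrite /al /al'.
      have dE : is_derive t 1 (fun t => expR (t / eps)) (expR (t / eps) / eps).
        apply: (@is_derive1_comp _ (@expR R) (fun t => t / eps)).
        rewrite -[X in is_derive _ _ _ X]mul1r.
        rewrite (_ : (fun t => t / eps) = eps^-1 \*: id); last first.
          by apply/funext => z; rewrite /= mulrC.
        rewrite [X in is_derive _ _ _ X]mulrC.
        exact: is_deriveZ.
      rewrite (_ : _ * _ = expR (t / eps) *: th' t + th t *: (expR (t / eps) / eps)); last first.
        by rewrite /GRing.scale/=; ring.
      exact: (is_deriveM dE (Cth1.1 t)).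
    - have c1 := C11_continuous' Cth1; have c2 := C11_continuous Cth1.
      rewrite /al'; move=> t; apply: cvgM.
        apply: continuous_comp; last exact: continuous_expR.
        by apply: cvgM; [exact: cvg_id|exact: cvg_cst].
      apply: (@cvgD _ _ _ _ _ th' (fun t => th t / eps)); first exact: c1.
      by apply: cvgM; [exact: c2|exact: cvg_cst].
    - by move=> t; rewrite /al /al' => /th0[-> ->]; rewrite mul0r addr0 !mulr0.
  have w1 := W1 l Cal C1psi M0; have w2 := W2 l Cal C1psi M0.
  have bal := C1c_lb Cal; have bal' := C1c_lb' Cal.
  have bth := C11_lb Cth1; have bth' := C11_lb' Cth1.
  set I1 := J 0 M1 _ in w1; set I2 := J 0 M1 _ in w2.
  set i1 := J (- M) M _ in w1; set i2 := J (- M) M _ in w2.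
  have -> : a0 = l * i1 + i2.
    rewrite /a0 /i1 /i2 -J_mull; last by lbt.
    rewrite -J_add; [|by lbt..].
    by apply: eq_J => x _; rewrite /Nl; ring.
  have al0 : al 0 = th 0 by rewrite /al mul0r expR0 mul1r.
  rewrite al0 in w1 w2.
  suff -> : J 0 M1 (fun t => a t * th' t + b t * th t) = l * I1 + I2.
    transitivity (l * (I1 + th 0 * i1) + (I2 + th 0 * i2)); first by ring.
    by rewrite w1 w2 mulr0 addr0.
  have bi1 : lb (fun t => J (- M) M (fun x =>
    U t (x + l * t) * (al' t * psi x - l * al t * psi' x) +
    V t (x + l * t) * (al t * psi' x))).
    by apply: (@lb_J _ (- M) M (fun t x =>
    U t (x + l * t) * (al' t * psi x - l * al t * psi' x) +
    V t (x + l * t) * (al t * psi' x))); lbt.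
  have bi2 : lb (fun t => J (- M) M (fun x =>
    V t (x + l * t) * (al' t * psi x - l * al t * psi' x) +
    c ^+ 2 * U t (x + l * t) * (al t * psi' x) +
    eps^-1 * (2^-1 * U t (x + l * t) ^+ 2 - V t (x + l * t)) * (al t * psi x))).
    by apply: (@lb_J _ (- M) M (fun t x => V t (x + l * t) * (al' t * psi x - l * al t * psi' x) +
    c ^+ 2 * U t (x + l * t) * (al t * psi' x) +
    eps^-1 * (2^-1 * U t (x + l * t) ^+ 2 - V t (x + l * t)) * (al t * psi x))); lbt.
  rewrite /I1 /I2 -J_mull// -J_add//; last by lbt.
  apply: eq_J => t _; rewrite /a /b.
  rewrite -[in RHS]J_mull; last by lbt.
  rewrite -[in RHS]J_add; [|by lbt..].
  rewrite [RHS](eq_J (g := fun x => expR (t / eps) * th' t *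
    ((l * U t (x + l * t) + V t (x + l * t)) * psi x) +
    eps^-1 * expR (t / eps) * th t * (Nl l (U t (x + l * t)) * psi x))); last first.
    by move=> x _; rewrite -lc /al' /al /Nl; ring.
  have ? : lb (fun x => Nl l (U t (x + l * t)) * psi x) by rewrite /Nl; lbt.
  by rewrite J_add ?J_mull; [ring|by lbt..].
apply: eq_J => t /andP[T1t _].
have t0 : 0 <= t by apply: le_trans T1t.
pose h s x := expR (s / eps) * Nl l (U s (x + l * s)).
have bh : lb2 h by rewrite /h /Nl; lbt.
pose P x := J 0 t (h ^~ x).
have bPx : lb P by exact: lb_J2.
have bN0 : lb (fun x => Nl l (U 0 x)) by rewrite /Nl; lbt.
have -> : J 0 t b = eps^-1 * J (- M) M (fun x => P x * psi x).
  have -> : J (- M) M (fun x => P x * psi x) =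
      J 0 t (fun s => J (- M) M (fun x => h s x * psi x)).
    rewrite J_swap; last by lbt.
    by apply: eq_J => x _; rewrite J_mulr//; rewrite /h /Nl; lbt.
  rewrite -J_mull; last by apply: (@lb_J _ _ _ (fun s x => h s x * psi x)); lbt.
  apply: eq_J => s _; rewrite /b -mulrA; congr (_ * _).
  rewrite -J_mull; last by rewrite /Nl; lbt.
  by apply: eq_J => x _; rewrite /h mulrA.
pose f1 x := (l * U t (x + l * t) + V t (x + l * t)) * psi x.
pose f2 x := (Nl l (U 0 x) + 3 / 8) * psi x.
pose f3 x := P x * psi x.
have bd := lb2_defect l.
have bf0 : lb (fun x => defect l t (x + l * t) * psi x) by lbt.
have bf1 : lb f1 by rewrite /f1; lbt.
have bf2 : lb f2 by rewrite /f2; lbt.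
have bf3 : lb f3 by rewrite /f3; lbt.
rewrite -J_mull// /a /a0 -/f1 -/f2 -/f3 -[X in X - _ - _]J_mull// -[X in _ - X]J_mull//.
rewrite -J_sub; [|by lbt..].
rewrite -J_sub; [|by lbt..].
apply: eq_J => x _; rewrite /defect /kinetic addrK -/(P x) /f1 /f2 /f3.
transitivity (expR (t / eps) * ((l * U t (x + l * t) + V t (x + l * t)) * psi x) -
    (expR (t / eps) * expR (- t / eps)) * ((Nl l (U 0 x) + 3 / 8) * psi x +
      eps^-1 * (P x * psi x))); first by ring.
by rewrite expR_mulVN; ring.
Qed.

(* As [kinetic l] is [l * U + V] up to a function of t alone, this is V up to a function of t. *)
Definition mean_flux (t x : R) : R := 2^-1 * (kinetic c t x + kinetic (- c) t x).

(** [duhamel] is tied to the frame of speed [l], whereas the flux of [U] is needed in the frames of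
    speed [- l] and 0; [change_frame] carries it there. The term in [3 / 8] disappears when [chi] is
    itself a derivative of a compactly supported function. *)
Lemma flux_K k l M chi chi' T : l ^+ 2 = c ^+ 2 -> C11c M chi chi' -> 0 <= M -> 0 <= T ->
  J 0 T (fun t => J (- M) M (fun x => (l * U t (x + k * t) + V t (x + k * t)) * chi x)) =
  J 0 T (fun t => J (- M) M (fun x => kinetic l t (x + k * t) * chi x)) +
  3 / 8 * J 0 T (fun t => expR (- t / eps)) * J (- M) M chi.
Proof.
move=> lc Cchi M0 T0; have bchi := C11_lb Cchi.1.
have bK := lb2_kinetic l; have bd := lb2_defect l.
have := @change_frame R eps l (defect l) eps0 bd (fun M psi psi' h1 h2 => @duhamel l M psi psi' lc h1 h2) k M chi chi' T Cchi M0 T0.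
move=> E; apply/eqP; rewrite -subr_eq0; apply/eqP; rewrite -[RHS]E.
have ? : lb (fun t => J (- M) M (fun x => kinetic l t (x + k * t) * chi x)).
  by apply: (@lb_J _ _ _ (fun t x => kinetic l t (x + k * t) * chi x)); lbt.
have ? : lb (fun t => J (- M) M (fun x => (l * U t (x + k * t) + V t (x + k * t)) * chi x)).
  by apply: (@lb_J _ _ _ (fun t x => (l * U t (x + k * t) + V t (x + k * t)) * chi x)); lbt.
have bE : lb (fun t : R => expR (- t / eps)) by lbt.
have -> : 3 / 8 * J 0 T (fun t => expR (- t / eps)) * J (- M) M chi =
    J 0 T (fun t => J (- M) M (fun x => expR (- t / eps) * (3 / 8) * chi x)).
  rewrite -[X in X * _]J_mull// -J_mulr; last by lbt.
  by apply: eq_J => t _; rewrite J_mull// (mulrC (3 / 8)).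
have ? : lb (fun t => J (- M) M (fun x => expR (- t / eps) * (3 / 8) * chi x)).
  by apply: (@lb_J _ _ _ (fun t x => expR (- t / eps) * (3 / 8) * chi x)); lbt.
rewrite -J_add; [|by []..]; rewrite -J_sub; [|by []|by lbt].
apply: eq_J => t _.
rewrite -J_add; [|by lbt..].
rewrite -J_sub; [|by lbt..].
by apply: eq_J => x _; rewrite /defect; ring.
Qed.

Lemma J_chi (M : R) psi chi chi' : tst M psi chi chi' -> 0 <= M -> J (- M) M chi = 0.
Proof.
move=> [[Cpsi psi0] _ _] M0; rewrite (C11_ftc Cpsi); last by lra.
by rewrite !(psi0 _ _).1 ?subrr ?normrN ?ger0_norm.
Qed.

Lemma flux_K_tst k l M psi chi chi' T : l ^+ 2 = c ^+ 2 -> tst M psi chi chi' ->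
  0 <= M -> 0 <= T ->
  J 0 T (fun t => J (- M) M (fun x => (l * U t (x + k * t) + V t (x + k * t)) * chi x)) =
  J 0 T (fun t => J (- M) M (fun x => kinetic l t (x + k * t) * chi x)).
Proof.
move=> lc Tt M0 T0; have [_ Cchi _] := Tt.
by rewrite (flux_K k lc Cchi M0 T0) (J_chi Tt M0) mulr0 addr0.
Qed.

Lemma lcont_kinetic l t x : 0 <= t -> lcont (kinetic l t) x.
Proof.
move=> t0; apply: lcont_seq => y Hy; rewrite /kinetic.
have cN s k : Nl l (U s (y n + k)) @[n --> \oo] --> Nl l (U s (x + k)).
  have c1 : U s (y n + k) @[n --> \oo] --> U s (x + k).
    apply: (lcont_cvg (y := fun n => y n + k)); first exact: lU.
    by move=> n; rewrite addrAC !lerD2r; exact: Hy.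
  rewrite /Nl; apply: cvgD; first by apply: cvgM => //; exact: cvg_cst.
  apply: cvgM; first exact: cvg_cst.
  exact: (cvg_comp _ _ c1 (@exprn_continuous R 2 _)).
apply: cvgM; first exact: cvg_cst.
apply: cvgD; first exact: cN.
apply: cvgM; first exact: cvg_cst.
have bN : lb2 (fun s z => expR (s / eps) * Nl l (U s (z + l * s))) by rewrite /Nl; lbt.
have [B HB] := bN.2 (`|x| + 1 + `|l| * t + t).
have Nt (m : R) : 0 <= m -> `|x - l * t| <= `|x| + `|l| * t.
  by move=> _; rewrite (le_trans (ler_normB _ _))// lerD2l normrM (ger0_norm t0).
apply: (@J_cvg _ _ _ (fun n s => expR (s / eps) * Nl l (U s (y n - l * t + l * s))) _ B) => //.
- by move=> n; rewrite /Nl; lbt.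
- by rewrite /Nl; lbt.
- move=> n s /andP[s0 st]; apply: HB.
    rewrite ger0_norm//; have : 0 <= `|l| * t by rewrite mulr_ge0.
    by have := normr_ge0 x; move=> *; lra.
  have /andP[h1 h2] := Hy n.
  have n1 : n.+1%:R^-1 <= 1 :> R by rewrite invf_le1 ?ltr0n// ler1n.
  have : `|y n| <= `|x| + 1.
    rewrite ler_norml; have [x1 x2] := abs_bounds x.
    move: n1 h1; move: (n.+1%:R^-1) => q n1 h1.
    by apply/andP; split; lra.
  move=> h3; rewrite (le_trans (ler_normB _ _))// normrM (ger0_norm t0).
  by lra.
- move=> s _; apply: cvgM; first exact: cvg_cst.
  have := cN s (- l * t + l * s).
  rewrite (_ : x - l * t + l * s = x + (- l * t + l * s)); last by ring.
  apply: cvg_trans; apply: near_eq_cvg; apply: nearW => n.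
  by congr (Nl _ (U _ _)); ring.
Qed.

(** In the frame of speed [- l] the flux of [U] is [V + l U], exactly the combination that
    [kinetic l] represents. *)
Lemma frame_conservation (l T : R) : l ^+ 2 = c ^+ 2 -> 0 <= T -> forall a b, a <= b ->
  J a b (fun x => U T (x - l * T)) - J a b (U 0) =
  J 0 T (fun t => kinetic l t (a - l * t) - kinetic l t (b - l * t)).
Proof.
move=> lc T0 a b ab; have bK := lb2_kinetic l.
(* [conservation] asks for left continuity at all times, which [lcont_kinetic] provides for
   [0 <= t]. *)
pose Kp (t x : R) := kinetic l (Num.max t 0) x.
have bKp : lb2 Kp by apply: (lb2_lb2 bK (G := fun t _ => Num.max t 0) (H := fun _ x => x)); lbt.
have KpE (t : R) : 0 <= t -> Kp t = kinetic l t by move=> t0; apply/funext => x; rewrite /Kp max_l.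
have := @conservation R U Kp (- l) T bU bKp.
have lKp (t x : R) : lcont (Kp t) x by apply: lcont_kinetic; rewrite le_max lexx orbT.
move=> /(_ lKp T0) C.
rewrite [LHS](_ : _ = J a b (fun x => U T (x + - l * T)) - J a b (U 0)); last first.
  by congr (_ - _); apply: eq_J => x _; rewrite mulNr.
rewrite (C _ a b ab).
  by apply: eq_J => t /andP[t0 _]; rewrite (KpE t t0) !mulNr.
move=> M psi chi chi' Tt M0.
have [Cpsi Cchi _] := Tt.
have C1psi := C11c_C1c Cpsi.
rewrite (weak_balance bU bV C1psi _ T0 (cU _ Cpsi M0 T0)).
  have E := @flux_K_tst (- l) l M psi chi chi' T lc Tt M0 T0.
  rewrite [RHS](eq_J (g := fun t => J (- M) M (fun x => kinetic l t (x + - l * t) * chi x))).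
    rewrite -E; apply: eq_J => t _; apply: eq_J => x _; congr (_ * _); ring.
  by move=> t /andP[t0 _]; rewrite KpE.
move=> M1 al al' Cal _; exact: (W1 (- l) (C11c_C1c Cal) C1psi M0).
Qed.

(** In the frame at rest the flux is [V], which is the mean of [l U + V] over [l = c] and
    [l = - c]. *)
Lemma conservation_mean_flux (T : R) : 0 <= T -> forall a b, a <= b ->
  J a b (U T) - J a b (U 0) = J 0 T (fun t => mean_flux t a - mean_flux t b).
Proof.
move=> T0 a b ab; have bK1 := lb2_kinetic c; have bK2 := lb2_kinetic (- c).
pose Kp (t x : R) := mean_flux (Num.max t 0) x.
have bw : lb2 mean_flux by rewrite /mean_flux; lbt.
have bKp : lb2 Kp by apply: (lb2_lb2 bw (G := fun t _ => Num.max t 0) (H := fun _ x => x)); lbt.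
have KpE (t : R) : 0 <= t -> Kp t = mean_flux t by move=> t0; apply/funext => x; rewrite /Kp max_l.
have lKp (t x : R) : lcont (Kp t) x.
  have t0 : 0 <= Num.max t 0 by rewrite le_max lexx orbT.
  apply: lcont_seq => y Hy; apply: cvgM; first exact: cvg_cst.
  by apply: cvgD; apply: (lcont_cvg (lcont_kinetic _ _ t0)).
have := @conservation R U Kp 0 T bU bKp lKp T0.
move=> C.
rewrite [LHS](_ : _ = J a b (fun x => U T (x + 0 * T)) - J a b (U 0)); last first.
  by congr (_ - _); apply: eq_J => x _; rewrite mul0r addr0.
rewrite (C _ a b ab).
  by apply: eq_J => t /andP[t0 _]; rewrite (KpE t t0) !mul0r !addr0.
move=> M psi chi chi' Tt M0.
have [Cpsi Cchi _] := Tt.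
have C1psi := C11c_C1c Cpsi.
have bchi := C11_lb Cchi.1.
rewrite (weak_balance bU bV C1psi _ T0 (cU _ Cpsi M0 T0)).
  have E1 := @flux_K_tst 0 c M psi chi chi' T erefl Tt M0 T0.
  have E2 := @flux_K_tst 0 (- c) M psi chi chi' T (sqrrN c) Tt M0 T0.
  rewrite [RHS](eq_J (g := fun t => J (- M) M (fun x =>
    2^-1 * (kinetic c t (x + 0 * t) + kinetic (- c) t (x + 0 * t)) * chi x))); last first.
    by move=> t /andP[t0 _]; rewrite (KpE t t0).
  apply: (etrans _ (esym (J_mean 0 M T bK1 bK2 bchi))).
  apply: (etrans _ (congr1 ( *%R 2^-1) (f_equal2 +%R E1 E2))).
  apply: (etrans _ (@J_mean R (fun t x => c * U t x + V t x)
    (fun t x => - c * U t x + V t x) 0 M T chi _ _ bchi)); [|by lbt|by lbt].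
  by apply: eq_J => t _; apply: eq_J => x _; field.
move=> M1 al al' Cal _; exact: (W1 0 (C11c_C1c Cal) C1psi M0).
Qed.

End Relaxation.

(** * Monotonicity along characteristics and the size of the flux defect *)

Section Dissipation.
Variable R : realType.
Variables (c eps : R) (U : R -> R -> R).
Hypotheses (eps0 : 0 < eps) (c12 : 2^-1 < c) (bU : lb2 U).
Hypothesis Uni : forall t x y : R, x <= y -> U t y <= U t x.
Hypothesis U2 : forall t x : R, - 2^-1 <= U t x <= 2^-1.
Hypothesis lU : forall t x : R, lcont (U t) x.
Local Notation K := (kinetic eps U).
Hypothesis frame : forall l T : R, l ^+ 2 = c ^+ 2 -> 0 <= T -> forall a b, a <= b ->
  J a b (fun x => U T (x - l * T)) - J a b (U 0) =
  J 0 T (fun t => K l t (a - l * t) - K l t (b - l * t)).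

(** The subcharacteristic condition: [Nl l z - Nl l y = (z - y) (l + (y + z) / 2)], and
    [|y + z| / 2 <= 1/2 < c] gives the second factor the sign of [l]. *)
Lemma Nl_mono (y z : R) : - 2^-1 <= y -> y <= z -> z <= 2^-1 ->
  Nl c y <= Nl c z /\ Nl (- c) z <= Nl (- c) y.
Proof.
move=> y2 yz z2; rewrite /Nl; have c12' := c12.
have h1 : 0 <= (z - y) * (c + 2^-1 * (y + z)).
  apply: mulr_ge0; first by rewrite subr_ge0.
  by lra.
have h2 : 0 <= (z - y) * (c - 2^-1 * (y + z)).
  by rewrite mulr_ge0 ?subr_ge0//; lra.
by split; rewrite -subr_ge0; [move: h1|move: h2]; congr (0 <= _); ring.
Qed.

Lemma Nl_c (s x t y : R) : U s x <= U t y -> Nl c (U s x) <= Nl c (U t y).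
Proof.
by move=> h; have [? _] := Nl_mono (proj1 (andP (U2 s x))) h (proj2 (andP (U2 t y))).
Qed.

Lemma Nl_Nc (s x t y : R) : U s x <= U t y -> Nl (- c) (U t y) <= Nl (- c) (U s x).
Proof.
by move=> h; have [_ ?] := Nl_mono (proj1 (andP (U2 s x))) h (proj2 (andP (U2 t y))).
Qed.

(** [kinetic l] is a combination, with nonnegative weights, of the values of [Nl l U] along a line
    of slope [l]; the lines through [x] and [y] stay at the distance [y - x]. *)
Lemma K_le (l t x y : R) : (forall s z z' : R, z' - z = y - x -> Nl l (U s z) <= Nl l (U s z')) ->
  K l t x <= K l t y.
Proof.
move=> H; rewrite /kinetic ler_wpM2l ?expR_ge0// lerD//; first by apply: H; ring.
rewrite ler_wpM2l ?invr_ge0 ?(ltW eps0)//.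
apply: le_J; [by rewrite /Nl; lbt|by rewrite /Nl; lbt|] => s _.
by rewrite ler_wpM2l ?expR_ge0//; apply: H; ring.
Qed.

Lemma K_c_ni (t x y : R) : x <= y -> K c t y <= K c t x.
Proof. by move=> xy; apply: K_le => s z z1 E; apply: Nl_c; apply: Uni; lra. Qed.

Lemma K_Nc_nd (t x y : R) : x <= y -> K (- c) t x <= K (- c) t y.
Proof. by move=> xy; apply: K_le => s z z' E; apply: Nl_Nc; apply: Uni; lra. Qed.

Lemma lcont_shift (t k x : R) : lcont (fun x => U t (x + k)) x.
Proof.
move=> e e0; have [d d0 Hd] := lU t (x + k) e0; exists d => // y /andP[? ?].
by apply: Hd; apply/andP; split; lra.
Qed.

Lemma frame_between (l s t a b : R) : l ^+ 2 = c ^+ 2 -> 0 <= s -> s <= t -> a <= b ->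
  J a b (fun x => U t (x - l * t)) - J a b (fun x => U s (x - l * s)) =
  J s t (fun t => K l t (a - l * t) - K l t (b - l * t)).
Proof.
move=> lc s0 st ab; have t0 : 0 <= t by apply: le_trans st.
have bK := lb2_kinetic eps bU l.
have := frame lc t0 ab; rewrite (@J_cat _ 0 s t); [|by lbt|by rewrite s0].
by rewrite -(frame lc s0 ab) => E; lra.
Qed.

(** The flux [K c] of this frame is nonincreasing in space, so more enters every interval at its
    left end than leaves at its right end; left continuity turns the comparison of integrals into
    one of values. *)
Lemma sandwich_c (s t x : R) : 0 <= s -> s <= t -> U s (x - c * s) <= U t (x - c * t).
Proof.
move=> s0 st.
apply: (@lcont_le _ (fun x => U s (x - c * s)) (fun x => U t (x - c * t))).
- by lbt.
- by lbt.
- exact: lcont_shift.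
- exact: lcont_shift.
move=> a b ab; rewrite -subr_ge0 (frame_between erefl s0 st ab).
by apply: J_ge0 => u _; rewrite subr_ge0; apply: K_c_ni; rewrite lerD2r.
Qed.

Lemma sandwich_Nc (s t x : R) : 0 <= s -> s <= t -> U t (x + c * t) <= U s (x + c * s).
Proof.
move=> s0 st.
have E (z u : R) : z + c * u = z - - c * u by ring.
rewrite !E; apply: (@lcont_le _ (fun x => U t (x - - c * t)) (fun x => U s (x - - c * s))).
- by lbt.
- by lbt.
- exact: lcont_shift.
- exact: lcont_shift.
move=> a b ab; rewrite -subr_le0 (frame_between (sqrrN c) s0 st ab).
rewrite -oppr_ge0 -J_opp; last by have := lb2_kinetic eps bU (- c) => ?; lbt.
by apply: J_ge0 => u _; rewrite opprB subr_ge0; apply: K_Nc_nd; rewrite lerD2r.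
Qed.

(** The two monotonicities give [U s (x + c (t - s)) <= U t x <= U s (x - c (t - s))]. Passing from
    [c] to [- c] exchanges the two points and also reverses the monotonicity of [Nl], hence one
    statement for both values of [l]. *)
Lemma Nl_lower (l s t x : R) : (l = c) \/ (l = - c) -> 0 <= s -> s <= t ->
  Nl l (U t x) <= Nl l (U s (x - l * t + l * s)) /\
  Nl l (U s (x + l * (t - s))) <= Nl l (U t x).
Proof.
move=> + s0 st; have h1 := sandwich_c (x + c * t) s0 st; have h2 := sandwich_Nc (x - c * t) s0 st.
rewrite addrK in h1; rewrite subrK in h2.
have E1 : x + c * t - c * s = x + c * (t - s) by ring.
have E2 : x + - c * (t - s) = x - c * t + c * s by ring.
have E3 : x - - c * t + - c * s = x + c * t - c * s by ring.
case=> ->; rewrite ?E2 ?E3; split.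
- exact: Nl_c.
- by rewrite -E1; exact: Nl_c.
- exact: Nl_Nc.
- exact: Nl_Nc.
Qed.

Lemma J_exp (t : R) : 0 <= t -> J 0 t (fun s => expR (s / eps)) = eps * (expR (t / eps) - 1).
Proof.
rewrite le_eqVlt => /orP[/eqP <-|t0]; first by rewrite J_xx mul0r expR0 subrr mulr0.
have E : eps != 0 by rewrite gt_eqF.
have D (x : R) : is_derive x 1 (fun s : R => eps * expR (s / eps)) (expR (x / eps)).
  rewrite [X in is_derive _ _ _ X](_ : _ = eps *: (expR (x / eps) / eps)); last first.
    by rewrite /GRing.scale/=; field.
  apply: is_deriveZ.
  apply: (@is_derive1_comp _ (@expR R) (fun t => t / eps)).
  rewrite (_ : (fun t => t / eps) = eps^-1 \*: id); last first.
    by apply/funext => z; rewrite /= mulrC.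
  rewrite -[X in is_derive _ _ _ X]mulr1.
  exact: is_deriveZ.
have C : continuous (fun s : R => expR (s / eps)).
  move=> x; apply: continuous_comp; last exact: continuous_expR.
  by apply: cvgM; [exact: cvg_id|exact: cvg_cst].
by rewrite (J_ftc t0 D C) mul0r expR0; ring.
Qed.

Lemma J_exp_lin (t : R) : 0 <= t -> J 0 t (fun s => expR (s / eps) * (t - s)) =
  eps ^+ 2 * (expR (t / eps) - 1) - eps * t.
Proof.
rewrite le_eqVlt => /orP[/eqP <-|t0].
  by rewrite J_xx mul0r expR0 subrr !mulr0 subrr.
have E : eps != 0 by rewrite gt_eqF.
have D (x : R) : is_derive x 1 (fun s : R => expR (s / eps) * (eps * (t - s) + eps ^+ 2))
    (expR (x / eps) * (t - x)).
  rewrite [X in is_derive _ _ _ X](_ : _ = expR (x / eps) *: (eps *: (0 - 1) + 0) +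
    (eps * (t - x) + eps ^+ 2) *: (expR (x / eps) / eps)); last first.
    by rewrite /GRing.scale/=; field.
  apply: is_deriveM.
    apply: (@is_derive1_comp _ (@expR R) (fun t => t / eps)).
    rewrite (_ : (fun t => t / eps) = eps^-1 \*: id); last first.
      by apply/funext => z; rewrite /= mulrC.
    rewrite -[X in is_derive _ _ _ X]mulr1.
    exact: is_deriveZ.
have C : continuous (fun s : R => expR (s / eps) * (t - s)).
  move=> x; apply: cvgM.
    apply: continuous_comp; last exact: continuous_expR.
    by apply: cvgM; [exact: cvg_id|exact: cvg_cst].
  by apply: cvgB; [exact: cvg_cst|exact: cvg_id].
by rewrite (J_ftc t0 D C) mul0r expR0; ring.
Qed.

Lemma K_ge (l t x : R) : (l = c) \/ (l = - c) -> 0 <= t -> Nl l (U t x) <= K l t x.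
Proof.
move=> lc t0; rewrite /kinetic.
have E : eps != 0 by rewrite gt_eqF.
set n := Nl l (U t x).
(* The weights in [kinetic] have total mass 1, so a constant is its own average and the comparison
   can be made under the integral sign. *)
have -> : n = expR (- t / eps) * (n + eps^-1 * J 0 t (fun s => expR (s / eps) * n)).
  rewrite J_mulr; last by lbt.
  rewrite (J_exp t0) mulrA mulrA mulVf// mul1r mulrBl mul1r addrC subrK mulrA.
  by rewrite -expRD mulNr addNr expR0 mul1r.
rewrite ler_wpM2l ?expR_ge0// lerD//.
  by have := (Nl_lower x lc (lexx 0) t0).1; rewrite mulr0 addr0.
rewrite ler_wpM2l ?invr_ge0 ?(ltW eps0)//.
apply: le_J; [by lbt|by rewrite /Nl; lbt|] => s /andP[s0 st].
by rewrite ler_wpM2l ?expR_ge0//; exact: (Nl_lower x lc s0 st).1.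
Qed.

Lemma mean_flux_ge (t x : R) : 0 <= t -> 2^-1 * U t x ^+ 2 <= mean_flux c eps U t x.
Proof.
move=> t0; have h1 := K_ge x (or_introl erefl) t0; have h2 := K_ge x (or_intror erefl) t0.
rewrite /mean_flux; move: h1 h2; rewrite /Nl; move: (U t x) (K c t x) (K (- c) t x) => u k1 k2 h1 h2.
lra.
Qed.

(** By [Nl_lower] the excess contributed by time [s] is at most [d s x], a difference of values of
    [Nl l (U s)] at distance [2 c (t - s)]. By [J_shift_le] its integral is at most [2 c^2 (t - s)],
    and the exponential average of [t - s] is [eps (1 - exp (- t / eps))]. *)
Lemma K_excess (l t L : R) : (l = c) \/ (l = - c) -> 0 <= t -> 0 <= L ->
  J (- L) L (fun x => K l t x - Nl l (U t x)) <= 2 * c ^+ 2 * eps.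
Proof.
move=> lc t0 L0.
have E : eps != 0 by rewrite gt_eqF.
have c0 : 0 < c by apply: lt_trans c12; rewrite invr_gt0.
pose d s x := Nl l (U s (x - l * (t - s))) - Nl l (U s (x + l * (t - s))).
have bd : lb2 d by rewrite /d /Nl; lbt.
have bK := lb2_kinetic eps bU l.
have bP : lb (fun x => J 0 t (fun s => expR (s / eps) * d s x)).
  by apply: (@lb_J2 _ 0 t (fun s x => expR (s / eps) * d s x)); lbt.
have le1 x : - L <= x <= L -> K l t x - Nl l (U t x) <=
    expR (- t / eps) * (d 0 x + eps^-1 * J 0 t (fun s => expR (s / eps) * d s x)).
  move=> _.
  set n := Nl l (U t x).
  have En : n = expR (- t / eps) * (n + eps^-1 * J 0 t (fun s => expR (s / eps) * n)).
    rewrite J_mulr; last by lbt.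
    rewrite (J_exp t0) mulrA mulrA mulVf// mul1r mulrBl mul1r addrC subrK mulrA.
    by rewrite -expRD mulNr addNr expR0 mul1r.
  rewrite {1}En /kinetic -mulrBr ler_wpM2l ?expR_ge0//.
  rewrite opprD addrACA -mulrBr -J_sub; [|by rewrite /Nl; lbt|by lbt].
  have dE s : 0 <= s -> s <= t -> Nl l (U s (x - l * t + l * s)) - n <= d s x.
    move=> s0 st; rewrite /d (_ : x - l * t + l * s = x - l * (t - s)); last by ring.
    by rewrite lerD2l lerN2; exact: (Nl_lower x lc s0 st).2.
  apply: lerD.
    by have := dE 0 (lexx 0) t0; rewrite mulr0 addr0.
  rewrite ler_wpM2l ?invr_ge0 ?(ltW eps0)//.
  apply: le_J; [by rewrite /Nl; lbt|by lbt|] => s /andP[s0 st].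
  by rewrite -mulrBr ler_wpM2l ?expR_ge0//; exact: dE.
have LL : - L <= L by rewrite (le_trans _ L0)// oppr_le0.
have dJ s : s <= t -> J (- L) L (d s) <= 2 * (c * (t - s)) * c.
  move=> st; have ts0 : 0 <= t - s by rewrite subr_ge0.
  have nl : `|l| = c by case: lc => ->; rewrite ?normrN gtr0_norm.
  have bf : lb (fun x => Nl l (U s x)) by rewrite /Nl; lbt.
  (* The two bounds are the values of [Nl l] at the endpoints -1/2 and 1/2, so the oscillation is
     [c]. *)
  have rng x : 8^-1 - 2^-1 * c <= Nl l (U s x) <= 8^-1 + 2^-1 * c.
    have /andP[u1 u2] := U2 s x.
    have [a1 a2] := Nl_mono (lexx _) u1 u2; have [b1 b2] := Nl_mono u1 u2 (lexx _).
    case: lc => ->; move: a1 a2 b1 b2; rewrite /Nl => a1 a2 b1 b2; apply/andP; split; lra.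
  have := J_shift_le (l * (t - s)) bf LL rng.
  rewrite normrM nl (ger0_norm ts0) (_ : 8^-1 + 2^-1 * c - (8^-1 - 2^-1 * c) = c)//.
  by field.
apply: le_trans (le_J _ _ le1) _.
- by rewrite /Nl; lbt.
- by lbt.
rewrite J_mull; last by lbt.
rewrite J_add; [|by lbt|by lbt]; rewrite J_mull//.
rewrite -(@J_swap _ 0 t (- L) L (fun s x => expR (s / eps) * d s x)); last by lbt.
apply: (@le_trans _ _ (expR (- t / eps) * (2 * c ^+ 2 * t + eps^-1 *
    J 0 t (fun s => 2 * c ^+ 2 * (expR (s / eps) * (t - s)))))).
  rewrite ler_wpM2l ?expR_ge0//; apply: lerD.
    by have := dJ 0 t0; rewrite subr0 => /le_trans; apply; rewrite le_eqVlt; apply/orP; left; apply/eqP; ring.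
  rewrite ler_wpM2l ?invr_ge0 ?(ltW eps0)//.
  apply: le_J; [|by lbt|].
    by apply: (@lb_J _ _ _ (fun s x => expR (s / eps) * d s x)); lbt.
  move=> s /andP[s0 st]; rewrite J_mull; last by lbt.
  rewrite mulrCA ler_wpM2l ?expR_ge0//; apply: le_trans (dJ s st) _.
  by rewrite le_eqVlt; apply/orP; left; apply/eqP; ring.
rewrite J_mull; last by lbt.
rewrite (J_exp_lin t0).
have Em : expR (- t / eps) * expR (t / eps) = 1 by rewrite -expRD mulNr addNr expR0.
rewrite (_ : _ * (_ + _) = 2 * c ^+ 2 * eps * (expR (- t / eps) * expR (t / eps)) -
  2 * c ^+ 2 * eps * expR (- t / eps)); last by field.
rewrite Em mulr1 gerBl; apply: mulr_ge0; last exact: expR_ge0.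
by apply: mulr_ge0; [rewrite mulr_ge0 ?sqr_ge0|exact: ltW].
Qed.

Lemma mean_flux_excess (t L : R) : 0 <= t -> 0 <= L ->
  J (- L) L (fun x => mean_flux c eps U t x - 2^-1 * U t x ^+ 2) <= 2 * c ^+ 2 * eps.
Proof.
move=> t0 L0; have bK1 := lb2_kinetic eps bU c; have bK2 := lb2_kinetic eps bU (- c).
have h1 := K_excess (or_introl erefl) t0 L0; have h2 := K_excess (or_intror erefl) t0 L0.
rewrite (eq_J (g := fun x => 2^-1 * ((K c t x - Nl c (U t x)) +
  (K (- c) t x - Nl (- c) (U t x))))); last by move=> x _; rewrite /mean_flux /Nl; field.
have b1 : lb (fun x => K c t x - Nl c (U t x)) by rewrite /Nl; lbt.
have b2 : lb (fun x => K (- c) t x - Nl (- c) (U t x)) by rewrite /Nl; lbt.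
rewrite J_mull; last by lbt.
rewrite J_add//.
move: h1 h2; move: (J _ _ _) (J _ _ _) => j1 j2 h1 h2; lra.
Qed.

End Dissipation.

(** * Stability in L1 *)

Section Huber.
Variable R : realType.

Definition clamp (y : R) : R := Num.max (- 1) (Num.min 1 y).

Lemma clamp_cases (y : R) :
  [\/ y <= - 1 /\ clamp y = - 1, (- 1 <= y /\ y <= 1) /\ clamp y = y | 1 <= y /\ clamp y = 1].
Proof.
rewrite /clamp; case: (leP 1 y) => y1.
  by apply: Or33; split=> //; case: (leP (- 1) (1 : R)) => // ?; lra.
case: (leP (- 1) y) => y2; last by apply: Or31; split=> //; exact: ltW.
by apply: Or32; split; [split; [|exact: ltW]|].
Qed.

Lemma clamp_itv (y : R) : - 1 <= clamp y <= 1.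
Proof. by case: (clamp_cases y) => -[h ->]; apply/andP; split; lra. Qed.

Lemma clamp_lip (y z : R) : `|clamp y - clamp z| <= `|y - z|.
Proof.
have [h1 h2] : y - z <= `|y - z| /\ z - y <= `|y - z|.
  by split; [exact: ler_norm|rewrite distrC; exact: ler_norm].
rewrite ler_norml; move: (`|y - z|) h1 h2 => n h1 h2.
by case: (clamp_cases y) => -[h3 ->]; case: (clamp_cases z) => -[h4 ->]; apply/andP; split; lra.
Qed.

(** The maximum of [s y - s^2 / 2] over [[-1, 1]] is attained at [clamp y]. Each bound on [hub]
    below is one choice of [s]: another slope for the tangent inequality, 1 or -1 for the comparison
    with the absolute value. *)
Lemma clamp_opt (y s : R) : - 1 <= s <= 1 ->
  s * y - s ^+ 2 / 2 <= clamp y * y - clamp y ^+ 2 / 2.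
Proof.
move=> /andP[s1 s2]; rewrite -subr_ge0.
case: (clamp_cases y) => -[h ->].
- rewrite (_ : _ - _ = (1 + s) * ((s - 1) / 2 - y)); last by field.
  by apply: mulr_ge0; lra.
- rewrite (_ : _ - _ = (y - s) ^+ 2 / 2); last by field.
  by rewrite divr_ge0 ?sqr_ge0.
- rewrite (_ : _ - _ = (1 - s) * (y - (1 + s) / 2)); last by field.
  by apply: mulr_ge0; lra.
Qed.

Lemma clamp0 : clamp 0 = 0.
Proof. by case: (clamp_cases 0) => -[h ->]//; lra. Qed.

(* The Huber function in Legendre form: [hub dl] is convex and C^1, its derivative at y is
   [clamp (y / dl)], and it tends to the absolute value as dl tends to 0. *)
Definition hub (dl y : R) : R := clamp (y / dl) * y - dl * (clamp (y / dl) ^+ 2 / 2).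

Lemma hub_tangent (dl p q : R) : 0 < dl -> hub dl p - hub dl q <= clamp (p / dl) * (p - q).
Proof.
move=> dl0; have := clamp_opt (q / dl) (clamp_itv (p / dl)).
rewrite -(ler_pM2l dl0) /hub; set a := clamp (p / dl); set b := clamp (q / dl).
rewrite (_ : dl * (a * _ - _) = a * q - dl * (a ^+ 2 / 2)); last by field; rewrite gt_eqF.
rewrite (_ : dl * (b * _ - _) = b * q - dl * (b ^+ 2 / 2)); last by field; rewrite gt_eqF.
by move=> ?; rewrite mulrBr; lra.
Qed.

Lemma hub0 (dl : R) : 0 < dl -> hub dl 0 = 0.
Proof.
move=> dl0; rewrite /hub mul0r mulr0 sub0r.
rewrite clamp0.
by rewrite expr0n/= mul0r mulr0 oppr0.
Qed.

Lemma hub_ge0 (dl y : R) : 0 < dl -> 0 <= hub dl y.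
Proof.
move=> dl0; have := hub_tangent 0 y dl0; rewrite hub0// mul0r.
rewrite clamp0.
by rewrite mul0r sub0r oppr_le0.
Qed.

Lemma hub_lip (dl p q : R) : 0 < dl -> `|hub dl p - hub dl q| <= `|p - q|.
Proof.
move=> dl0.
have H (x y : R) : hub dl x - hub dl y <= `|x - y|.
  apply: (le_trans (hub_tangent x y dl0)); apply: (le_trans (ler_norm _)).
  by rewrite normrM ler_piMl// ler_norml clamp_itv.
rewrite ler_norml; have h1 := H p q; have h2 := H q p; rewrite distrC in h2.
by apply/andP; split; lra.
Qed.

Lemma hub_ge (dl y : R) : 0 < dl -> `|y| - dl / 2 <= hub dl y.
Proof.
move=> dl0.
have H (s : R) : - 1 <= s <= 1 -> s * y - dl * (s ^+ 2 / 2) <= hub dl y.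
  move=> hs; have := clamp_opt (y / dl) hs; rewrite -(ler_pM2l dl0) /hub.
  set a := clamp _.
  rewrite (_ : dl * (s * _ - _) = s * y - dl * (s ^+ 2 / 2)); last by field; rewrite gt_eqF.
  by rewrite (_ : dl * (a * _ - _) = a * y - dl * (a ^+ 2 / 2))//; field; rewrite gt_eqF.
have h1 := H 1; have h2 := H (- 1); rewrite sqrrN in h2.
have [y0|y0] := leP 0 y.
  rewrite ger0_norm//; apply: le_trans (h1 _); last by apply/andP; split; lra.
  by rewrite expr1n; lra.
rewrite ltr0_norm//; apply: le_trans (h2 _); last by apply/andP; split; lra.
by rewrite expr1n; lra.
Qed.

Lemma lb_clamp : lb clamp.
Proof. exact: (lb2_lb (@lb2_max R) (lb_cst (- 1)) (lb2_l 1 (@lb2_min R))). Qed.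

Lemma lb_hub dl : lb (hub dl).
Proof. by have ? := lb_clamp; rewrite /hub; lbt. Qed.

(* Here f = D', so that the integrand is (hub dl (D))' m, where m is nonincreasing. *)
Lemma transport_ibp (dl al be B : R) (f D m : R -> R) : 0 < dl -> al <= be -> lb f -> lb D -> lb m ->
  (forall x y, x <= y -> m y <= m x) -> (forall x, - 2^-1 <= m x <= 2^-1) ->
  (forall x, `|f x| <= B) ->
  (forall x y, x <= y -> D y - D x = J x y f) ->
  - (2^-1 * (hub dl (D al) + hub dl (D be))) <=
  J al be (fun x => clamp (D x / dl) * f x * m x).
Proof.
move=> dl0 ab bf bD bm mni m2 fB DE.
have bc := lb_clamp; have bh := lb_hub dl.
have B0 : 0 <= B := le_trans (normr_ge0 _) (fB 0).
pose E x := hub dl (D x); pose g x := clamp (D x / dl) * f x * m x.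
pose e x := clamp (D x / dl) * f x.
have bE : lb E by rewrite /E; lbt.
have be' : lb e by rewrite /e; lbt.
have bg : lb g by rewrite /g; lbt.
have E0 x : 0 <= E x by exact: hub_ge0.
pose C := B + B ^+ 2 / dl.
have C0 : 0 <= C by rewrite addr_ge0// divr_ge0 ?sqr_ge0// ltW.
have Dxy (x y : R) : x <= y -> `|D y - D x| <= B * (y - x).
  by move=> xy; rewrite (DE _ _ xy); apply: (J_le_norm bf xy) => z _; exact: fB.
have eB x : `|e x| <= B.
  rewrite /e normrM -[leRHS]mul1r ler_pM//.
  by rewrite ler_norml clamp_itv.
have cl (x y z : R) : x <= y -> y <= z -> `|clamp (D y / dl) - clamp (D x / dl)| <= B / dl * (z - x).
  move=> xy yz; apply: (le_trans (clamp_lip _ _)).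
  rewrite -mulrBl normrM (ger0_norm (_ : 0 <= dl^-1)) ?invr_ge0 ?(ltW dl0)//.
  rewrite mulrAC ler_wpM2r ?invr_ge0 ?(ltW dl0)//.
  by apply: (le_trans (Dxy _ _ xy)); rewrite ler_wpM2l// lerD2r.
have Exy (x y : R) : x <= y -> `|E y - E x - J x y e| <= B ^+ 2 / dl * (y - x) * (y - x).
  move=> xy.
  have up : E y - E x - J x y e <= B ^+ 2 / dl * (y - x) * (y - x).
    have h := hub_tangent (D y) (D x) dl0; rewrite DE// in h.
    apply: (@le_trans _ _ (clamp (D y / dl) * J x y f - J x y e)); first by rewrite lerD2r.
    rewrite -J_mull// -J_sub//; last by lbt.
    apply: J_le_cst; [by lbt|by []|] => z /andP[xz zy].
    rewrite /e -mulrBl; apply: (le_trans (ler_norm _)); rewrite normrM.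
    rewrite (_ : B ^+ 2 / dl * (y - x) = B / dl * (y - x) * B); last by ring.
    apply: ler_pM => //; apply: (le_trans (cl _ _ _ zy (lexx y))).
    by rewrite ler_wpM2l ?divr_ge0 ?(ltW dl0)// lerD2l lerN2.
  have lo : - (B ^+ 2 / dl * (y - x) * (y - x)) <= E y - E x - J x y e.
    have h := hub_tangent (D x) (D y) dl0.
    have DxDy : D x - D y = - J x y f by rewrite -DE// opprB.
    rewrite DxDy mulrN in h.
    rewrite -[leLHS]mulNr.
    apply: (@le_trans _ _ (clamp (D x / dl) * J x y f - J x y e)); last first.
      by rewrite lerD2r -lerN2 opprB.
    rewrite -J_mull// -J_sub//; last by lbt.
    apply: J_ge_cst; [by lbt|by []|] => z /andP[xz zy].
    rewrite /e -mulrBl lerNl; apply: (le_trans (ler_norm _)); rewrite normrN normrM.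
    rewrite (_ : B ^+ 2 / dl * (y - x) = B / dl * (y - x) * B); last by ring.
    by rewrite distrC; apply: ler_pM => //; exact: cl.
  by rewrite ler_norml lo.
(* Integration by parts with an [m] that may jump. The monotone function [x - m x] pays for both
   errors: [(y - x)^2] from linearizing [E], and [(y - x) (m x - m y)] from freezing [m]. The term
   [(m x - m y) * E x] has the favourable sign since [E >= 0]. *)
have P : m be * E be - J al be g <= m al * E al - J al al g.
  apply: (@partition_le _ (fun x => m x * E x - J al x g) (fun x => x - m x) C al be ab C0).
    by move=> x y _ xy _; rewrite lerB// mni.
  move=> x y ax xy yb.
  rewrite (@J_cat _ al x y)//; last by rewrite ax.
  have mxy := mni x y xy.
  have my : `|m y| <= 1.
    have /andP[h1 h2] := m2 y; rewrite ler_norml; apply/andP; split; clear -h1 h2; lra.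
  rewrite (_ : _ - _ = m y * (E y - E x - J x y e) + J x y (fun z => (m y - m z) * e z)
    - (m x - m y) * E x); last first.
    have -> : J x y (fun z => (m y - m z) * e z) = m y * J x y e - J x y g.
      rewrite -J_mull// -J_sub//; last by lbt.
      by apply: eq_J => z _; rewrite /g /e; ring.
    by ring.
  have h1 : m y * (E y - E x - J x y e) <= B ^+ 2 / dl * (y - x) * (y - x).
    apply: (le_trans (ler_norm _)); rewrite normrM -[leRHS]mul1r.
    by apply: ler_pM => //; exact: Exy.
  have h2 : J x y (fun z => (m y - m z) * e z) <= (m x - m y) * B * (y - x).
    apply: J_le_cst; [by lbt|by []|] => z /andP[xz zy].
    apply: (le_trans (ler_norm _)); rewrite normrM; apply: ler_pM => //.
    rewrite distrC ger0_norm ?subr_ge0 ?mni//.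
    by rewrite lerD2r mni.
  have h3 : 0 <= (m x - m y) * E x by rewrite mulr_ge0// subr_ge0.
  have yx0 : 0 <= y - x by rewrite subr_ge0.
  have mm0 : 0 <= m x - m y by rewrite subr_ge0.
  have D0 : 0 <= B ^+ 2 / dl by rewrite divr_ge0 ?sqr_ge0// ltW.
  have k1 : 0 <= B * ((y - x) * (y - x)) by do 2 (apply: mulr_ge0 => //).
  have k2 : 0 <= B ^+ 2 / dl * ((y - x) * (m x - m y)) by do 2 (apply: mulr_ge0 => //).
  rewrite /C; clear -h1 h2 h3 k1 k2.
  move: h1 h2 h3 k1 k2; move: (J x y _) (B ^+ 2 / dl) (m y * _) ((m x - m y) * E x).
  move=> j1 q j2 j3 h1 h2 h3 k1 k2.
  apply: (@le_trans _ _ (q * (y - x) * (y - x) + (m x - m y) * B * (y - x))).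
    by lra.
  rewrite -subr_ge0; apply: (le_trans (addr_ge0 k1 k2)).
  by rewrite le_eqVlt; apply/orP; left; apply/eqP; ring.
rewrite J_xx subr0 in P.
have /andP[a1 a2] := m2 al; have /andP[b1 b2] := m2 be.
have p1 : 0 <= (m al + 2^-1) * E al by rewrite mulr_ge0//; clear -a1; lra.
have p2 : 0 <= (m be + 2^-1) * E be by rewrite mulr_ge0//; clear -b1; lra.
have p3 : 0 <= (2^-1 - m al) * E al by rewrite mulr_ge0//; clear -a2; lra.
rewrite -/(E al) -/(E be) -/g; clear -P p1 p2 p3.
move: (J al be g) (E al) (E be) (m al) (m be) P p1 p2 p3 => j x y m1 m2 P p1 p2 p3.
by lra.
Qed.

End Huber.

Section Arithmetic.
Variable R : realType.

(** This lemma and the next ones are the linear steps of the stability estimate, stated over plain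
    variables so that [lra] meets only the relevant inequalities. *)
Lemma slice_arith (B ts a j1 j2 j3 k0 e1 e2 e3 e4 : R) :
  j1 <= j2 + a * ts -> j2 <= j3 + 2^-1 * (e2 + e1) -> j3 <= k0 ->
  e1 <= e3 + B * ts -> e2 <= e4 + B * ts ->
  j1 <= k0 + (2^-1 * (e4 + e3) + (a + B) * ts).
Proof. by lra. Qed.

Lemma step_arith (ts e1 e2 c1 j1 j2 j3 j4 j5 : R) :
  j1 - j2 <= j5 + ts * (2^-1 * (e2 + e1)) + c1 * ts ^+ 2 ->
  2^-1 * ts * e2 - (2^-1 * ts) ^+ 2 <= j3 -> 2^-1 * ts * e1 - (2^-1 * ts) ^+ 2 <= j4 ->
  j1 - (j3 + j2 + j4) <= j5 + (c1 + 2^-1) * ts ^+ 2.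
Proof. by move=> h1 h2 h3; lra. Qed.

Lemma sum_arith (s t j1 j2 j3 j4 a c : R) :
  c * (t - s) ^+ 2 <= a * (t - s) ^+ 2 -> j1 - j2 <= j4 + (c + 2^-1) * (t - s) ^+ 2 ->
  j1 - (j3 + j4) - (j2 - j3) <= (a + 2^-1) * (t - s) * (t - s).
Proof. by move=> h1 h2; lra. Qed.

Lemma diff_arith (x y z t : R) : x - y <= z - t -> z = 0 -> t = 0 -> x <= y.
Proof. by move=> h z0 t0; lra. Qed.

Lemma sum2_arith (x y z e : R) : x <= y -> z - x <= e -> z <= y + e.
Proof. by move=> h1 h2; lra. Qed.

Lemma gap_arith (h a a' b b' ja jb D1 D2 n : R) :
  D1 - D2 = ja - jb -> ja <= a * h -> a' * h <= ja -> jb <= b * h -> b' * h <= jb ->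
  D1 - D2 <= n -> - (D1 - D2) <= n -> 0 <= (b - b') * h -> 0 <= (a - a') * h ->
  `|h * (a - b)| <= n + h * (b - b' + (a - a')).
Proof. by move=> *; rewrite ler_norml; apply/andP; split; lra. Qed.

End Arithmetic.

(** * Stability of the entropy solution under a perturbation of the flux *)

Section Stability.
Variable R : realType.
Variables (ka : R) (U u w : R -> R -> R).
Hypotheses (bU : lb2 U) (bu : lb2 u) (bw : lb2 w).
Hypothesis Uni : forall t x y : R, x <= y -> U t y <= U t x.
Hypothesis uni : forall t x y : R, x <= y -> u t y <= u t x.
Hypothesis U2 : forall t x : R, - 2^-1 <= U t x <= 2^-1.
Hypothesis u2 : forall t x : R, - 2^-1 <= u t x <= 2^-1.
Hypothesis Uu0 : U 0 = u 0.
Hypothesis consU : forall T : R, 0 <= T -> forall a b, a <= b ->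
  J a b (U T) - J a b (U 0) = J 0 T (fun t => w t a - w t b).
Hypothesis consu : forall T : R, 0 <= T -> forall a b, a <= b ->
  J a b (u T) - J a b (u 0) = J 0 T (fun t => 2^-1 * u t a ^+ 2 - 2^-1 * u t b ^+ 2).
Hypothesis w_ge : forall t x : R, 0 <= t -> 2^-1 * U t x ^+ 2 <= w t x.
Hypothesis w_ex : forall t L : R, 0 <= t -> 0 <= L ->
  J (- L) L (fun x => w t x - 2^-1 * U t x ^+ 2) <= ka.

Definition flux_gap (t x : R) : R := w t x - 2^-1 * u t x ^+ 2.
Definition potential_gap (t x : R) : R := J 0 t (fun s => flux_gap s x).
Local Notation d := flux_gap.
Local Notation D := potential_gap.

Lemma lb2_flux_gap : lb2 d. Proof. by rewrite /flux_gap; lbt. Qed.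

Lemma lb2_potential_gap : lb2 D.
Proof. exact: (lb2_primitive lb2_flux_gap). Qed.

Lemma potential_gap_x (t x y : R) : 0 <= t -> x <= y ->
  D t y - D t x = J x y (fun z => u t z - U t z).
Proof.
move=> t0 xy; have bd := lb2_flux_gap.
rewrite /D -J_sub; [|by lbt..].
have E1 := consU t0 xy; have E2 := consu t0 xy; rewrite Uu0 in E1.
rewrite [in RHS]J_sub; [|by lbt..].
have -> : J x y (u t) - J x y (U t) =
  J 0 t (fun s => 2^-1 * u s x ^+ 2 - 2^-1 * u s y ^+ 2) - J 0 t (fun s => w s x - w s y).
  by rewrite -E1 -E2; ring.
rewrite -J_sub; [|by lbt..].
by apply: eq_J => s _; rewrite /flux_gap; ring.
Qed.

Lemma uU_le1 (t x : R) : `|u t x - U t x| <= 1.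
Proof.
have /andP[h1 h2] := U2 t x; have /andP[h3 h4] := u2 t x.
by rewrite ler_norml; apply/andP; split; lra.
Qed.

Lemma potential_gap_lip (t x y : R) : 0 <= t -> x <= y -> `|D t y - D t x| <= y - x.
Proof.
move=> t0 xy; rewrite (potential_gap_x t0 xy) -[leRHS]mul1r.
by apply: J_le_norm => //; [by lbt|move=> z _; exact: uU_le1].
Qed.

(** The left side is formally the time derivative of the integral of [hub dl (D t x)]. The source
    enters with a factor at most 1, and transport by a nonincreasing velocity adds nothing but
    boundary terms. *)
Lemma slice (dl t al be : R) : 0 < dl -> 0 <= t -> al <= be ->
  J al be (fun x => clamp (D t x / dl) * d t x) <=
  J al be (fun x => w t x - 2^-1 * U t x ^+ 2) +
  2^-1 * (hub dl (D t al) + hub dl (D t be)).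
Proof.
move=> dl0 t0 ab.
have bd := lb2_flux_gap; have bD := lb2_potential_gap; have bc := lb_clamp R.
pose f x := u t x - U t x.
(* [d = (w - U^2 / 2) - m (u - U)]: D is transported with the nonincreasing velocity m. *)
pose m x := 2^-1 * (u t x + U t x).
have bf : lb f by rewrite /f; lbt.
have bm : lb m by rewrite /m; lbt.
have mni (x y : R) : x <= y -> m y <= m x.
  by move=> xy; rewrite /m ler_wpM2l// lerD// ?uni ?Uni.
have m2 (x : R) : - 2^-1 <= m x <= 2^-1.
  have /andP[h1 h2] := U2 t x; have /andP[h3 h4] := u2 t x.
  by rewrite /m; apply/andP; split; lra.
have := @transport_ibp R dl al be 1 f (D t) m dl0 ab bf (lb2_l t bD) bm mni m2 (uU_le1 t)
  (fun x y => potential_gap_x t0).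
set I := J al be _; set H := 2^-1 * _ => ibp.
have -> : J al be (fun x => clamp (D t x / dl) * d t x) =
  J al be (fun x => clamp (D t x / dl) * (w t x - 2^-1 * U t x ^+ 2)) - I.
  rewrite /I -J_sub; [|by lbt..].
  by apply: eq_J => x _; rewrite /flux_gap /f /m; field.
apply: lerD; last by rewrite lerNl.
apply: le_J; [by lbt|by lbt|] => x _.
rewrite -[leRHS]mul1r ler_wpM2r//; first by rewrite subr_ge0 w_ge.
by have /andP[] := clamp_itv (D t x / dl).
Qed.

Lemma J_hub_gap (dl T L : R) : 0 < dl -> 0 <= T -> 0 <= L ->
  J (- L) L (fun x => hub dl (D T x)) <= ka * T.
Proof.
move=> dl0 T0 L0.
have bd := lb2_flux_gap; have bD := lb2_potential_gap; have bc := lb_clamp R.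
have bh := lb_hub dl.
(* The cone opens backwards in time at speed 1/2, the bound on the transport velocity, which
   absorbs the boundary terms of [slice]. *)
pose beta t := L + 2^-1 * (T - t).
pose L' := L + T.
pose E t x := hub dl (D t x).
pose r t x := w t x - 2^-1 * U t x ^+ 2.
have br : lb2 r by rewrite /r; lbt.
pose k t := J (- L') L' (r t).
have bk : lb k by exact: lb_J.
have bE : lb2 E by rewrite /E; lbt.
have [B dB] := bd.2 (L' + T).
have L'0 : 0 <= L' by rewrite /L' addr_ge0.
have beL t : 0 <= t -> t <= T -> 0 <= beta t /\ beta t <= L'.
  by move=> t0 tT; rewrite /beta /L'; split; lra.
have dB' t x : 0 <= t -> t <= T -> - L' <= x -> x <= L' -> `|d t x| <= B.
  move=> t0 tT x1 x2; apply: dB; first by rewrite ger0_norm//; lra.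
  by rewrite ler_norml; apply/andP; split; lra.
have B0 : 0 <= B by apply: le_trans (dB' 0 0 _ _ _ _) => //; rewrite ?lexx ?oppr_le0.
have Dst s t x : 0 <= s -> s <= t -> t <= T -> - L' <= x -> x <= L' ->
    `|D t x - D s x| <= B * (t - s).
  move=> s0 st tT x1 x2; rewrite /D (@J_cat _ 0 s t); [|by lbt|by rewrite s0].
  rewrite addrAC subrr add0r; apply: J_le_norm; [by lbt|by []|] => z /andP[sz zt].
  by apply: dB' => //; [exact: le_trans s0 sz|exact: le_trans zt tT].
(* The first term pays for evaluating [clamp] at time [t] instead of the intermediate time, over an
   interval of length at most [2 L']; the second for moving the boundary values of [E] back to time
   [s]. *)
pose C1 := 2 * L' * (B / dl * B) + B.
have key s t : 0 <= s -> s <= t -> t <= T ->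
  J (- beta t) (beta t) (E t) - J (- beta s) (beta s) (E s) <=
  J s t k + (C1 + 2^-1) * (t - s) ^+ 2.
  move=> s0 st tT.
  have t0 : 0 <= t := le_trans s0 st.
  have sT : s <= T := le_trans st tT.
  have [b0 bL] := beL t t0 tT; have [b'0 b'L] := beL s s0 sT.
  have bb' : beta s - beta t = 2^-1 * (t - s) by rewrite /beta; ring.
  have ts0 : 0 <= t - s by rewrite subr_ge0.
  have bb : beta t <= beta s by rewrite -subr_ge0 bb' mulr_ge0.
  move: (beta t) (beta s) b0 bL b'0 b'L bb' bb => b b' b0 bL b'0 b'L bb' bb.
  have Nbb : - b <= b by rewrite (le_trans _ b0)// oppr_le0.
  have NbL : - L' <= - b by rewrite lerN2.
  have sB x : - b <= x <= b -> - L' <= x /\ x <= L'.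
    by move=> /andP[h1 h2]; split; [exact: le_trans NbL h1|exact: le_trans h2 bL].
  have Es x y : `|E s x - E s y| <= `|x - y|.
    have H (p q : R) : p <= q -> `|E s q - E s p| <= `|q - p|.
      move=> pq; apply: (le_trans (hub_lip _ _ dl0)).
      by rewrite (ger0_norm (_ : 0 <= q - p)) ?subr_ge0//; exact: potential_gap_lip.
    have [yx|/ltW xy] := leP y x; first exact: H.
    by rewrite distrC (distrC x); exact: H.
  (* From [s] to [t] the cone loses two strips of width [(t - s) / 2]. As [E s] is 1-Lipschitz, the
     integrals lost there match the boundary terms of [main] up to a quadratic error. *)
  have side_r : (b' - b) * E s b - (b' - b) ^+ 2 <= J b b' (E s).
    rewrite (_ : _ - _ = (E s b - (b' - b)) * (b' - b)); last by ring.
    apply: J_ge_cst; [by lbt|by []|] => x /andP[bx xb'].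
    have h1 : `|E s x - E s b| <= x - b.
      by apply: (le_trans (Es _ _)); rewrite ger0_norm ?subr_ge0.
    move: h1; rewrite ler_norml => /andP[h1 _]; lra.
  have side_l : (b' - b) * E s (- b) - (b' - b) ^+ 2 <= J (- b') (- b) (E s).
    rewrite (_ : _ - _ = (E s (- b) - (b' - b)) * (- b - - b')); last by ring.
    apply: J_ge_cst; [by lbt|by rewrite lerN2|] => x /andP[bx xb'].
    have h1 : `|E s (- b) - E s x| <= - b - x.
      by apply: (le_trans (Es _ _)); rewrite ger0_norm ?subr_ge0.
    move: h1; rewrite ler_norml => /andP[_ h1]; lra.
  have split_s : J (- b') b' (E s) = J (- b') (- b) (E s) + J (- b) b (E s) + J b b' (E s).
    rewrite (@J_cat _ (- b') (- b) b'); [|by lbt|by rewrite lerN2 bb (le_trans Nbb)].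
    by rewrite (@J_cat _ (- b) b b'); [rewrite addrA|by lbt|by rewrite Nbb].
  have main : J (- b) b (E t) - J (- b) b (E s) <=
      J s t k + (t - s) * (2^-1 * (E s (- b) + E s b)) + C1 * (t - s) ^+ 2.
    rewrite -J_sub; [|by lbt..].
    (* Convexity at the later time: [hub_tangent] bounds the increment by the slope at [D t x] times
       the increment of [D], which is the time integral of [d]. *)
    apply: (@le_trans _ _ (J s t (fun si => J (- b) b (fun x => clamp (D t x / dl) * d si x)))).
      rewrite J_swap; last by lbt.
      apply: le_J; [by lbt| |].
        by apply: (@lb_J2 _ _ _ (fun si x => clamp (D t x / dl) * d si x)); lbt.
      move=> x _; apply: (le_trans (hub_tangent _ _ dl0)).
      rewrite J_mull; last by lbt.
      by rewrite /D (@J_cat _ 0 s t); [rewrite addrAC subrr add0r|by lbt|by rewrite s0].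
    pose c0 := 2^-1 * (E s (- b) + E s b) + C1 * (t - s).
    rewrite (_ : _ + _ + _ = J s t (fun si => k si + c0)); last first.
      by rewrite J_add; [|by lbt|by lbt]; rewrite J_cst// /c0; ring.
    apply: le_J; [|by lbt|].
      by apply: (@lb_J _ _ _ (fun si x => clamp (D t x / dl) * d si x)); lbt.
    move=> si /andP[ssi sit].
    have si0 : 0 <= si := le_trans s0 ssi.
    have siT : si <= T := le_trans sit tT.
    have h1 : J (- b) b (fun x => clamp (D t x / dl) * d si x) <=
       J (- b) b (fun x => clamp (D si x / dl) * d si x) + 2 * L' * (B / dl * B) * (t - s).
      rewrite -lerBlDl -J_sub; [|by lbt..].
      have dlV : 0 <= dl^-1 by rewrite invr_ge0 ltW.
      apply: (@le_trans _ _ (B / dl * (t - s) * B * (b - - b))).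
        apply: J_le_cst; [by lbt|by []|] => x xb; have [x1 x2] := sB x xb.
        rewrite -mulrBl; apply: (le_trans (ler_norm _)); rewrite normrM; apply: ler_pM => //.
          apply: (le_trans (clamp_lip _ _)).
          rewrite -mulrBl normrM (ger0_norm dlV) mulrAC ler_wpM2r//.
          apply: (le_trans (Dst si t x si0 sit tT x1 x2)).
          by rewrite ler_wpM2l// lerD2l lerN2.
        exact: dB'.
      rewrite (_ : B / dl * (t - s) * B * (b - - b) = 2 * b * (B / dl * B) * (t - s)); last by ring.
      rewrite ler_wpM2r// ler_wpM2r//; first by rewrite mulr_ge0// mulr_ge0.
      by rewrite ler_wpM2l.
    have h2 := slice dl0 si0 Nbb.
    have h3 : J (- b) b (fun x => w si x - 2^-1 * U si x ^+ 2) <= k si.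
      rewrite /k.
      rewrite (@J_cat _ (- L') (- b) L'); [|by lbt|by rewrite NbL (le_trans Nbb)].
      rewrite (@J_cat _ (- b) b L'); [|by lbt|by rewrite Nbb].
      rewrite addrCA lerDl addr_ge0//; apply: J_ge0 => x _; rewrite subr_ge0; exact: w_ge.
    have h4 x : - b <= x <= b -> E si x <= E s x + B * (t - s).
      move=> xb; have [x1 x2] := sB x xb.
      rewrite -lerBlDl; apply: (le_trans (ler_norm _)).
      apply: (le_trans (hub_lip _ _ dl0)); apply: (le_trans (Dst s si x s0 ssi siT x1 x2)).
      by rewrite ler_wpM2l// lerD2r.
    have h5 := h4 b; have h6 := h4 (- b).
    rewrite Nbb lexx in h5; rewrite Nbb lexx in h6.
    have {}h5 := h5 isT; have {}h6 := h6 isT.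
    exact: (slice_arith h1 h2 h3 h5 h6).
  rewrite bb' in side_l side_r; rewrite split_s.
  exact: (step_arith main side_l side_r).
have bQ0 : J (- L) L (E T) - J 0 T k <= J (- beta 0) (beta 0) (E 0) - J 0 0 k.
  have bT : beta T = L by rewrite /beta subrr mulr0 addr0.
  rewrite -{1 2}bT.
  apply: (@partition_le _ (fun t => J (- beta t) (beta t) (E t) - J 0 t k) id (`|C1| + 2^-1) 0 T T0).
  - by rewrite addr_ge0.
  - by [].
  move=> s t s0 st tT; rewrite (@J_cat _ 0 s t)//; last by rewrite s0.
  have h : C1 * (t - s) ^+ 2 <= `|C1| * (t - s) ^+ 2 by rewrite ler_wpM2r ?sqr_ge0// ler_norm.
  exact: (sum_arith _ h (key s t s0 st tT)).
have E0 : J (- beta 0) (beta 0) (E 0) = 0.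
  apply: J_zero => x _; rewrite /E /potential_gap (J_xx 0 (fun s => d s x)).
  exact: hub0.
apply: (le_trans (diff_arith bQ0 E0 (J_xx 0 k))).
rewrite (_ : ka * T = ka * (T - 0)); last by rewrite subr0.
by apply: J_le_cst => // t /andP[t0 _]; exact: w_ex.
Qed.

Lemma J_potential_gap (T L : R) : 0 <= T -> 0 <= L -> J (- L) L (fun x => `|D T x|) <= ka * T.
Proof.
move=> T0 L0; have bD := lb2_potential_gap.
have NL : - L <= L by rewrite (le_trans _ L0)// oppr_le0.
apply/ler_addgt0Pl => e e0.
(* [hub dl] is at least the absolute value minus [dl / 2], so over [[- L, L]] the loss is at most
   [dl L <= e]. *)
have dl0 : 0 < e / (L + 1) by rewrite divr_gt0// ltr_wpDl.
have h0 := J_hub_gap dl0 T0 L0.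
have bh := lb_hub (e / (L + 1)).
have h : J (- L) L (fun x => `|D T x|) - J (- L) L (fun x => hub (e / (L + 1)) (D T x)) <= e.
  rewrite -J_sub; [|by lbt..].
  apply: (@le_trans _ _ (e / (L + 1) / 2 * (L - - L))).
    apply: J_le_cst; [by lbt|by []|] => x _.
    by have := hub_ge (D T x) dl0; move: (hub _ _) => q ?; lra.
  have L1 : 0 < L + 1 by rewrite ltr_wpDl.
  rewrite (_ : _ * _ = e * (L / (L + 1))); last by field; rewrite gt_eqF.
  by rewrite ler_piMr ?(ltW e0)// ler_pdivrMr// mul1r lerDl.
by rewrite addrC; exact: (sum2_arith h0 h).
Qed.

Lemma l1_gap (T L h : R) : 0 <= T -> 0 <= L -> 0 < h ->
  J (- L) L (fun x => `|u T x - U T x|) <= h^-1 * (2 * (ka * T)) + 2 * h.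
Proof.
move=> T0 L0 h0; have bD := lb2_potential_gap.
have NL : - L <= L by rewrite (le_trans _ L0)// oppr_le0.
have V0 : 0 <= h^-1 by rewrite invr_ge0 ltW.
have bu' : lb (u T) by lbt.
have bU' : lb (U T) by lbt.
(* The decrease of [f] over [[x, x + h]], centred so that [J_shift_le] applies with [p = h / 2]; as
   the values lie in [[-1/2, 1/2]] its integral is at most [h]. *)
pose g (f : R -> R) x := f (x + h / 2 - h / 2) - f (x + h / 2 + h / 2).
(* u and U being monotone, their gap at x is controlled by increments of D over [x, x + h]. *)
have pt x : - L <= x <= L -> `|u T x - U T x| <=
    h^-1 * (`|D T (x + h)| + `|D T x|) + (g (U T) x + g (u T) x).
  move=> _; rewrite /g (_ : x + h / 2 - h / 2 = x); last by ring.
  rewrite (_ : x + h / 2 + h / 2 = x + h); last by field.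
  have xh : x <= x + h by rewrite lerDl ltW.
  have E := potential_gap_x T0 xh.
  rewrite J_sub // in E.
  have hE : x + h - x = h by ring.
  have u1 : J x (x + h) (u T) <= u T x * h.
    by rewrite -[X in _ * X]hE; apply: J_le_cst => // y /andP[xy _]; exact: uni.
  have u2' : u T (x + h) * h <= J x (x + h) (u T).
    by rewrite -[X in _ * X]hE; apply: J_ge_cst => // y /andP[_ xy]; exact: uni.
  have U1 : J x (x + h) (U T) <= U T x * h.
    by rewrite -[X in _ * X]hE; apply: J_le_cst => // y /andP[xy _]; exact: Uni.
  have U2' : U T (x + h) * h <= J x (x + h) (U T).
    by rewrite -[X in _ * X]hE; apply: J_ge_cst => // y /andP[_ xy]; exact: Uni.
  have n1 := ler_norm (D T (x + h) - D T x).
  have n2 := ler_norm (- (D T (x + h) - D T x)); rewrite normrN in n2.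
  have n3 := ler_normB (D T (x + h)) (D T x).
  have mU : U T (x + h) <= U T x := Uni T xh.
  have mu : u T (x + h) <= u T x := uni T xh.
  have mUh : 0 <= (U T x - U T (x + h)) * h by rewrite mulr_ge0 ?subr_ge0// ltW.
  have muh : 0 <= (u T x - u T (x + h)) * h by rewrite mulr_ge0 ?subr_ge0// ltW.
  rewrite -(ler_pM2l h0) mulrDr mulVKf ?gt_eqF// -[X in X * `|_|](gtr0_norm h0) -normrM.
  apply: (@le_trans _ _ (`|D T (x + h) - D T x| + h * (U T x - U T (x + h) + (u T x - u T (x + h)))));
    last by rewrite lerD2r.
  exact: (gap_arith E u1 u2' U1 U2' n1 n2 mUh muh).
have bg f : lb f -> lb (g f) by move=> bf; rewrite /g; lbt.
have Jg (f : R -> R) : lb f -> (forall x, - 2^-1 <= f x <= 2^-1) -> J (- L) L (g f) <= h.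
  move=> bf f2.
  have bf2 : lb (fun x => f (x + h / 2)) by lbt.
  have h2 x : - 2^-1 <= f (x + h / 2) <= 2^-1 by exact: f2.
  have := J_shift_le (h / 2) bf2 NL h2.
  rewrite (ger0_norm (_ : 0 <= h / 2)); last by rewrite divr_ge0// ltW.
  rewrite (_ : 2 * (h / 2) * (2^-1 - - 2^-1) = h); last by field.
  apply: le_trans; rewrite le_eqVlt; apply/orP; left; apply/eqP; apply: eq_J => x _.
  by rewrite /g; congr (f _ - f _); ring.
have := bg _ bu' ; have := bg _ bU' => bg1 bg2.
apply: (le_trans (le_J _ _ pt)); [by lbt|by lbt|].
rewrite J_add; [|by lbt|by lbt]; rewrite J_mull; last by lbt.
rewrite J_add; [|by lbt|by lbt]; rewrite J_add//.
apply: lerD; last first.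
  by rewrite (_ : 2 * h = h + h); [apply: lerD; exact: Jg|ring].
rewrite ler_wpM2l// (_ : 2 * (ka * T) = ka * T + ka * T); last by ring.
apply: lerD; last exact: J_potential_gap.
have Lh : 0 <= L + h by rewrite addr_ge0// ltW.
apply: le_trans (J_potential_gap T0 Lh).
rewrite (@J_shift _ _ _ h (fun x => `|D T x|)); last by lbt.
apply: le_J_itv; [by lbt|by move=> x; exact: normr_ge0|by lra|by lra|by lra].
all: by lbt.
Qed.

(** The choice [h = sqrt (ka T)] minimizes the bound of [l1_gap] and makes its two terms equal. *)
Lemma l1_gap_sqrt (T L : R) : 0 < T -> 0 <= L -> 0 < ka ->
  J (- L) L (fun x => `|u T x - U T x|) <= 4 * Num.sqrt (ka * T).
Proof.
move=> T0 L0 ka0.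
have kT : 0 < ka * T by rewrite mulr_gt0.
have s0 : 0 < Num.sqrt (ka * T) by rewrite sqrtr_gt0.
apply: (le_trans (l1_gap (ltW T0) L0 s0)).
rewrite -{2}(sqr_sqrtr (ltW kT)) le_eqVlt; apply/orP; left; apply/eqP.
by field; rewrite gt_eqF.
Qed.

End Stability.

(** * Cumulative distribution functions *)

Section Probability.
Variable R : realType.
Notation leb := (@lebesgue_measure R).
Implicit Types (mu : probR R) (x y a b : R).

Lemma cdfL_fin mu x : mu `]-oo, x[%classic = (cdfL mu x)%:E.
Proof. by rewrite /cdfL fineK// fin_num_measure. Qed.

Lemma cdfL_itv mu x : 0 <= cdfL mu x <= 1.
Proof. by rewrite -!lee_fin -cdfL_fin measure_ge0 probability_le1. Qed.

Lemma cdfL_nd mu x y : x <= y -> cdfL mu x <= cdfL mu y.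
Proof.
move=> xy; rewrite -lee_fin -!cdfL_fin; apply: le_measure; rewrite ?inE//.
by apply: subset_itvl; rewrite bnd_simp.
Qed.

Lemma u_of_itv mu x : - 2^-1 <= u_of mu x <= 2^-1.
Proof. by have /andP[? ?] := cdfL_itv mu x; rewrite /u_of; apply/andP; split; lra. Qed.

Lemma u_of_ni mu x y : x <= y -> u_of mu y <= u_of mu x.
Proof. by move=> xy; rewrite /u_of lerD2l lerN2 cdfL_nd. Qed.

Lemma lb_u_of mu : lb (u_of mu).
Proof.
apply: (@lb_nincr _ _ 1); first by move=> x y; exact: u_of_ni.
by move=> x; have /andP[? ?] := u_of_itv mu x; rewrite ler_norml; apply/andP; split; lra.
Qed.

Lemma cdfL_cvg mu x : cdfL mu (x - n.+1%:R^-1) @[n --> \oo] --> cdfL mu x.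
Proof.
have := @nondecreasing_cvg_mu _ _ R mu (fun n => `]-oo, x - n.+1%:R^-1[%classic).
have -> : \bigcup_n `]-oo, x - n.+1%:R^-1[%classic = `]-oo, x[%classic :> set R.
  apply/seteqP; split=> [y [n _]|y]; rewrite /= !in_itv/=.
    by move=> /lt_trans; apply; rewrite ltrBlDr ltrDl invr_gt0.
  move=> yx.
  have [N HN] : exists N, (x - y)^-1 < N.+1%:R.
    have := Num.Theory.archi_boundP (normr_ge0 ((x - y)^-1)).
    set N := Num.bound _ => h; exists N.
    rewrite (le_lt_trans (ler_norm _))// (lt_trans h)// ltr_nat//.
  exists N => //; rewrite /= in_itv/= ltrBrDr addrC -ltrBrDr.
  by rewrite invf_plt ?posrE ?subr_gt0// ?ltr0n.
move=> H; apply: fine_cvg; rewrite -cdfL_fin; apply: H.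
- by move=> n; exact: measurable_itv.
- exact: measurable_itv.
- move=> n m nm; apply/subsetPset; apply: subset_itvl; rewrite bnd_simp.
  by rewrite lerD2l lerN2 lef_pV2 ?posrE ?ltr0n// ler_nat.
Qed.

Lemma lcont_u_of mu x : lcont (u_of mu) x.
Proof.
apply: lcont_seq => y Hy; rewrite /u_of; apply: cvgB; first exact: cvg_cst.
apply: (@squeeze_cvgr _ _ _ _ (fun n => cdfL mu (x - n.+1%:R^-1)) (fun=> cdfL mu x)).
- by apply: nearW => n; have /andP[? ?] := Hy n; rewrite !cdfL_nd.
- exact: cdfL_cvg.
- exact: cvg_cst.
Qed.

Lemma integrable_bounded mu (f : R -> R) B : measurable_fun setT f -> (forall x, `|f x| <= B) ->
  mu.-integrable setT (EFin \o f).
Proof.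
move=> mf fB; apply: measurable_bounded_integrable => //.
- by have := probability_setT mu; rewrite /= => ->; rewrite ltry.
by exists B; split; [exact: num_real|move=> M BM x _; exact: le_trans (fB x) (ltW BM)].
Qed.

Lemma cdfL_integral mu x : cdfL mu x = \int[mu]_y (1 - (x <= y)%R%:R).
Proof.
rewrite /cdfL /Rintegral; congr fine.
rewrite -(setIT `]-oo, x[%classic) -integral_indic//.
apply: eq_integral => y _; rewrite indicE.
have -> : (y \in `]-oo, x[%classic) = ~~ (x <= y).
  by rewrite -ltNge; apply/idP/idP; rewrite inE/= in_itv.
by case: (x <= y); rewrite ?subrr ?subr0.
Qed.

Lemma fubini_prob mu (F : R -> R -> R) a b B : lb2 F -> a <= b ->
  (forall y x, a <= x <= b -> `|F y x| <= B) ->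
  \int[mu]_y J a b (F y) = J a b (fun x => \int[mu]_y F y x).
Proof.
move=> bF ab FB.
pose D : set (R * R) := setT `*` `[a, b]%classic.
have mD : measurable D by exact: measurableX.
pose g := (fun p : R * R => (F p.1 p.2)%:E) \_ D.
have ig : (mu \x leb)%E.-integrable setT g.
  rewrite /g -integrable_mkcond//; apply: measurable_bounded_integrable => //.
  - apply: (@le_lt_trans _ _ (mu setT * leb `[a, b]%classic)%E).
      by rewrite -product_measure1E.
    rewrite probability_setT mul1e.
    have := @lebesgue_measure_itv R `[a, b]; rewrite /= => ->.
    by case: ifPn => _; rewrite ?ltry// -EFinD ltry.
  - by apply: measurable_funTS; exact: bF.1.
  - exists B; split; first exact: num_real.
    move=> M BM [y x] [] /= _; rewrite in_itv/= => xab.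
    exact: le_trans (FB y x xab) (ltW BM).
have := Fubini ig.
have H1 (y : R) : (\int[leb]_x g (y, x) = (J a b (F y))%:E)%E.
  rewrite -J_EFin; last by lbt.
  rewrite [RHS]integral_mkcond; apply: eq_integral => x _.
  rewrite /g /patch /D.
  suff -> : ((y, x) \in setT `*` `[a, b]%classic) = (x \in `[a, b]%classic) by [].
  by apply/idP/idP; rewrite !inE/=; [case|split].
have H2 (x : R) : (\int[mu]_y g (y, x) = ((fun x => (\int[mu]_y F y x)%:E) \_ `[a, b]) x)%E.
  rewrite /patch; case: ifPn => xab.
    have xab' : a <= x <= b by move: xab; rewrite inE/= in_itv.
    rewrite /Rintegral fineK; last first.
      apply: integrable_fin_num => //; apply: (@integrable_bounded _ _ B) => [|y]; last exact: FB.
      by apply: (proj1 (_ : lb (F ^~ x))); apply: (lb2_lb bF); lbt.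
    apply: eq_integral => y _; rewrite /g /patch /D ifT//.
    by rewrite inE/=; split => //; rewrite inE in xab.
  rewrite integral0_eq// => y _; rewrite /g /patch ifF//.
  by apply/negbTE; apply: contra xab; rewrite !inE => -[].
have H1' : (\int[mu]_y \int[leb]_x g (y, x) = \int[mu]_y (J a b (F y))%:E)%E.
  by apply: eq_integral => y _; exact: H1.
have H2' : (\int[leb]_x \int[mu]_y g (y, x) = \int[leb]_x ((fun x => (\int[mu]_y F y x)%:E) \_ `[a, b]) x)%E.
  by apply: eq_integral => x _; exact: H2.
rewrite H1' H2' -integral_mkcond => E.
by rewrite /J /Rintegral E.
Qed.

(** Narrow continuity says nothing about [cdfL] at an atom. Integrated against [chi], however,
    [cdfL] becomes the [mu]-integral of a bounded continuous function. *)
Lemma J_cdfL mu (chi : R -> R) a b B : lb chi -> a <= b -> (forall x, a <= x <= b -> `|chi x| <= B) ->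
  J a b (fun x => cdfL mu x * chi x) =
  \int[mu]_y J a b (fun x => (1 - (x <= y)%R%:R) * chi x).
Proof.
move=> bchi ab chiB.
rewrite (@fubini_prob mu (fun y x => (1 - (x <= y)%R%:R) * chi x) a b B) //.
- apply: eq_J => x xab; rewrite cdfL_integral -RintegralZr//.
  apply: (@integrable_bounded _ _ 1).
    apply: (proj1 (_ : lb (fun y => 1 - (x <= y)%R%:R : R))); lbt.
  by move=> y; case: (x <= y); rewrite ?subrr ?subr0 ?normr0 ?normr1.
- by lbt.
- move=> y x xab; rewrite normrM -[leRHS]mul1r ler_pM ?chiB//.
  by case: (x <= y); rewrite ?subrr ?subr0 ?normr0 ?normr1.
Qed.

End Probability.

(** * Consequences of narrow continuity for cumulative functions *)

Section NarrowContinuity.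
Variable R : realType.
Implicit Types (f chi : R -> R) (x y z a b t T : R).

Lemma J_le_ind chi a b y : lb chi -> a <= b ->
  J a b (fun x => (x <= y)%R%:R * chi x) = J a (Num.max a (Num.min y b)) chi.
Proof.
move=> bchi ab.
have [by_|yb] := leP b y.
  rewrite max_r//; apply: eq_J => x /andP[_ xb].
  by rewrite (le_trans xb by_) mul1r.
have [ay|ya] := leP a y.
  rewrite (@J_cat _ a y b); [|by lbt|by rewrite ay ltW].
  rewrite (_ : J y b _ = 0) ?addr0.
    by apply: eq_J => x /andP[_ ->]; rewrite mul1r.
  apply: J_zero_oo; first by lbt.
  by move=> x /andP[yx _]; rewrite leNgt yx mul0r.
rewrite J_xx; apply: J_zero => x /andP[ax _].
by rewrite leNgt (lt_le_trans ya ax) mul0r.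
Qed.

Lemma max_min_lip a b (y z : R) : a <= b -> y <= z ->
  0 <= Num.max a (Num.min z b) - Num.max a (Num.min y b) <= z - y.
Proof.
have E (x : R) : a <= b -> [\/ x <= a /\ Num.max a (Num.min x b) = a,
    (a <= x /\ x <= b) /\ Num.max a (Num.min x b) = x | b <= x /\ Num.max a (Num.min x b) = b].
  move=> ab; case: (leP x b) => xb.
    by case: (leP a x) => ax; [apply: Or32|apply: Or31; split=> //; exact: ltW].
  by apply: Or33; split; [exact: ltW|rewrite max_r].
move=> ab yz.
by case: (E y ab) => -[h1 ->]; case: (E z ab) => -[h2 ->]; apply/andP; split; lra.
Qed.

(** As a function of [y] this is the integral of [chi] over the part of [[a, b]] beyond [y]: it is
    Lipschitz, since clipping [y] to [[a, b]] is. *)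
Lemma J_tail_continuous chi a b B : lb chi -> a <= b ->
  (forall x, a <= x <= b -> `|chi x| <= B) ->
  continuous (fun y => J a b (fun x => (1 - (x <= y)%R%:R) * chi x)) /\
  forall y, `|J a b (fun x => (1 - (x <= y)%R%:R) * chi x)| <= B * (b - a).
Proof.
move=> bchi ab chiB.
have B0 : 0 <= B by apply: le_trans (chiB a _) => //; rewrite lexx ab.
split; last first.
  move=> y; apply: J_le_norm; [by lbt|by []|] => x xab.
  rewrite normrM -[leRHS]mul1r ler_pM ?chiB//.
  by case: (x <= y); rewrite ?subrr ?subr0 ?normr0 ?normr1.
pose m y := Num.max a (Num.min y b).
have am y : a <= m y <= b.
  by rewrite /m le_max lexx ge_max ab ge_min lexx orbT.
have mlip y z : y <= z -> 0 <= m z - m y <= z - y.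
  exact: max_min_lip ab.
have E y : J a b (fun x => (1 - (x <= y)%R%:R) * chi x) = J a b chi - J a (m y) chi.
  rewrite -(J_le_ind y bchi ab) -J_sub; [|by lbt|by lbt].
  by apply: eq_J => x _; ring.
apply: lipschitz_continuous => M; exists B.
have H y z : y <= z -> `|J a (m z) chi - J a (m y) chi| <= B * (z - y).
  move=> yz; have /andP[h1 h2] := mlip y z yz; have /andP[h3 h4] := am y.
  have /andP[h5 h6] := am z.
  rewrite (@J_cat _ a (m y) (m z)) ?h3//=; last by rewrite -subr_ge0.
  rewrite addrAC subrr add0r; apply: (@le_trans _ _ (B * (m z - m y))); last by rewrite ler_wpM2l.
  apply: J_le_norm => //; first by rewrite -subr_ge0.
  by move=> x /andP[x1 x2]; apply: chiB; rewrite (le_trans h3 x1) (le_trans x2 h6).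
move=> y z _ _; rewrite !E (_ : _ - _ = J a (m z) chi - J a (m y) chi); last by ring.
have [yz|/ltW zy] := leP y z.
  by rewrite (distrC y) (ger0_norm (_ : 0 <= z - y)) ?subr_ge0//; exact: H.
rewrite distrC.
by rewrite (ger0_norm (_ : 0 <= y - z)) ?subr_ge0//; exact: H.
Qed.

Variable rho : R -> probR R.
Hypothesis nc : narrow_cont rho.

(* The truncation matters because rho is arbitrary at negative times. *)
Definition ucdf t x : R := u_of (rho (Num.max t 0)) x.

Lemma ucdf_itv t x : - 2^-1 <= ucdf t x <= 2^-1.
Proof. exact: u_of_itv. Qed.

Lemma ucdf_norm t x : `|ucdf t x| <= 1.
Proof. by have /andP[? ?] := ucdf_itv t x; rewrite ler_norml; apply/andP; split; lra. Qed.

Lemma max0_continuous : continuous (fun t : R => Num.max t 0).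
Proof.
by apply: lipschitz_continuous => M; exists 1 => x y _ _; rewrite mul1r; exact: (pos_lip x y).
Qed.

Lemma narrow_max f B : continuous f -> (forall x, `|f x| <= B) ->
  continuous (fun t => \int[rho (Num.max t 0)]_x f x).
Proof.
move=> cf fB t0.
have := nc cf (ex_intro _ B fB); move/subspace_continuousP => /(_ (Num.max t0 0)).
have t00 : `[0, +oo[%classic (Num.max t0 0) by rewrite /= in_itv/= le_max lexx orbT.
move=> /(_ t00) H P /H; rewrite !nbhs_simpl /= => HP.
have : nbhs (Num.max t0 0) (fun y => `[0, +oo[%classic y ->
  P (fine (\int[rho y]_x (f x)%:E)%E)) by exact: HP.
move=> /(@max0_continuous t0); rewrite !nbhs_simpl /=; apply: filterS => t; apply.
by rewrite /= in_itv/= le_max lexx orbT.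
Qed.

Lemma ramp_lip n x y : `|ramp n x - ramp n y| <= 2 * n.+1%:R * `|x - y|.
Proof.
rewrite /ramp (_ : _ - _ = (pos (n.+1%:R * x) - pos (n.+1%:R * y)) -
  (pos (n.+1%:R * x - 1) - pos (n.+1%:R * y - 1))); last by ring.
rewrite (le_trans (ler_normB _ _))//.
have h1 := pos_lip (n.+1%:R * x) (n.+1%:R * y).
have h2 := pos_lip (n.+1%:R * x - 1) (n.+1%:R * y - 1).
rewrite -mulrBr normrM ger0_norm// in h1.
rewrite (_ : n.+1%:R * x - 1 - (n.+1%:R * y - 1) = n.+1%:R * (x - y)) in h2; last by ring.
rewrite normrM ger0_norm// in h2.
by rewrite (le_trans (lerD h1 h2))// -mulrA mulr2n mulrDl mul1r.
Qed.

Lemma ramp_norm n x : `|ramp n x| <= 1.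
Proof. by have /andP[h1 h2] := ramp_itv n x; rewrite ger0_norm. Qed.

(** Replacing the indicator of [y < x] by [ramp n (x - y)] gives [F n], continuous in [t] by narrow
    continuity and Lipschitz in [x], hence jointly measurable; [F n] tends pointwise to the
    cumulative function. *)
Lemma lb2_ucdf : lb2 ucdf.
Proof.
split; last first.
  move=> M; exists 1 => t x _ _.
  exact: ucdf_norm.
pose F n t x := 2^-1 - \int[rho (Num.max t 0)]_y ramp n (x - y).
have cr n x : continuous (fun y : R => ramp n (x - y)).
  apply: lipschitz_continuous => M; exists (2 * n.+1%:R) => y z _ _.
  rewrite (le_trans (ramp_lip _ _ _))// (_ : x - y - (x - z) = z - y); last by ring.
  by rewrite distrC.
have ir (mu : probR R) n x : mu.-integrable setT (EFin \o (fun y => ramp n (x - y))).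
  apply: (@integrable_bounded _ _ _ 1); last by move=> y; exact: ramp_norm.
  exact: (lb_continuous (cr n x)).1.
have bF n : lb2 (F n).
  apply: lb2_caratheodory.
  - move=> x t; apply: cvgB; first exact: cvg_cst.
    exact: (@narrow_max (fun y => ramp n (x - y)) 1 (cr n x) (fun y => ramp_norm n _)).
  - move=> t; apply: (proj1 (_ : lb (F n t))); apply: lb_lipschitz => M.
    exists (2 * n.+1%:R) => x z _ _.
    rewrite /F (_ : _ - _ = \int[rho (Num.max t 0)]_y ramp n (z - y) -
      \int[rho (Num.max t 0)]_y ramp n (x - y)); last by ring.
    rewrite -RintegralB; [|exact: measurableT|exact: ir|exact: ir].
    apply: (le_trans (le_normr_Rintegral _ _)) => //.
      apply: (@integrable_bounded _ _ _ 2).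
        by apply: measurable_funB; exact: (lb_continuous (cr n _)).1.
      move=> y; rewrite (le_trans (ler_normB _ _))// (_ : 2 = 1 + 1 :> R)//.
      by rewrite lerD// ramp_norm.
    have -> : 2 * n.+1%:R * `|x - z| =
        \int[rho (Num.max t 0)]_(y in setT) (2 * n.+1%:R * `|x - z|).
      rewrite Rintegral_cst//.
      by have := probability_setT (rho (Num.max t 0)); rewrite /= => ->; rewrite /= mulr1.
    apply: le_Rintegral => //.
    + apply: (@integrable_bounded _ _ _ 2).
        apply: measurableT_comp => //.
        by apply: measurable_funB; exact: (lb_continuous (cr n _)).1.
      move=> y; rewrite normr_id (le_trans (ler_normB _ _))// (_ : 2 = 1 + 1 :> R)//.
      by rewrite lerD// ramp_norm.
    + by apply: (@integrable_bounded _ _ _ `|2 * n.+1%:R * `|x - z| |) => //; exact: measurable_cst.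
    + move=> y _; rewrite (le_trans (ramp_lip _ _ _))// (_ : z - y - (x - y) = z - x); last by ring.
      by rewrite distrC.
  - move=> M; exists 2 => t x _ _; rewrite /F.
    rewrite (le_trans (ler_normB _ _))// (_ : 2 = 1 + 1 :> R)// lerD//.
      by rewrite (_ : `|2^-1| = 2^-1 :> R) ?ger0_norm ?invr_ge0 // invf_le1 // ler1n.
    apply: (le_trans (le_normr_Rintegral _ _)) => //; first exact: ir.
    apply: (@le_trans _ _ (\int[rho (Num.max t 0)]_(y in setT) 1)).
      apply: le_Rintegral => //.
      + apply: (@integrable_bounded _ _ _ 1); last by move=> y; rewrite normr_id ramp_norm.
        by apply: measurableT_comp => //; exact: (lb_continuous (cr n x)).1.
      + by apply: (@integrable_bounded _ _ _ 1) => [|y]; [exact: measurable_cst|rewrite normr1].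
      + by move=> y _; exact: ramp_norm.
    rewrite Rintegral_cst//.
    by have := probability_setT (rho (Num.max t 0)); rewrite /= => ->; rewrite /= mulr1.
apply: (@measurable_fun_cvg _ _ _ _ (fun n (p : R * R) => F n p.1 p.2)).
  by move=> n; exact: (bF n).1.
move=> [t x] _ /=; rewrite /F /ucdf /u_of; apply: cvgB; first exact: cvg_cst.
rewrite cdfL_integral.
have := @dominated_convergence _ _ R (rho (Num.max t 0)) setT measurableT
  (fun n y => (ramp n (x - y))%:E) (fun y => (1 - (x <= y)%R%:R)%:E) (fun=> 1%:E).
case.
- by move=> n; apply/measurable_EFinP; exact: (lb_continuous (cr n x)).1.
- apply/measurable_EFinP; apply: (proj1 (_ : lb (fun y => 1 - (x <= y)%R%:R : R))); lbt.
- apply: aeW => y _; apply/fine_cvgP; split; first exact: nearW.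
  case: leP => [xy|yx] /=.
    rewrite subrr; apply: cvg_near_cst; apply: nearW => n.
    by rewrite /= ramp_le0// subr_le0.
  by rewrite subr0; apply: ramp_cvg1; rewrite subr_gt0.
- by apply: (@integrable_bounded _ _ (fun=> 1) 1) => [|y]; [exact: measurable_cst|rewrite normr1].
- by apply: aeW => y n _; rewrite lee_fin ramp_norm.
move=> _ _.
have fin : (\int[rho (Num.max t 0)%R]_y (1 - (x <= y)%R%:R)%R%:E \is a fin_num)%E.
  apply: integrable_fin_num => //.
  by apply: (@integrable_bounded _ _ (fun y => 1 - (x <= y)%R%:R) 1) => [|y];
    [apply: (proj1 (_ : lb (fun y => 1 - (x <= y)%R%:R : R))); lbt|
     case: (x <= y); rewrite ?subrr ?subr0 ?normr0 ?normr1].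
by rewrite -(fineK fin) => /fine_cvgP[_]; exact.
Qed.

End NarrowContinuity.

Section NarrowMovingFrame.
Variable R : realType.
Implicit Types (f chi : R -> R) (x y z a b t T : R).
Variable rho : R -> probR R.
Hypothesis nc : narrow_cont rho.

Lemma norm_itv_max a b (x : R) : a <= x -> x <= b -> `|x| <= Num.max `|a| `|b|.
Proof.
move=> ax xb; have h1 := ler_norm (- a); have h2 := ler_norm b; rewrite normrN in h1.
have m1 : `|a| <= Num.max `|a| `|b| by rewrite le_max lexx.
have m2 : `|b| <= Num.max `|a| `|b| by rewrite le_max lexx orbT.
move: (Num.max _ _) m1 m2 => m m1 m2.
by rewrite ler_norml; apply/andP; split; lra.
Qed.

Lemma J_ucdf_continuous chi a b : lb chi -> a <= b ->
  continuous (fun t => J a b (fun x => ucdf rho t x * chi x)).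
Proof.
move=> bchi ab.
have [B chiB] := bchi.2 (Num.max `|a| `|b|).
have {}chiB x : a <= x <= b -> `|chi x| <= B.
  by move=> /andP[ax xb]; apply: chiB; exact: norm_itv_max.
have [cP PB] := J_tail_continuous bchi ab chiB.
have E t : J a b (fun x => ucdf rho t x * chi x) = 2^-1 * J a b chi -
    \int[rho (Num.max t 0)]_y J a b (fun x => (1 - (x <= y)%R%:R) * chi x).
  rewrite -(J_cdfL (rho (Num.max t 0)) bchi ab chiB) -J_mull// -J_sub.
  - by apply: eq_J => x _; rewrite /ucdf /u_of; ring.
  - by lbt.
  - have -> : (fun x => cdfL (rho (Num.max t 0)) x * chi x) =
        (fun x => (2^-1 - u_of (rho (Num.max t 0)) x) * chi x).
      by apply/funext => x; rewrite /u_of; ring.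
    have bu := lb_u_of (rho (Num.max t 0)); lbt.
move=> t; rewrite (_ : (fun t => _) = (fun t => 2^-1 * J a b chi -
    \int[rho (Num.max t 0)]_y J a b (fun x => (1 - (x <= y)%R%:R) * chi x))); last exact/funext.
by apply: cvgB; [exact: cvg_cst|exact: (narrow_max nc cP PB)].
Qed.

(** In the frame frozen at time [T] this is narrow continuity. Unfreezing it displaces [psi] by
    [k (t - T)], at a cost O(t - T) as [psi] is Lipschitz; [M'] leaves room for [t <= T + 1]. *)
Lemma ucdf_rcont k M psi psi' : C11c M psi psi' -> 0 <= M -> forall T, 0 <= T ->
  rcont (fun t => J (- M) M (fun x => ucdf rho t (x + k * t) * psi x)) T.
Proof.
move=> Cpsi M0 T T0 e e0.
have bU := lb2_ucdf nc.
have bpsi := C11_lb Cpsi.1.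
have [C C0 [_ lipC]] := lb_C11c_lip Cpsi.
set M' : R := M + `|k|.
have M'0 : 0 <= M' by rewrite addr_ge0.
pose A0 t := J (- M') M' (fun x => ucdf rho t (x + k * T) * psi x).
have cA0 : continuous A0.
  have -> : A0 = (fun t => J (- M' + k * T) (M' + k * T) (fun y => ucdf rho t y * psi (y - k * T))).
    apply/funext => t; rewrite -J_shift; last by lbt.
    by apply: eq_J => x _; rewrite addrK.
  apply: J_ucdf_continuous; first by lbt.
  by rewrite lerD2r; lra.
have H t : T <= t <= T + 1 ->
    `|J (- M) M (fun x => ucdf rho t (x + k * t) * psi x) - A0 t| <= (C * `|k| * (2 * M')) * (t - T).
  move=> /andP[Tt tT].
  have dk : `|k * (T - t)| <= `|k| * (t - T) by rewrite normrM (distrC T) (ger0_norm (_ : 0 <= t - T)) ?subr_ge0.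
  rewrite -(@J_supp_shift _ (fun x => ucdf rho t (x + k * t) * psi x) M M' (k * (T - t))) => //.
  - rewrite /A0 -J_sub; [|by lbt|by lbt].
    rewrite (_ : C * _ * _ * _ = (C * (`|k| * (t - T))) * (M' - (- M'))); last by ring.
    apply: J_le_norm; [by lbt|by lra|] => x _.
    rewrite (_ : x + k * (T - t) + k * t = x + k * T); last by ring.
    rewrite -mulrBr normrM -[leRHS]mul1r ler_pM//; first exact: ucdf_norm.
    apply: (le_trans (lipC _ _)); rewrite (_ : x + k * (T - t) - x = k * (T - t)); last by ring.
    by rewrite ler_wpM2l.
  - by lbt.
  - rewrite /M' lerD2l (le_trans dk)// -[leRHS]mulr1 ler_wpM2l//; lra.
  - by move=> x Mx; rewrite (Cpsi.2 x Mx).1 mulr0.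
have HT : J (- M) M (fun x => ucdf rho T (x + k * T) * psi x) = A0 T.
  have := H T; rewrite subrr mulr0 lexx ler_wpDr// => /(_ isT).
  by rewrite normr_le0 subr_eq0 => /eqP.
have e20 : 0 < e / 2 by rewrite divr_gt0.
have /cvgrPdist_le/(_ _ e20) := cA0 T.
move=> /nbhs_ballP[d /= d0 dA].
set D := C * `|k| * (2 * M').
have D0 : 0 <= D by rewrite /D !mulr_ge0.
exists (Num.min (d / 2) (Num.min 1 (e / (2 * (D + 1))))).
  by rewrite !lt_min ltr01 !divr_gt0// mulr_gt0// ltr_wpDl.
move=> t /andP[Tt]; rewrite -lerBlDl !le_min => /andP[t1 /andP[t2 t3]].
rewrite HT; set At := J (- M) M _.
have h1 : `|At - A0 t| <= e / 2.
  have tt : T <= t <= T + 1 by rewrite Tt -lerBlDl.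
  apply: (le_trans (H t tt)).
  apply: (@le_trans _ _ ((D + 1) * (t - T))); first by rewrite ler_wpM2r ?subr_ge0// lerDl.
  apply: (@le_trans _ _ ((D + 1) * (e / (2 * (D + 1))))); first by rewrite ler_wpM2l// addr_ge0.
  by rewrite le_eqVlt; apply/orP; left; apply/eqP; field; rewrite gt_eqF// ltr_wpDl.
have h2 : `|A0 T - A0 t| <= e / 2.
  apply: dA; rewrite /ball/= distrC ger0_norm ?subr_ge0//.
  by apply: (le_lt_trans t1); rewrite ltr_pdivrMr// mulr_natr mulr2n ltrDl.
rewrite (_ : At - A0 T = (At - A0 t) - (A0 T - A0 t)); last by ring.
by rewrite (le_trans (ler_normB _ _))// [leRHS](splitr e) lerD.
Qed.

Lemma lcont_ucdf t x : lcont (ucdf rho t) x.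
Proof. exact: lcont_u_of. Qed.

Lemma ucdf_ni t x y : x <= y -> ucdf rho t y <= ucdf rho t x.
Proof. exact: u_of_ni. Qed.

End NarrowMovingFrame.

(** * The initial value of the flux variable *)

Section InitialFlux.
Variable R : realType.
Implicit Types (mu : probR R) (x y z B : R).

Lemma integrable_prob_prod mu (G : R -> R -> R) B : lb2 G -> (forall y z, `|G y z| <= B) ->
  (mu \x mu)%E.-integrable setT (fun p : R * R => (G p.1 p.2)%:E).
Proof.
move=> bG GB; apply: measurable_bounded_integrable => //.
- apply: (@le_lt_trans _ _ (mu setT * mu setT)%E).
    by rewrite -product_measure1E// setXTT.
  by rewrite probability_setT mul1e ltry.
- exact: bG.1.
- by exists B; split; [exact: num_real|move=> M BM [y z] _; exact: le_trans (GB y z) (ltW BM)].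
Qed.

Lemma Rintegral_prob_prod mu (G : R -> R -> R) B : lb2 G -> (forall y z, `|G y z| <= B) ->
  \int[mu]_y \int[mu]_z G y z = \int[(mu \x mu)%E]_p G p.1 p.2.
Proof.
move=> bG GB; rewrite /Rintegral; congr fine.
rewrite -(integral12_prod_meas1 (integrable_prob_prod mu bG GB)).
apply: eq_integral => y _; rewrite /fubini_F fineK//.
apply: integrable_fin_num => //; apply: (@integrable_bounded _ _ _ B) => [|z]; last exact: GB.
by apply: (proj1 (_ : lb (G y))); apply: (lb2_lb bG (g := fun=> y) (h := id)); lbt.
Qed.

Lemma Rintegral_prob_swap mu (G : R -> R -> R) B : lb2 G -> (forall y z, `|G y z| <= B) ->
  \int[(mu \x mu)%E]_p G p.1 p.2 = \int[(mu \x mu)%E]_p G p.2 p.1.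
Proof.
move=> bG GB.
have bG' : lb2 (fun y z => G z y) by lbt.
rewrite -(Rintegral_prob_prod mu bG' (fun y z => GB z y)) -(Rintegral_prob_prod mu bG GB).
have E := Fubini (integrable_prob_prod mu bG GB).
have fin y z : (\int[mu]_z (G y z)%:E)%E \is a fin_num /\ (\int[mu]_y (G y z)%:E)%E \is a fin_num.
  split; apply: integrable_fin_num => //; apply: (@integrable_bounded _ _ _ B) => [|?]; try exact: GB.
    by apply: (proj1 (_ : lb (G y))); apply: (lb2_lb bG (g := fun=> y) (h := id)); lbt.
  by apply: (proj1 (_ : lb (G^~ z))); apply: (lb2_lb bG (g := id) (h := fun=> z)); lbt.
rewrite /Rintegral; congr fine.
transitivity (\int[mu]_y \int[mu]_z (G y z)%:E)%E.
  by apply: eq_integral => y _; rewrite fineK//; exact: (fin y 0).1.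
transitivity (\int[mu]_z \int[mu]_y (G y z)%:E)%E; first exact: E.
by apply: eq_integral => z _; rewrite fineK//; exact: (fin 0 z).2.
Qed.

(* As sgn is odd, only the pairs (y, z) with y < x <= z contribute to the integral of avel. *)
Lemma v0_ofE mu x : v0_of mu x = 3 / 8 + 2^-1 * u_of mu x ^+ 2.
Proof.
pose ch y : R := 1 - (x <= y)%R%:R.
have chn y : `|ch y| <= 1 by rewrite /ch; case: (x <= y); rewrite ?subrr ?subr0 ?normr0 ?normr1.
have bch : lb ch by rewrite /ch; lbt.
(* The sign as a difference of indicators, a form that [lbt] recognizes. *)
pose sgn y : R := (1 - (y <= 0)%R%:R) - (1 - (0 <= y)%R%:R).
have sgE y : Num.sg y = sgn y.
  rewrite /sgn; have [y0|y0|->] := ltgtP y 0; last by rewrite sgr0 subrr.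
  - by rewrite ltr0_sg//= ?mulr0n ?mulr1n; ring.
  - by rewrite gtr0_sg//= ?mulr0n ?mulr1n; ring.
have bsgn : lb sgn by rewrite /sgn; lbt.
pose G y z := - 2^-1 * ch y * sgn (y - z).
have GB y z : `|G y z| <= 1.
  have s1 : `|sgn (y - z)| <= 1 by rewrite -sgE normr_sg; case: (_ != _).
  rewrite /G normrM -[leRHS]mulr1 ler_pM// normrM -[leRHS]mulr1 ler_pM//.
  by rewrite normrN ger0_norm ?invr_ge0//; lra.
have bG : lb2 G by rewrite /G; lbt.
have F : \int[mu]_y ch y = cdfL mu x by rewrite cdfL_integral.
have ich : mu.-integrable setT (EFin \o ch).
  by apply: (@integrable_bounded _ _ _ 1) => //; exact: bch.1.
have icst k : mu.-integrable setT (EFin \o (fun=> k)).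
  by apply: (@integrable_bounded _ _ _ `|k|) => //; exact: measurable_cst.
have cstE k : \int[mu]_(y in setT) k = k.
  by rewrite Rintegral_cst//; have := probability_setT mu; rewrite /= => ->; rewrite /= mulr1.
pose I := \int[mu]_y \int[mu]_z G y z.
(* The symmetrization of [G]: 1/2 when exactly one of [y], [z] is below [x], and 0 otherwise.
   Swapping the variables therefore doubles the integral into that of [S]. *)
pose S y z := 2^-1 * (ch y + ch z) - ch y * ch z.
have SE y z : G y z + G z y = S y z.
  rewrite /G /S -!sgE -(opprB y z) sgrN.
  rewrite /ch; case: (leP x y) => xy; case: (leP x z) => xz /=; rewrite ?mulr0n ?mulr1n.
  - by ring.
  - by rewrite gtr0_sg ?subr_gt0 ?(lt_le_trans xz)//; field.
  - by rewrite ltr0_sg ?subr_lt0 ?(lt_le_trans xy)//; field.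
  - by field.
have bS : lb2 S by rewrite /S; lbt.
have SB y z : `|S y z| <= 2.
  by rewrite -SE (le_trans (ler_normD _ _))// (_ : 2 = 1 + 1 :> R)// lerD.
have I2 : 2 * I = cdfL mu x - cdfL mu x ^+ 2.
  rewrite mulr2n mulrDl !mul1r {1}/I /I (Rintegral_prob_prod mu bG GB).
  rewrite [X in _ + X](Rintegral_prob_swap mu bG GB).
  have bG' : lb2 (fun y z => G z y) by lbt.
  rewrite -RintegralD//; [|exact: (integrable_prob_prod mu bG GB)|
    exact: (integrable_prob_prod mu bG' (fun y z => GB z y))].
  transitivity (\int[(mu \x mu)%E]_p S p.1 p.2).
    by apply: eq_Rintegral => p _; exact: SE.
  rewrite -(Rintegral_prob_prod mu bS SB).
  transitivity (\int[mu]_y ((2^-1 - cdfL mu x) * ch y + 2^-1 * cdfL mu x)).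
    apply: eq_Rintegral => y _.
    transitivity (\int[mu]_z ((2^-1 - ch y) * ch z + 2^-1 * ch y)).
      by apply: eq_Rintegral => z _; rewrite /S; ring.
    rewrite RintegralD//; last first.
      by apply: (@integrable_bounded _ _ _ (`|2^-1 - ch y| * 1)) => [|z];
        [apply: (proj1 (_ : lb (fun z => (2^-1 - ch y) * ch z))); lbt|rewrite normrM ler_wpM2l].
    by rewrite RintegralZl// cstE F; field.
  rewrite RintegralD//; last first.
    by apply: (@integrable_bounded _ _ _ (`|2^-1 - cdfL mu x| * 1)) => [|z];
      [apply: (proj1 (_ : lb (fun z => (2^-1 - cdfL mu x) * ch z))); lbt|rewrite normrM ler_wpM2l].
  by rewrite RintegralZl// cstE F; field.
(* With [F] for [cdfL mu x], the initial value is [1/2 - (F - F^2) / 2], while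
   [u^2 / 2 = 1/8 - (F - F^2) / 2]. The constant 3/8 is the gap between the normalization 1/2 of [v]
   at minus infinity and the value 1/8 of [u^2 / 2] there. *)
have -> : v0_of mu x = 2^-1 - I; last by rewrite /u_of; lra.
rewrite /v0_of /I /Rintegral; congr (_ - fine _).
rewrite [LHS]integral_mkcond; apply: eq_integral => y _; rewrite /patch.
rewrite -/(Rintegral mu setT (G y)) (_ : G y = (fun z => ch y * (- (2^-1 * sgn (y - z))))); last first.
  by apply/funext => z; rewrite /G; ring.
rewrite RintegralZl//; last first.
  apply: (@integrable_bounded _ _ _ 1) => [|z].
    by apply: (proj1 (_ : lb (fun z => - (2^-1 * sgn (y - z))))); lbt.
  have s1 : `|sgn (y - z)| <= 1 by rewrite -sgE normr_sg; case: (_ != _).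
  rewrite normrN normrM -[leRHS]mulr1 ler_pM//.
  by rewrite ger0_norm ?invr_ge0//; lra.
have -> : (y \in `]-oo, x[%classic) = ~~ (x <= y).
  by rewrite -ltNge; apply/idP/idP; rewrite inE/= in_itv.
rewrite /avel /ch; case: (x <= y) => /=; first by rewrite subrr mul0r.
rewrite subr0 mul1r; congr EFin.
rewrite (_ : (fun z => - (2^-1 * sgn (y - z))) = (fun z => - 1 * (2^-1 * sgn (y - z)))); last first.
  by apply/funext => z; rewrite mulN1r.
rewrite RintegralZl//; last first.
  apply: (@integrable_bounded _ _ _ 1) => [|z].
    by apply: (proj1 (_ : lb (fun z => 2^-1 * sgn (y - z)))); lbt.
  have s1 : `|sgn (y - z)| <= 1 by rewrite -sgE normr_sg; case: (_ != _).
  rewrite normrM -[leRHS]mulr1 ler_pM//.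
  by rewrite ger0_norm ?invr_ge0//; lra.
rewrite mulN1r; congr (- fine _).
by apply: eq_integral => z _; rewrite sgE.
Qed.

End InitialFlux.

(** * Weak formulations *)

Section TestFunctions.
Variable R : realType.
Implicit Types (t x k M : R).

Lemma continuous_fst_comp (f : R -> R) : continuous f -> continuous (fun p : R * R => f p.1).
Proof. by move=> cf p; apply: continuous_comp; [exact: cvg_fst|exact: cf]. Qed.

Lemma continuous_frame_comp k (f : R -> R) : continuous f ->
  continuous (fun p : R * R => f (p.2 - k * p.1)).
Proof.
move=> cf p; apply: continuous_comp; last exact: cf.
by apply: cvgB; [exact: cvg_snd|apply: cvgM; [exact: cvg_cst|exact: cvg_fst]].
Qed.

Variables (k M1 M : R) (al al' psi psi' : R -> R).
Hypotheses (Cal : C1c M1 al al') (Cpsi : C1c M psi psi').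

(** A product test function travelling at speed [k]: in the frame of that speed it is
    [al t * psi x], which separates time from space. *)
Let phi t x : R := al t * psi (x - k * t).

Lemma frame_derive_t t x :
  is_derive t 1 (phi ^~ x) (al' t * psi (x - k * t) - k * al t * psi' (x - k * t)).
Proof.
have [dal _ _] := Cal; have [dpsi _ _] := Cpsi.
have dl : is_derive t 1 (fun s : R => x - k * s) (- k).
  rewrite (_ : (fun s : R => x - k * s) = (fun s => - k * s + x)); last first.
    by apply/funext => s; rewrite mulNr addrC.
  rewrite -[X in is_derive _ _ _ X]addr0; apply: is_deriveD.
  by rewrite -[X in is_derive _ _ _ X]mulr1; apply: is_deriveZ.
have dp : is_derive t 1 (fun s : R => psi (x - k * s)) (psi' (x - k * t) * - k).
  have dpsi' := dpsi (x - k * t).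
  exact: (@is_derive1_comp _ psi (fun s : R => x - k * s) t _ _ dpsi' dl).
have dalt := dal t.
rewrite (_ : _ - _ = al t *: (psi' (x - k * t) * - k) + psi (x - k * t) *: al' t); last first.
  by rewrite /GRing.scale/=; ring.
exact: is_deriveM.
Qed.

Lemma frame_derive_x t x : is_derive x 1 (phi t) (al t * psi' (x - k * t)).
Proof.
have [dpsi _ _] := Cpsi.
have dl : is_derive x 1 (fun y : R => y - k * t) 1.
  rewrite -[X in is_derive _ _ _ X]addr0; exact: is_deriveD.
have dpsi' := dpsi (x - k * t).
have dp : is_derive x 1 (fun y : R => psi (y - k * t)) (psi' (x - k * t) * 1).
  exact: (@is_derive1_comp _ psi (fun y : R => y - k * t) x _ _ dpsi' dl).
rewrite mulr1 in dp.
rewrite (_ : al t * _ = al t *: psi' (x - k * t) ); last by [].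
exact: is_deriveZ.
Qed.

Lemma frame_dt t x : dt phi t x = al' t * psi (x - k * t) - k * al t * psi' (x - k * t).
Proof. by rewrite /dt derive1E; have H := frame_derive_t t x; rewrite derive_val. Qed.

Lemma frame_dx t x : dx phi t x = al t * psi' (x - k * t).
Proof. by rewrite /dx derive1E; have H := frame_derive_x t x; rewrite derive_val. Qed.

Lemma testfun_frame : testfun phi.
Proof.
have [dal cal' al0] := Cal; have [dpsi cpsi' psi0] := Cpsi.
have cal := is_derive_continuous dal; have cpsi := is_derive_continuous dpsi.
split.
- exists (Num.max `|M1| (`|M| + `|k| * `|M1|)) => t x.
  rewrite /phi mulf_eq0 negb_or => /andP[at0 px0].
  have tM : `|t| < M1 by rewrite ltNge; apply/negP => /al0[E _]; rewrite E eqxx in at0.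
  have xM : `|x - k * t| < M by rewrite ltNge; apply/negP => /psi0[E _]; rewrite E eqxx in px0.
  have t1 : `|t| <= `|M1| by rewrite (le_trans (ltW tM))// ler_norm.
  split; first by rewrite le_max t1.
  rewrite le_max; apply/orP; right.
  rewrite -(subrK (k * t) x) (le_trans (ler_normD _ _))// lerD//.
    by rewrite (le_trans (ltW xM))// ler_norm.
  by rewrite normrM ler_wpM2l.
- by move=> p; apply: cvgM; [exact: (continuous_fst_comp cal)|exact: (continuous_frame_comp cpsi)].
- move=> t x; have H1 := frame_derive_t t x; have H2 := frame_derive_x t x.
  by split; exact: ex_derive.
- rewrite (_ : (fun p => _) = (fun p : R * R => al' p.1 * psi (p.2 - k * p.1) -
    k * al p.1 * psi' (p.2 - k * p.1))); last by apply/funext => p; exact: frame_dt.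
  move=> p; apply: cvgB; apply: cvgM.
  + exact: (continuous_fst_comp cal').
  + exact: (continuous_frame_comp cpsi).
  + by apply: cvgM; [exact: cvg_cst|exact: (continuous_fst_comp cal)].
  + exact: (continuous_frame_comp cpsi').
- rewrite (_ : (fun p => _) = (fun p : R * R => al p.1 * psi' (p.2 - k * p.1))); last first.
    by apply/funext => p; exact: frame_dx.
  by move=> p; apply: cvgM; [exact: (continuous_fst_comp cal)|exact: (continuous_frame_comp cpsi')].
Qed.

End TestFunctions.

Section FrameIntegrals.
Variable R : realType.
Notation leb := (@lebesgue_measure R).
Implicit Types (f : R -> R) (g : R -> R -> R) (a b t x k M : R).

Lemma int_R_supp M f : lb f -> (forall x, M <= `|x| -> f x = 0) -> int_R f = (J (- M) M f)%:E.
Proof.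
move=> bf f0; rewrite /int_R -J_EFin// [RHS]integral_mkcond.
apply: eq_integral => x _; rewrite /patch; case: ifPn => // xM.
rewrite f0//; rewrite leNgt; apply: contra xM => xM.
by rewrite inE/= in_itv/= -ler_norml ltW.
Qed.

Lemma int_QT_supp k M1 M g : lb2 g -> (forall t x, M1 <= `|t| \/ M <= `|x| -> g t (x + k * t) = 0) ->
  int_QT g = (J 0 M1 (fun t => J (- M) M (fun x => g t (x + k * t))))%:E.
Proof.
move=> bg g0; rewrite /int_QT.
have E t : (\int[leb]_x (g t x)%:E)%E = (J (- M) M (fun x => g t (x + k * t)))%:E.
  have bgt : lb (g t) by lbt.
  rewrite -(integral_shift (k * t)); last by apply/measurable_EFinP; exact: bgt.1.
  apply: int_R_supp; first by lbt.
  by move=> x Mx; apply: g0; right.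
transitivity (\int[leb]_(t in `[0%R, +oo[) (J (- M) M (fun x => g t (x + k * t))%R)%:E)%E.
  by apply: eq_integral => t _; exact: E.
rewrite -J_EFin; last first.
  by apply: (@lb_J _ _ _ (fun t x => g t (x + k * t))); lbt.
rewrite integral_mkcond [RHS]integral_mkcond.
apply: eq_integral => t _; rewrite /patch.
have H1 : (t \in `[0%R, +oo[%classic) = (0 <= t).
  by apply/idP/idP; rewrite inE/= in_itv/= andbT.
have H2 : (t \in `[0%R, M1]%classic) = (0 <= t) && (t <= M1).
  by apply/idP/idP; rewrite inE/= in_itv/=.
rewrite H1 H2; case: leP => //= t0; case: leP => //= M1t.
rewrite J_zero// => x _; apply: g0; left.
by rewrite ger0_norm// ltW.
Qed.

End FrameIntegrals.

Section FrameWeakForms.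
Variable R : realType.
Implicit Types (t x k M : R).

Lemma eq_int_QT (f g : R -> R -> R) : (forall t x, 0 <= t -> f t x = g t x) -> int_QT f = int_QT g.
Proof.
move=> fg; rewrite /int_QT; apply: eq_integral => t.
rewrite inE/= in_itv/= andbT => t0; apply: eq_integral => x _.
by rewrite fg.
Qed.

Lemma int_QT_frame k M1 M (al al' psi psi' : R -> R) (A B C : R -> R -> R) :
  lb2 A -> lb2 B -> lb2 C -> C1c M1 al al' -> C1c M psi psi' ->
  int_QT (fun t x => A t x * dt (fun t x => al t * psi (x - k * t)) t x +
    B t x * dx (fun t x => al t * psi (x - k * t)) t x + C t x * (al t * psi (x - k * t))) =
  (J 0 M1 (fun t => J (- M) M (fun x =>
    A t (x + k * t) * (al' t * psi x - k * al t * psi' x) +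
    B t (x + k * t) * (al t * psi' x) + C t (x + k * t) * (al t * psi x))))%:E.
Proof.
move=> bA bB bC Cal Cpsi.
have bal := C1c_lb Cal; have bal' := C1c_lb' Cal.
have bpsi := C1c_lb Cpsi; have bpsi' := C1c_lb' Cpsi.
have [_ _ al0] := Cal; have [_ _ psi0] := Cpsi.
transitivity (int_QT (fun t x =>
    A t x * (al' t * psi (x - k * t) - k * al t * psi' (x - k * t)) +
    B t x * (al t * psi' (x - k * t)) + C t x * (al t * psi (x - k * t)))).
  by apply: eq_int_QT => t x _; rewrite (frame_dt _ Cal Cpsi) (frame_dx _ _ Cpsi).
rewrite (@int_QT_supp _ k M1 M).
- apply: f_equal; apply: eq_J => t _; apply: eq_J => x _.
  by rewrite addrK.
- by lbt.
- move=> t x; rewrite addrK => -[/al0[-> ->]|/psi0[-> ->]]; ring.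
Qed.

Lemma int_R_frame k M al0 (psi psi' f : R -> R) : lb f -> C1c M psi psi' ->
  int_R (fun x => f x * (al0 * psi (x - k * 0))) = (al0 * J (- M) M (fun x => f x * psi x))%:E.
Proof.
move=> bf Cpsi; have bpsi := C1c_lb Cpsi; have [_ _ psi0] := Cpsi.
rewrite (@int_R_supp _ M).
- congr EFin; rewrite -J_mull; last by lbt.
  by apply: eq_J => x _; rewrite mulr0 subr0; ring.
- by lbt.
- by move=> x /psi0[E _]; rewrite mulr0 subr0 E !mulr0.
Qed.

End FrameWeakForms.

Section WeakForms.
Variable R : realType.
Implicit Types (t x k M : R).
Variables (rho0 : probR R) (rho : R -> probR R).

Lemma ucdf_ge0 t : 0 <= t -> ucdf rho t = u_of (rho t).
Proof. by move=> t0; rewrite /ucdf max_l. Qed.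

Section RelaxationWeak.
Variables (c eps : R) (v : R -> R -> R).
Hypothesis sol : relax_solution c eps rho0 rho v.

Lemma ucdf_0 : ucdf rho 0 = u_of rho0.
Proof. by have [r0 _ _ _ _] := sol; rewrite ucdf_ge0// r0. Qed.

Lemma lb2_relax_u : lb2 (ucdf rho).
Proof. by have [_ nc _ _ _] := sol; exact: lb2_ucdf. Qed.

Lemma lb2_relax_v : lb2 v.
Proof. by have [_ _ [mv [B vB]] _ _] := sol; split=> // M; exists B => t x _ _; exact: vB. Qed.

Lemma relax_weak1 k M1 M (al al' psi psi' : R -> R) : C1c M1 al al' -> C1c M psi psi' -> 0 <= M ->
  J 0 M1 (fun t => J (- M) M (fun x =>
    ucdf rho t (x + k * t) * (al' t * psi x - k * al t * psi' x) +
    v t (x + k * t) * (al t * psi' x))) +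
  al 0 * J (- M) M (fun x => ucdf rho 0 x * psi x) = 0.
Proof.
move=> Cal Cpsi M0; have bU := lb2_relax_u; have bV := lb2_relax_v.
have [_ _ _ E _] := sol.
have := E _ (testfun_frame k Cal Cpsi).
rewrite (int_R_frame _ _ (lb_u_of rho0) Cpsi) ucdf_0.
rewrite (eq_int_QT (g := fun t x => ucdf rho t x * dt (fun t x => al t * psi (x - k * t)) t x +
    v t x * dx (fun t x => al t * psi (x - k * t)) t x + 0 * (al t * psi (x - k * t)))); last first.
  by move=> t x t0; rewrite ucdf_ge0// mul0r addr0.
rewrite (@int_QT_frame _ k M1 M al al' psi psi' (ucdf rho) v (fun _ _ => 0))//; last by lbt.
rewrite -EFinD => E0; have H0 := EFin_inj E0. apply: (etrans _ H0).
apply: (f_equal2 +%R); [|reflexivity].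
apply: eq_J => t _; apply: eq_J => x _.
by rewrite mul0r addr0.
Qed.

Lemma relax_weak2 k M1 M (al al' psi psi' : R -> R) : C1c M1 al al' -> C1c M psi psi' -> 0 <= M ->
  J 0 M1 (fun t => J (- M) M (fun x =>
    v t (x + k * t) * (al' t * psi x - k * al t * psi' x) +
    c ^+ 2 * ucdf rho t (x + k * t) * (al t * psi' x) +
    eps^-1 * (2^-1 * ucdf rho t (x + k * t) ^+ 2 - v t (x + k * t)) * (al t * psi x))) +
  al 0 * J (- M) M (fun x => (3 / 8 + 2^-1 * ucdf rho 0 x ^+ 2) * psi x) = 0.
Proof.
move=> Cal Cpsi M0; have bU := lb2_relax_u; have bV := lb2_relax_v.
have bu0 := lb_u_of rho0.
have [_ _ _ _ E] := sol.
have := E _ (testfun_frame k Cal Cpsi).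
have -> : v0_of rho0 = (fun x => 3 / 8 + 2^-1 * u_of rho0 x ^+ 2) by apply/funext => x; exact: v0_ofE.
rewrite (int_R_frame _ _ _ Cpsi) ?ucdf_0; last by lbt.
rewrite (eq_int_QT (g := fun t x => v t x * dt (fun t x => al t * psi (x - k * t)) t x +
    (c ^+ 2 * ucdf rho t x) * dx (fun t x => al t * psi (x - k * t)) t x +
    (eps^-1 * (2^-1 * ucdf rho t x ^+ 2 - v t x)) * (al t * psi (x - k * t)))); last first.
  by move=> t x t0; rewrite ucdf_ge0.
rewrite (@int_QT_frame _ k M1 M al al' psi psi' v (fun t x => c ^+ 2 * ucdf rho t x)
  (fun t x => eps^-1 * (2^-1 * ucdf rho t x ^+ 2 - v t x)) bV _ _ Cal Cpsi); [|by lbt|by lbt].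
by rewrite -EFinD => E0; exact: (EFin_inj E0).
Qed.

End RelaxationWeak.

Section EntropyWeak.
Hypothesis sol : aggregation_solution rho0 rho.

Lemma entropy_ucdf_0 : ucdf rho 0 = u_of rho0.
Proof. by have [r0 _ _ _] := sol; rewrite ucdf_ge0// r0. Qed.

Lemma lb2_entropy_u : lb2 (ucdf rho).
Proof. by have [_ nc _ _] := sol; exact: lb2_ucdf. Qed.

Lemma J_C1c' M (f f' : R -> R) : C1c M f f' -> J (- M) M f' = 0.
Proof.
move=> [df cf f0]; have [M0|M0] := ltP 0 M.
  rewrite (@J_ftc _ f f')//; last by lra.
  have [E1 _] := f0 M (ler_norm _); have [E2 _] : f (- M) = 0 /\ f' (- M) = 0.
    by apply: f0; rewrite normrN ler_norm.
  by rewrite E1 E2 subrr.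
by apply: J_zero => x _; rewrite (f0 x _).2// (le_trans M0).
Qed.

Lemma J_C1c'_half M (f f' : R -> R) : C1c M f f' -> J 0 M f' = - f 0.
Proof.
move=> [df cf f0]; have [M0|M0] := ltP 0 M.
  rewrite (@J_ftc _ f f')//.
  by rewrite (f0 M _).1 ?sub0r// ler_norm.
rewrite (f0 0 _).1 ?normr0// oppr0.
by apply: J_zero => x _; rewrite (f0 x _).2// (le_trans M0).
Qed.

(* The Kruzhkov constants 1 and -1 lie outside the range of u, where the entropy
   inequalities become the two halves of the weak formulation. *)
Lemma entropy_weak M1 M (al al' psi psi' : R -> R) : C1c M1 al al' -> C1c M psi psi' -> 0 <= M ->
  (forall t, 0 <= al t) -> (forall x, 0 <= psi x) ->
  J 0 M1 (fun t => J (- M) M (fun x =>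
    ucdf rho t (x + 0 * t) * (al' t * psi x - 0 * al t * psi' x) +
    2^-1 * ucdf rho t (x + 0 * t) ^+ 2 * (al t * psi' x))) +
  al 0 * J (- M) M (fun x => ucdf rho 0 x * psi x) = 0.
Proof.
move=> Cal Cpsi M0 al0 psi0; have bU := lb2_entropy_u.
have bu0 := lb_u_of rho0.
have bal := C1c_lb Cal; have bal' := C1c_lb' Cal.
have bpsi := C1c_lb Cpsi; have bpsi' := C1c_lb' Cpsi.
have [_ _ _ E] := sol.
have phi0 t x : 0 <= al t * psi (x - 0 * t) by rewrite mulr_ge0.
pose Y t x := ucdf rho t (x + 0 * t) * (al' t * psi x - 0 * al t * psi' x) +
    2^-1 * ucdf rho t (x + 0 * t) ^+ 2 * (al t * psi' x).
have bY : lb2 Y by rewrite /Y; lbt.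
have bJY : lb (fun t => J (- M) M (Y t)) by exact: (lb_J _ _ bY).
have bJ0 : lb (fun t : R => al' t * J (- M) M psi) by lbt.
have b0 : lb (fun x => u_of rho0 x * psi x) by lbt.
(* The constant 1 in [1 + s u] contributes this time integral and an initial term, which cancel each
   other. *)
have Z : J 0 M1 (fun t => al' t * J (- M) M psi) = - al 0 * J (- M) M psi.
  by rewrite J_mulr// (J_C1c'_half Cal).
(* The Kruzhkov constant is [- s]: since [|u| <= 1/2], one has [|u + s| = 1 + s u] and
   [sg (u + s) = s], so the entropy inequality is the weak equation multiplied by [s]. *)
suff H (s : R) : `|s| = 1 -> 0 <= s * (J 0 M1 (fun t => J (- M) M (Y t)) +
    al 0 * J (- M) M (fun x => u_of rho0 x * psi x)).
  rewrite entropy_ucdf_0; apply/eqP; rewrite eq_le.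
  have := H 1 (normr1 _); rewrite mul1r => ->; rewrite andbT.
  by have := H (- 1); rewrite normrN normr1 mulN1r oppr_ge0; exact.
move=> s1.
have s2 : s ^+ 2 = 1 by rewrite -(real_normK (num_real s)) s1 expr1n.
have H (t x : R) : `|u_of (rho t) x - - s| = 1 + s * u_of (rho t) x /\
    Num.sg (u_of (rho t) x - - s) = s.
  have /andP[u1 u2] := u_of_itv (rho t) x.
  have [->|->] : s = 1 \/ s = - 1.
    by move/eqP: s2; rewrite sqrf_eq1 => /orP[/eqP|/eqP]; [left|right].
  - rewrite opprK mul1r addrC; have h : 0 < 1 + u_of (rho t) x by lra.
    by rewrite (gtr0_norm h) (gtr0_sg h).
  - rewrite opprK mulN1r; have h : u_of (rho t) x - 1 < 0 by lra.
    by rewrite (ltr0_norm h) (ltr0_sg h) opprB.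
have [r0 _ _ _] := sol.
have := E (- s) _ (testfun_frame 0 Cal Cpsi) phi0.
have -> : (fun x => `|u_of rho0 x - - s| * (al 0 * psi (x - 0 * 0))) =
   (fun x => (1 + s * u_of rho0 x) * (al 0 * psi (x - 0 * 0))).
  by apply/funext => x; rewrite -r0 (H 0 x).1.
rewrite (int_R_frame _ _ (_ : lb (fun x => 1 + s * u_of rho0 x)) Cpsi); last by lbt.
rewrite (eq_int_QT (g := fun t x => (1 + s * ucdf rho t x) * dt (fun t x => al t * psi (x - 0 * t)) t x +
    (s * (2^-1 * ucdf rho t x ^+ 2 - 2^-1)) * dx (fun t x => al t * psi (x - 0 * t)) t x +
    0 * (al t * psi (x - 0 * t)))); last first.
  by move=> t x t0; rewrite (H t x).1 (H t x).2 ucdf_ge0// sqrrN s2 mulr1 mul0r addr0.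
rewrite (@int_QT_frame _ 0 M1 M al al' psi psi' (fun t x => 1 + s * ucdf rho t x)
  (fun t x => s * (2^-1 * ucdf rho t x ^+ 2 - 2^-1)) (fun _ _ => 0) _ _ _ Cal Cpsi); [|by lbt..].
rewrite -EFinD lee_fin; congr (0 <= _).
rewrite (eq_J (g := fun t => al' t * J (- M) M psi + s * J (- M) M (Y t))); last first.
  move=> t _; have bYt : lb (Y t) by apply: (lb2_lb bY (g := fun=> t) (h := id)); lbt.
  transitivity (J (- M) M (fun x => al' t * psi x + (s * Y t x + - (s * 2^-1 * al t) * psi' x))).
    by apply: eq_J => x _; rewrite /Y; ring.
  rewrite J_add; [|by lbt|by lbt]; rewrite J_add; [|by lbt|by lbt].
  by rewrite !J_mull// (J_C1c' Cpsi) mulr0 addr0.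
rewrite J_add; [|by lbt|by lbt]; rewrite Z J_mull//.
rewrite (eq_J (f := fun x => (1 + s * u_of rho0 x) * psi x) (g := fun x => psi x + s * (u_of rho0 x * psi x))).
  rewrite J_add//; last by lbt.
  by rewrite J_mull//; ring.
by move=> x _; ring.
Qed.

Lemma entropy_conservation T : 0 <= T -> forall a b, a <= b ->
  J a b (ucdf rho T) - J a b (ucdf rho 0) =
  J 0 T (fun t => 2^-1 * ucdf rho t a ^+ 2 - 2^-1 * ucdf rho t b ^+ 2).
Proof.
move=> T0 a b ab; have bU := lb2_entropy_u; have [_ nc _ _] := sol.
pose fl t x := 2^-1 * ucdf rho t x ^+ 2.
have bfl : lb2 fl by rewrite /fl; lbt.
have lfl t x : lcont (fl t) x.
  apply: lcont_seq => y Hy; apply: cvgM; first exact: cvg_cst.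
  have h := lcont_cvg (@lcont_ucdf R rho t x) Hy.
  by rewrite expr2 (_ : (fun n => _) = (fun n => ucdf rho t (y n) * ucdf rho t (y n)));
    [exact: cvgM|apply/funext => n; rewrite expr2].
have C := @conservation R (ucdf rho) fl 0 T bU bfl lfl T0.
rewrite [LHS](_ : _ = J a b (fun x => ucdf rho T (x + 0 * T)) - J a b (ucdf rho 0)); last first.
  by congr (_ - _); apply: eq_J => x _; rewrite mul0r addr0.
rewrite (C _ a b ab).
  by apply: eq_J => t _; rewrite !mul0r !addr0.
move=> M psi chi chi' [Cpsi Cchi psi0] M0.
have C1psi := C11c_C1c Cpsi.
rewrite (weak_balance bU bfl C1psi _ T0 (ucdf_rcont nc 0 Cpsi M0 T0)).
  by apply: eq_J => t _; apply: eq_J => x _; rewrite !mul0r subr0.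
move=> M1 al al' Cal al0; exact: (entropy_weak (C11c_C1c Cal) C1psi M0 al0 psi0).
Qed.

End EntropyWeak.

End WeakForms.

(** * The Wasserstein distance *)

Section Wasserstein.
Variable R : realType.
Notation leb := (@lebesgue_measure R).
Implicit Types (mu nu : probR R) (p q x y z : R).

(** Both kinds of half-line occur in the layer cake argument: slices in [z] are given by
    [z < cdfL mu x], slices in [x] by [x <= quantile mu z]. *)
Lemma integral_step_gap (b : bool) p q :
  (\int[leb]_z (`|(if b then z < p else z <= p)%:R - (if b then z < q else z <= q)%:R|)%:E)%E =
  `|p - q|%:E.
Proof.
wlog pq : p q / p <= q => [H|].
  have [pq|/ltW qp] := leP p q; first exact: H.
  rewrite distrC -H//; apply: eq_integral => z _; by rewrite distrC.
transitivity (\int[leb]_z (\1_[set` Interval (BSide b p) (BSide b q)] z)%:E)%E.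
  apply: eq_integral => z _; rewrite indicE.
  have -> : (z \in [set` Interval (BSide b p) (BSide b q)]) =
      ~~ (if b then z < p else z <= p) && (if b then z < q else z <= q).
    by case: b; apply/idP/idP; rewrite inE/= in_itv/= -?leNgt -?ltNge.
  case: b; [case: (ltP z p) => zp|case: (leP z p) => zp] => /=.
  - by rewrite (lt_le_trans zp pq) subrr normr0.
  - by rewrite sub0r normrN; case: (z < q); rewrite ?normr0 ?normr1.
  - by rewrite (le_trans zp pq) subrr normr0.
  - by rewrite sub0r normrN; case: (z <= q); rewrite ?normr0 ?normr1.
rewrite integral_indic// setIT distrC ger0_norm ?subr_ge0//.
have := @lebesgue_measure_itv R (Interval (BSide b p) (BSide b q)); rewrite /= => ->.
rewrite lte_fin lt_neqAle pq andbT; case: eqP => [->|_] /=; first by rewrite subrr.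
by rewrite EFinB.
Qed.

Lemma cdfL_cvgy mu : cdfL mu n%:R @[n --> \oo] --> (1 : R).
Proof.
have := @nondecreasing_cvg_mu _ _ R mu (fun n => `]-oo, n%:R[%classic).
have -> : \bigcup_n `]-oo, n%:R[%classic = [set: R].
  rewrite -subTset => y _; exists (Num.bound `|y|) => //=.
  by rewrite in_itv/= (le_lt_trans (ler_norm y))//; exact: archi_boundP.
have := probability_setT mu; rewrite /= => ->.
move=> H; apply: fine_cvg; apply: H.
- by move=> n; exact: measurable_itv.
- exact: measurableT.
- move=> n m nm; apply/subsetPset; apply: subset_itvl; rewrite bnd_simp.
  by rewrite ler_nat.
Qed.

Lemma cdfL_cvgNy mu : cdfL mu (- n%:R) @[n --> \oo] --> (0 : R).
Proof.
have := @nonincreasing_cvg_mu _ _ R mu (fun n => `]-oo, - n%:R[%classic).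
have -> : \bigcap_n `]-oo, - n%:R[%classic = set0 :> set R.
  rewrite -subset0 => y /(_ (Num.bound `|y|) I); rewrite /= in_itv/= ltrNr.
  rewrite ltNge => /negP; apply; rewrite ltW// (le_lt_trans (ler_norm _))// normrN.
  exact: archi_boundP.
rewrite measure0 => H; apply: fine_cvg; apply: H.
- by rewrite /= (le_lt_trans (probability_le1 _ _))// ltry.
- by move=> n; exact: measurable_itv.
- exact: measurable0.
- move=> n m nm; apply/subsetPset; apply: subset_itvl; rewrite bnd_simp.
  by rewrite lerN2 ler_nat.
Qed.

(** The limits of [cdfL] at infinity make the set nonempty and bounded below for [0 < z < 1], so
    that [inf] is a true infimum. From left to right, left continuity of [cdfL] puts a point
    strictly below [x] into the set. *)
Lemma quantileP mu z x : 0 < z < 1 -> (z < cdfL mu x) = ~~ (x <= quantile mu z).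
Proof.
move=> /andP[z0 z1]; rewrite -ltNge /quantile; set S := [set x | _].
have [y Sy] : S !=set0.
  have [n _ /(_ n)] := @cvgr_gt _ _ _ _ _ _ (cdfL_cvgy mu) _ z1.
  by rewrite /= => /(_ (leqnn _)) h; exists n%:R.
have Sb : has_lbound S.
  have [n _ /(_ n)] := @cvgr_lt _ _ _ _ _ _ (cdfL_cvgNy mu) _ z0.
  rewrite /= => /(_ (leqnn _)) h; exists (- n%:R) => t St; rewrite leNgt; apply/negP => tn.
  by have := lt_trans (lt_le_trans St (cdfL_nd mu (ltW tn))) h; rewrite ltxx.
apply/idP/idP => [zx|/inf_lt[]]; last 2 first.
- by exists y.
- by move=> s Ss sx; exact: lt_le_trans Ss (cdfL_nd mu (ltW sx)).
have [n _ /(_ n)] := @cvgr_gt _ _ _ _ _ _ (@cdfL_cvg R mu x) _ zx.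
rewrite /= => /(_ (leqnn _)) h.
apply: (@le_lt_trans _ _ (x - n.+1%:R^-1)); first exact: ge_inf.
by rewrite ltrBlDr ltrDl invr_gt0.
Qed.

(* Layer cake: both integrals slice the function |1(z < F x) - 1(z < G x)| of (z, x). *)
Lemma W1_le_cdf mu nu : (W1 mu nu <= \int[leb]_x (`|cdfL mu x - cdfL nu x|)%:E)%E.
Proof.
pose g (p : R * R) := (`|(p.1 < cdfL mu p.2)%R%:R - (p.1 < cdfL nu p.2)%R%:R| : R)%:E.
have lbF (m : probR R) : lb (cdfL m).
  rewrite (_ : cdfL m = (fun x => 2^-1 - u_of m x)); last first.
    by apply/funext => x; rewrite /u_of; ring.
  by have b := lb_u_of m; lbt.
have b1 (m : probR R) : lb2 (fun z x : R => (z < cdfL m x)%R%:R : R).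
  rewrite (_ : (fun z x : R => _) = (fun z x => 1 - (cdfL m x <= z)%R%:R)); last first.
    apply/funext => z; apply/funext => x; rewrite leNgt; case: (z < cdfL m x) => /=; ring.
  by have b := lbF m; lbt.
have mg : measurable_fun setT g.
  apply/measurable_EFinP.
  have h1 := b1 mu; have h2 := b1 nu.
  by apply: (proj1 (_ : lb2 (fun z x => `|(z < cdfL mu x)%R%:R - (z < cdfL nu x)%R%:R|))); lbt.
have g0 (r : R * R) : (0 <= g r)%E by rewrite lee_fin.
have mh := @measurable_fun_fubini_tonelli_F _ _ _ _ R leb g mg g0.
set h := fubini_F leb g in mh.
have h0 z : (0 <= h z)%E by apply: integral_ge0 => x _; exact: g0.
have E z : 0 < z < 1 -> h z = `|quantile mu z - quantile nu z|%:E.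
  move=> z01; rewrite /h /fubini_F -(integral_step_gap false).
  apply: eq_integral => x _; rewrite /g/= !(quantileP _ _ z01).
  case: (x <= quantile mu z); case: (x <= quantile nu z) => /=;
    by rewrite ?mulr0n ?mulr1n ?subrr ?subr0 ?sub0r ?normrN.
have mq : measurable_fun (`]0%R, 1%R[%classic : set (measurableTypeR R)) (fun z => `|quantile mu z - quantile nu z|%:E).
  apply: (@eq_measurable_fun _ _ _ _ _ h).
    by move=> z; rewrite inE/= in_itv/= => z01; rewrite E.
  exact: measurable_funTS.
(* The endpoints 0 and 1, where [quantile] may be the infimum of an unbounded or empty set, form a
   null set. *)
rewrite /W1 (@integral_itv_bndoo _ 0 1 (fun z => `|quantile mu z - quantile nu z|%:E) true false mq).
apply: (@le_trans _ _ (\int[leb]_z h z)%E).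
  rewrite [leLHS](_ : _ = (\int[leb]_(z in `]0%R, 1%R[) h z)%E); last first.
    by apply: eq_integral => z; rewrite inE/= in_itv/= => z01; rewrite E.
  exact: ge0_subset_integral.
have T := fubini_tonelli (m1 := leb) (m2 := leb) g mg g0.
rewrite [leLHS](_ : _ = (\int[leb]_x \int[leb]_z g (z, x))%E); last exact: T.
rewrite le_eqVlt; apply/orP; left; apply/eqP; apply: eq_integral => x _.
rewrite -(integral_step_gap true (cdfL mu x)).
by apply: eq_integral => z _; rewrite /g.
Qed.

Lemma integral_le_of_J (f : R -> R) B : lb f -> (forall x, 0 <= f x) ->
  (forall L, 0 <= L -> J (- L) L f <= B) -> (\int[leb]_x (f x)%:E <= B%:E)%E.
Proof.
move=> bf f0 H.
have cv : (\int[leb]_(x in `[(- n%:R)%R, n%:R]) (f x)%:E)%E @[n --> \oo] --> (\int[leb]_x (f x)%:E)%E.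
  rewrite -(_ : \bigcup_n `[- n%:R, n%:R]%classic = [set: R]); last first.
    rewrite -subTset => y _; exists (Num.bound `|y|) => //=.
    by rewrite in_itv/= -ler_norml ltW//; exact: archi_boundP.
  apply: ge0_nondecreasing_set_cvg_integral.
  - move=> n m nm; apply/subsetPset; apply: subset_itv; rewrite bnd_simp ?lerN2 ler_nat//.
  - by move=> n; exact: measurable_itv.
  - by move=> n; apply/measurable_EFinP; apply: measurable_funTS; exact: bf.1.
  - by move=> n x _; rewrite lee_fin.
apply: (cvge_to_le cv).
by apply: nearW => n; rewrite J_EFin// lee_fin H.
Qed.

End Wasserstein.

(** * The rate of convergence *)

Lemma l1_gap_relaxation (R : realType) (rho0 : probR R) (c eps : R) (rhoe rho : R -> probR R)
    (ve : R -> R -> R) (T L : R) :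
  2^-1 < c -> 0 < eps -> relax_solution c eps rho0 rhoe ve -> aggregation_solution rho0 rho ->
  0 < T -> 0 <= L ->
  J (- L) L (fun x => `|u_of (rho T) x - u_of (rhoe T) x|) <= 4 * Num.sqrt (2 * c ^+ 2 * eps * T).
Proof.
move=> c12 eps0 sole sol T0 L0.
have [_ nce _ _ _] := sole; have [_ nc _ _] := sol.
have bU := lb2_relax_u sole; have bV := lb2_relax_v sole; have bu := lb2_entropy_u sol.
have Uni := @ucdf_ni R rhoe; have uni := @ucdf_ni R rho.
have U2 := @ucdf_itv R rhoe; have u2 := @ucdf_itv R rho.
have lU := @lcont_ucdf R rhoe.
have cU k M psi psi' (Cpsi : C11c M psi psi') M0 := @ucdf_rcont R rhoe nce k M psi psi' Cpsi M0.
have W1' := relax_weak1 sole; have W2' := relax_weak2 sole.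
have c0 : 0 < c by rewrite (lt_trans _ c12)// invr_gt0.
have ka0 : 0 < 2 * c ^+ 2 * eps by rewrite !mulr_gt0// exprn_gt0.
have frame := frame_conservation eps0 bU bV lU cU W1' W2'.
have consU := conservation_mean_flux eps0 bU bV lU cU W1' W2'.
rewrite -(ucdf_ge0 rho (ltW T0)) -(ucdf_ge0 rhoe (ltW T0)).
have Uu0 : ucdf rhoe 0 = ucdf rho 0 by rewrite (ucdf_0 sole) (entropy_ucdf_0 sol).
have bw : lb2 (mean_flux c eps (ucdf rhoe)) by rewrite /mean_flux; have h1 := lb2_kinetic eps bU c; have h2 := lb2_kinetic eps bU (- c); lbt.
apply: (l1_gap_sqrt bU bu bw Uni uni U2 u2 Uu0 consU (entropy_conservation sol) _ _ T0 L0 ka0).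
- by move=> t x t0; exact: (mean_flux_ge eps0 c12 bU Uni U2 lU frame x t0).
- by move=> t L' t0 L0'; exact: (mean_flux_excess eps0 c12 bU Uni U2 lU frame t0 L0').
Qed.

Theorem theorem2 (R : realType) (rho0 : probR R) (c : R) :
  second_moment rho0 -> 2^-1 < c ->
  exists C : R, 0 < C /\
    forall eps : R, 0 < eps ->
    forall (rhoe : R -> probR R) (ve : R -> R -> R),
      relax_solution c eps rho0 rhoe ve ->
    forall rho : R -> probR R, aggregation_solution rho0 rho ->
    forall T : R, 0 < T ->
      (W1 (rho T) (rhoe T) <= (C * (Num.sqrt (eps * T) + eps))%:E)%E.
Proof.
move=> _ c12; have c0 : 0 < c by rewrite (lt_trans _ c12)// invr_gt0.
(* [l1_gap_relaxation] gives the factor [4 sqrt 2 * c], and [4 sqrt 2 <= 6] since [32 <= 36]. *)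
exists (6 * c); split; first by rewrite mulr_gt0.
move=> eps eps0 rhoe ve sole rho sol T T0.
have eT0 : 0 <= eps * T by rewrite mulr_ge0 ?ltW.
apply: (le_trans (W1_le_cdf _ _)); apply: integral_le_of_J => //.
  have b1 := lb_u_of (rho T); have b2 := lb_u_of (rhoe T).
  rewrite (_ : (fun x => _) = (fun x => `|u_of (rho T) x - u_of (rhoe T) x|)); first by lbt.
  by apply/funext => x; rewrite distrC /u_of; congr (`|_|); ring.
move=> L L0.
rewrite (eq_J (g := fun x => `|u_of (rho T) x - u_of (rhoe T) x|)); last first.
  by move=> x _; rewrite distrC /u_of; congr (`|_|); ring.
apply: (le_trans (l1_gap_relaxation c12 eps0 sole sol T0 L0)).
apply: (@le_trans _ _ (6 * c * Num.sqrt (eps * T))); last first.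
  by rewrite ler_wpM2l ?mulr_ge0 ?(ltW c0)// lerDl ltW.
rewrite (_ : 2 * c ^+ 2 * eps * T = 2 * (c ^+ 2 * (eps * T))); last by ring.
rewrite sqrtrM// sqrtrM ?sqr_ge0// sqrtr_sqr ger0_norm ?(ltW c0)// !mulrA.
rewrite ler_wpM2r ?sqrtr_ge0// ler_wpM2r ?(ltW c0)//.
rewrite -(@ler_pXn2r _ 2)// ?nnegrE ?mulr_ge0 ?sqrtr_ge0//.
by rewrite exprMn sqr_sqrtr//; lra.
Qed.
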